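(* Let $f$ be a density supported on $\mathcal{S}_d$ such that $f\in C^2(\mathrm{Int}(\mathcal{S}_d))$ and such that there exist an open set $\mathcal{U}\subseteq\mathbb{R}^d$ containing $\mathcal{S}_d$ and an extension $f_{\mathrm{ext}}:\mathcal{U}\to\mathbb{R}$ with $f_{\mathrm{ext}}\equiv f$ on $\mathcal{S}_d$ and $f_{\mathrm{ext}}\in C^2(\mathcal{U})$. Let $\mathcal{J}\subseteq[d]$. For any $\boldsymbol{x}\in\mathcal{S}_d$ such that $x_i=\lambda_i/m$ for all $i\in\mathcal{J}$ (with $\lambda_i\ge0$ fixed for all $i\in\mathcal{J}$) and $x_i\in(0,1)$ is independent of $m$ for all $i\in[d]\backslash\mathcal{J}$, we have, as $n\to\infty$, $$\begin{aligned}\mathrm{MSE}(\widetilde f_{n,m}(\boldsymbol{x}))&=n^{-1}m^{(d+|\mathcal{J}|)/2}v_{\mathcal{J}}(\boldsymbol{x})+m^{-2}b_{\mathcal{J}}^2(\boldsymbol{x})\\&\quad+n^{-1}m^{(d+|\mathcal{J}|)/2}\big[\mathcal{O}_{\boldsymbol{\lambda}_{\mathcal{J}}}(m^{-1})+\mathrm{o}_{\boldsymbol{x}_{[d]\backslash\mathcal{J}}}(1)\mathbf{1}_{\{\mathcal{J}\ne[d]\}}\big]+\mathcal{O}_{\boldsymbol{\lambda}_{\mathcal{J}}}(m^{-3})+\mathrm{o}_{\boldsymbol{\lambda}_{\mathcal{J}}}(m^{-2})\mathbf{1}_{\{\mathcal{J}\ne[d]\}},\end{aligned}$$ where $$b_{\mathcal{J}}(\boldsymbol{x})=\sum_{i\in[d]}\big(\tfrac12-x_i\mathbf{1}_{\{i\in[d]\backslash\mathcal{J}\}}\big)\frac{\partial}{\partial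 x_i}f(\boldsymbol{x})\Big|_{\boldsymbol{x}_{\mathcal{J}}=\boldsymbol{0}}+\sum_{i,j\in[d]\backslash\mathcal{J}}\tfrac12\big(x_i\mathbf{1}_{\{i=j\}}-x_ix_j\big)\frac{\partial^2}{\partial x_i\partial x_j}f(\boldsymbol{x})\Big|_{\boldsymbol{x}_{\mathcal{J}}=\boldsymbol{0}},$$ $$v_{\mathcal{J}}(\boldsymbol{x})=f(\boldsymbol{x})\big|_{\boldsymbol{x}_{\mathcal{J}}=\boldsymbol{0}}\;\psi_{[d]\backslash\mathcal{J}}(\boldsymbol{x})\prod_{i\in\mathcal{J}}e^{-2\lambda_i}I_0(2\lambda_i).$$ If $b_{\mathcal{J}}(\boldsymbol{x})\ne0$, the asymptotically optimal choice of $m$, with respect to $\mathrm{MSE}$, is $$m_{\mathrm{opt}}=n^{\frac{2}{d+|\mathcal{J}|+4}}\frac{\{b_{\mathcal{J}}(\boldsymbol{x})\}^{\frac{4}{d+|\mathcal{J}|+4}}}{\big\{\frac{d+|\mathcal{J}|}{4}v_{\mathcal{J}}(\boldsymbol{x})\big\}^{\frac{2}{d+|\mathcal{J}|+4}}},$$ in which case, as $n\to\infty$, $$\begin{aligned}\mathrm{MSE}(\widetilde f_{n,m_{\mathrm{opt}}}(\boldsymbol{x}))&=n^{-\frac{4}{d+|\mathcal{J}|+4}}\frac{\{b_{\mathcal{J}}(\boldsymbol{x})\}^{\frac{2(d+|\mathcal{J}|)}{d+|\mathcal{J}|+4}}}{\left[\frac{\big(\frac{4}{d+|\mathcal{J}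|}\big)^{\frac{4}{d+|\mathcal{J}|+4}}}{\frac{4}{d+|\mathcal{J}|}+1}\right]\{v_{\mathcal{J}}(\boldsymbol{x})\}^{\frac{-4}{d+|\mathcal{J}|+4}}}\\&\quad+\mathcal{O}_{\boldsymbol{\lambda}_{\mathcal{J}},\boldsymbol{x}_{[d]\backslash\mathcal{J}}}\big(n^{-\frac{6}{d+|\mathcal{J}|+4}}+\mathbf{1}_{\{\mathcal{J}\ne[d]\}}n^{-\frac{5}{d+|\mathcal{J}|+4}}\big)+\mathrm{o}_{\boldsymbol{\lambda}_{\mathcal{J}}}\big(n^{-\frac{4}{d+|\mathcal{J}|+4}}\big)\mathbf{1}_{\{\mathcal{J}\ne[d]\}}.\end{aligned}$$
   Context: Let $d\ge1$, $[d]=\{1,\dots,d\}$, $\mathbb{N}_0=\{0,1,2,\dots\}$, $\|\boldsymbol{x}\|_1=\sum_{i=1}^d|x_i|$, $\mathcal{S}_d=\{\boldsymbol{x}\in[0,1]^d:\|\boldsymbol{x}\|_1\le1\}$, $\mathrm{Int}(\mathcal{S}_d)=\{\boldsymbol{x}\in(0,1)^d:\|\boldsymbol{x}\|_1<1\}$, and $m\mathcal{S}_d=\{m\boldsymbol{x}:\boldsymbol{x}\in\mathcal{S}_d\}$. For $\boldsymbol{k}\in\mathbb{N}_0^d\cap m\mathcal{S}_d$ the multinomial probabilities are $$P_{\boldsymbol{k},m}(\boldsymbol{x})=\frac{m!}{(m-\|\boldsymbol{k}\|_1)!\prod_{i=1}^dk_i!}(1-\|\boldsymbol{x}\|_1)^{m-\|\boldsymbol{k}\|_1}\prod_{i=1}^dx_i^{k_i}$$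 (with $0^0=1$). Let $\boldsymbol{X}_1,\dots,\boldsymbol{X}_n$ be i.i.d. with density $f$ supported on $\mathcal{S}_d$. The Bernstein density estimator is $$\widetilde f_{n,m}(\boldsymbol{x})=\sum_{\boldsymbol{k}\in\mathbb{N}_0^d\cap(m-1)\mathcal{S}_d}m^d\Big\{\frac1n\sum_{i=1}^n\mathbf{1}_{(\frac{\boldsymbol{k}}{m},\frac{\boldsymbol{k}+1}{m}]}(\boldsymbol{X}_i)\Big\}P_{\boldsymbol{k},m-1}(\boldsymbol{x}),\quad \boldsymbol{x}\in\mathcal{S}_d,$$ where $(\frac{\boldsymbol{k}}{m},\frac{\boldsymbol{k}+1}{m}]=(\frac{k_1}{m},\frac{k_1+1}{m}]\times\dots\times(\frac{k_d}{m},\frac{k_d+1}{m}]$. $\mathrm{MSE}(\widetilde f_{n,m}(\boldsymbol{x}))=\mathbb{E}[(\widetilde f_{n,m}(\boldsymbol{x})-f(\boldsymbol{x}))^2]$, the sum of the variance and the squared bias. The bandwidth $m=m(n)\in\mathbb{N}$ is a function of $n$ with $m\to\infty$ as $n\to\infty$. The asymptotically optimal choice of $m$ is the value minimizing the leading terms $n^{-1}m^{(d+|\mathcal{J}|)/2}v_{\mathcal{J}}(\boldsymbol{x})+m^{-2}b_{\mathcal{J}}^2(\boldsymbol{x})$ of the MSE; powers of $b_{\mathcal{J}}(\boldsymbol{x})$ are understood as powers of $b_{\mathcal{J}}^2(\boldsymbol{x})$, e.g. $\{b\}^{4/p}=(b^2)^{2/p}$. For $A\subseteq[d]$, $\boldsymbol{v}_A=(v_i)_{i\in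 A}$ and $\psi_A(\boldsymbol{x})=\big[(4\pi)^{|A|}(1-\sum_{i\in A}x_i)\prod_{i\in A}x_i\big]^{-1/2}$, with empty sum $0$ and empty product $1$. The notation $|_{\boldsymbol{x}_{\mathcal{J}}=\boldsymbol{0}}$ means evaluation at the point obtained from $\boldsymbol{x}$ by setting the coordinates with index in $\mathcal{J}$ to $0$. At boundary points of $\mathcal{S}_d$ the partial derivatives of $f$ mean those of $f_{\mathrm{ext}}$. $I_0(z)=\sum_{k=0}^\infty\frac{(z/2)^{2k}}{(k!)^2}$ is the modified Bessel function of the first kind of order $0$. $u=\mathcal{O}(v)$ means $\limsup|u/v|<C<\infty$ and $u=\mathrm{o}(v)$ means $\lim|u/v|=0$; the constant or rate may depend on $f$ and $d$ but on no other variable unless written as a subscript. *)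

(* Defs.v *)
(* R^d carries two (interconvertible) representations:
   points are row vectors 'rV[R]_d, which have the topology and the derivatives,
   and observations are tuples d.-tuple R, which have the Borel sigma-algebra. *)
From HB Require Import structures.
From mathcomp Require Import all_boot all_order all_algebra.
From mathcomp Require Import all_classical all_reals all_analysis.

Set Implicit Arguments.
Unset Strict Implicit.
Unset Printing Implicit Defensive.

Import Order.TTheory GRing.Theory Num.Theory.
Import numFieldNormedType.Exports.

Local Open Scope classical_set_scope.
Local Open Scope ring_scope.

Section Simplex.
Context {R : realType} {d : nat}.
Implicit Types (x lam : 'rV[R]_d) (J : {set 'I_d}).

Definition norm1 x : R := \sum_(i < d) `|x ord0 i|.

Definition simplex : set 'rV[R]_d :=
  [set x : 'rV[R]_d | (forall i, 0 <= x ord0 i <= 1) /\ norm1 x <= 1].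

Definition int_simplex : set 'rV[R]_d :=
  [set x : 'rV[R]_d | (forall i, 0 < x ord0 i < 1) /\ norm1 x < 1].

Definition partial (i : 'I_d) (g : 'rV[R]_d -> R) : 'rV[R]_d -> R :=
  fun x => 'D_(delta_mx ord0 i) g x.

(* Meant for open U: g is C^2 on U. *)
Definition C2_on (U : set 'rV[R]_d) (g : 'rV[R]_d -> R) : Prop :=
  forall x, U x ->
    {for x, continuous g} /\
    forall i, [/\ derivable g x (delta_mx ord0 i),
      {for x, continuous (partial i g)} &
      forall j, derivable (partial i g) x (delta_mx ord0 j) /\
                {for x, continuous (partial j (partial i g))}].

(* Only the coordinates of lam in J and those of x outside J are used. *)
Definition boundary_point J (m : nat) lam x : 'rV[R]_d :=
  \row_i (if i \in J then lam ord0 i / m%:R else x ord0 i).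

Definition zero_on J x : 'rV[R]_d := \row_i (if i \in J then 0 else x ord0 i).

(* The last condition says that psi, below, is finite at x. *)
Definition admissible J lam x : Prop :=
  [/\ forall i, i \in J -> 0 <= lam ord0 i,
      forall i, i \notin J -> 0 < x ord0 i < 1 &
      \sum_(i | i \notin J) x ord0 i < 1].

Definition psi (A : {set 'I_d}) x : R :=
  ((4 * pi) ^+ #|A| * (1 - \sum_(i in A) x ord0 i) * \prod_(i in A) x ord0 i)
    `^ (- 2^-1).

End Simplex.

Definition besselI0 {R : realType} (z : R) : R :=
  limn (series (fun k : nat => (z / 2) ^+ (2 * k) / (k`!%:R) ^+ 2)).

Section Density.
Context {R : realType}.

Definition row_of_tuple {d} (t : d.-tuple R) : 'rV[R]_d := \row_i tnth t i.

(* Integral over R^d with respect to Lebesgue measure, as an iterated integral;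
   it is applied to nonnegative Borel functions only (Tonelli). *)
Fixpoint integral_tuple (d : nat) : (d.-tuple R -> \bar R) -> \bar R :=
  match d with
  | 0 => fun g => g [tuple]
  | d'.+1 => fun g =>
      (\int[lebesgue_measure]_(s in [set: R])
         integral_tuple (fun t : d'.-tuple R => g (cons_tuple s t)))%E
  end.

Definition simplex_density {d} (f : 'rV[R]_d -> R) : Prop :=
  [/\ measurable_fun [set: d.-tuple R] (f \o row_of_tuple),
      forall x, 0 <= f x,
      forall x, ~ simplex x -> f x = 0 &
      integral_tuple (fun t : d.-tuple R => (f (row_of_tuple t))%:E) = 1%E].

Context {disp : measure_display} {T : measurableType disp}.

Definition has_density {d} (P : probability T R) (X : {RV P >-> d.-tuple R})
    (f : 'rV[R]_d -> R) : Prop :=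
  forall A : set (d.-tuple R), measurable A ->
    distribution P X A =
    integral_tuple (fun t : d.-tuple R => (f (row_of_tuple t) * \1_A t)%:E).

(* Subfamilies are obtained by taking some of the B i equal to the full set. *)
Definition independent_seq {d} (P : probability T R)
    (X : nat -> {RV P >-> d.-tuple R}) : Prop :=
  forall (n : nat) (B : nat -> set (d.-tuple R)),
    (forall i, measurable (B i)) ->
    P (\bigcap_(i in `I_n) (X i @^-1` B i)) =
    (\prod_(i < n) P (X i @^-1` B i))%E.

Definition iid_density {d} (P : probability T R)
    (X : nat -> {RV P >-> d.-tuple R}) (f : 'rV[R]_d -> R) : Prop :=
  independent_seq X /\ forall i, has_density (X i) f.

End Density.

Section Estimator.
Context {R : realType} {d : nat}.

Definition multinomial_prob (k : 'I_d -> nat) (m : nat) (x : 'rV[R]_d) : R :=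
  m`!%:R / ((m - \sum_i k i)`!%:R * \prod_i (k i)`!%:R)
  * (1 - norm1 x) ^+ (m - \sum_i k i) * \prod_i x ord0 i ^+ k i.

Definition cell (m : nat) (k : 'I_d -> nat) : set (d.-tuple R) :=
  [set t | forall i, (k i)%:R / m%:R < tnth t i <= (k i).+1%:R / m%:R].

Context {disp : measure_display} {T : measurableType disp}.

(* The sample is X 0, ..., X n.-1; the index k ranges over the points of N^d
   with sum at most m - 1, each coordinate of which is < m. *)
Definition bernstein_estimator (P : probability T R)
    (X : nat -> {RV P >-> d.-tuple R}) (n m : nat) (x : 'rV[R]_d) (w : T) : R :=
  \sum_(k : {ffun 'I_d -> 'I_m} | (\sum_i k i <= m.-1)%N)
    m%:R ^+ d * (n%:R^-1 * \sum_(i < n) \1_(cell m (fun j => k j)) (X i w))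
    * multinomial_prob (fun j => k j) m.-1 x.

Definition MSE (P : probability T R) (X : nat -> {RV P >-> d.-tuple R})
    (f : 'rV[R]_d -> R) (n m : nat) (x : 'rV[R]_d) : \bar R :=
  ('E_P[fun w => ((bernstein_estimator X n m x w - f x) ^+ 2 : R)%R])%E.

End Estimator.

Section LeadingTerms.
Context {R : realType} {d : nat}.
Implicit Types (f fext : 'rV[R]_d -> R) (J : {set 'I_d}) (lam x : 'rV[R]_d).

(* The partial derivatives are those of the extension fext of the density. *)
Definition bcoef fext J x : R :=
  \sum_(i < d) (2^-1 - x ord0 i * (i \notin J)%:R)
    * partial i fext (zero_on J x)
  + \sum_(i | i \notin J) \sum_(j | j \notin J)
      2^-1 * (x ord0 i * (i == j)%:R - x ord0 i * x ord0 j)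
      * partial i (partial j fext) (zero_on J x).

Definition vcoef f J lam x : R :=
  f (zero_on J x) * psi (~: J)%SET x
  * \prod_(i in J) (expR (- 2 * lam ord0 i) * besselI0 (2 * lam ord0 i)).

Definition MSE_lead f fext J lam x (n : nat) (t : R) : R :=
  n%:R^-1 * t `^ ((d + #|J|)%:R / 2) * vcoef f J lam x
  + t ^- 2 * bcoef fext J x ^+ 2.

(* Powers of the (possibly negative) coefficient b are powers of b ^+ 2. *)
Definition m_opt f fext J lam x (n : nat) : R :=
  let q : R := (d + #|J|)%:R in
  n%:R `^ (2 / (q + 4))
  * ((bcoef fext J x ^+ 2) `^ (2 / (q + 4))
     / (q / 4 * vcoef f J lam x) `^ (2 / (q + 4))).

Definition MSE_opt f fext J lam x (n : nat) : R :=
  let q : R := (d + #|J|)%:R in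
  n%:R `^ (- (4 / (q + 4)))
  * ((bcoef fext J x ^+ 2) `^ (q / (q + 4))
     / ((4 / q) `^ (4 / (q + 4)) / (4 / q + 1)
        * vcoef f J lam x `^ (- 4 / (q + 4)))).

End LeadingTerms.

Section Asymptotics.
Context {R : realType} {L Y : Type}.

(* O and o as n tends to infinity, with subscript variable l: the constant and
   the threshold on n may depend on l, but they are uniform in y. *)
Definition bigO_unif (C : L -> R) (D : L -> Y -> Prop)
    (u : L -> Y -> nat -> R) (v : nat -> R) : Prop :=
  forall l, \forall n \near \oo,
    forall y, D l y -> `|u l y n| <= C l * `|v n|.

Definition littleo_unif (D : L -> Y -> Prop)
    (u : L -> Y -> nat -> R) (v : nat -> R) : Prop :=
  forall l (e : R), 0 < e -> \forall n \near \oo,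
    forall y, D l y -> `|u l y n| <= e * `|v n|.

End Asymptotics.

(* Main.v *)
Require Import Defs.
From HB Require Import structures.
From mathcomp Require Import all_boot all_order all_algebra.
From mathcomp Require Import all_classical all_reals all_analysis.
From mathcomp Require Import measurable_realfun.
From mathcomp Require Import ring lra zify.

Set Implicit Arguments.
Unset Strict Implicit.
Unset Printing Implicit Defensive.

Import Order.TTheory GRing.Theory Num.Theory.
Import numFieldNormedType.Exports.

Local Open Scope classical_set_scope.
Local Open Scope ring_scope.

(** Write W k for the multinomial weight P_(k,m-1)(x) and q k for the mean value
    of f over the cell k. The expectation of the estimator is the average of q
    with the weights W. As the cells are disjoint and the observations are
    independent, its variance is n^-1 (m^d sum_k q k (W k)^2 - (sum_k q k W k)^2);
    this is MSE_bernstein, and it leaves two purely analytic questions.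

    Bias. The midpoint of the cell k is an affine function of a multinomial
    vector, so that its first two moments around x are explicit. A second order
    Taylor expansion of f around x, in which a cell contributes through its
    midpoint only, turns these moments into b / m, and the expansion fails only
    on an exponentially small tail (bernstein_bias_bound, cvg_bias).

    Variance. Replacing q k by f x, which is legitimate because W concentrates,
    leaves the sum of the (W k)^2, the probability that two independent
    multinomial vectors collide. Coordinates of the form lam / m are
    asymptotically Poissonian and contribute the collision probability
    exp(-2 lam) I_0(2 lam) of two Poisson variables. The difference of two
    binomial variables is a lazy random walk, whose return probability is given
    by Wallis' formula; conditioning on one coordinate at a time yields the factor
    psi (cvg_multinomial_collision, cvg_variance). When all the coordinates
    are Poissonian, a total variation bound gives the rate O(1 / m)
    (multinomial_collision_poisson, full_errors).

    Uniformity. The limits are proved along arbitrary filters of parameters.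
    By compactness, along ultrafilters, they are uniform as long as the
    parameters lam and x stay in a compact part of the admissible set
    (uniform_errors). Letting this compact part grow slowly with m
    (diagonal_threshold) distributes the error among the remainder terms:
    for every fixed lam, or every fixed x, the parameters that escape the compact
    part matter for finitely many n only.

    Optimal bandwidth. At the optimum m_opt the two leading terms are in the
    proportion 4 : q, where q = d + |J|. In terms of the ratio r = m / m_opt the
    leading part of the error is therefore proportional to
    (4 / q) r^(q/2) + r^-2, which is minimal at r = 1 by convexity in ln r and
    Lipschitz near 1; rounding m_opt changes r by at most 1 / m_opt. *)

(** * Sums over multi-indices and multinomial weights *)

(** Lists, rather than finite functions, make the removal of the first coordinate
    a case of the same problem in dimension d - 1. *)
Fixpoint multi_indices (d m : nat) : seq (seq nat) :=
  if d is d'.+1 then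
    flatten [seq [seq k :: ks | ks <- multi_indices d' (m - k)]
            | k <- iota 0 m.+1]
  else [:: [::]].

Lemma multi_indicesS d m :
  multi_indices d.+1 m =
  flatten [seq [seq k :: ks | ks <- multi_indices d (m - k)] | k <- iota 0 m.+1].
Proof. by []. Qed.

Lemma mem_multi_indices d m ks :
  (ks \in multi_indices d m) = (size ks == d) && (sumn ks <= m)%N.
Proof.
elim: d m ks => [|d IH] m ks; first by rewrite inE; case: ks.
rewrite multi_indicesS; apply/flatten_mapP/andP => [[k + /mapP[ks' + ->]]|].
  by rewrite mem_iota IH => ? => /andP[/eqP <- le_ks]; split => //=; lia.
case: ks => [[]//|k ks [/= sz_ks le_ks]]; exists k.
  by rewrite -/(iota 0 m.+1) mem_iota; lia.
apply/map_f; rewrite IH; apply/andP; split; first by rewrite -eqSS.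
by rewrite leq_subRL //; lia.
Qed.

Lemma multi_indices_uniq d m : uniq (multi_indices d m).
Proof.
elim: d m => [|d IH] m //; rewrite multi_indicesS.
have iota_u := iota_uniq 0 m.+1.
elim: (iota 0 m.+1) iota_u => [|k l IHl] //= /andP[k_l l_u].
rewrite cat_uniq IHl // andbT map_inj_uniq ?IH /=; last by move=> ? ? [].
apply/hasPn => ks /flatten_mapP[k' k'_l /mapP[ks' _ ->]].
by apply/mapP => -[ks'' _ [ekk' _]]; move: k_l; rewrite -ekk' k'_l.
Qed.

Lemma big_multi_indices0 (V : nmodType) m (g : seq nat -> V) :
  \sum_(ks <- multi_indices 0 m) g ks = g [::].
Proof. by rewrite big_seq1. Qed.

Lemma big_multi_indicesS (V : nmodType) d m (g : seq nat -> V) :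
  \sum_(ks <- multi_indices d.+1 m) g ks =
  \sum_(k < m.+1) \sum_(ks <- multi_indices d (m - k)) g ((k : nat) :: ks).
Proof.
rewrite multi_indicesS big_flatten big_map -[X in iota 0 X]subn0 -/(index_iota 0 m.+1).
rewrite (big_mkord xpredT (fun k => \sum_(ks <- [seq k :: ks
  | ks <- multi_indices d (m - k)]) g ks)).
by apply: eq_bigr => k _; rewrite big_map.
Qed.

Lemma big_ffun_multi_indices (V : nmodType) d n r (g : seq nat -> V) :
  (r < n)%N ->
  \sum_(k : {ffun 'I_d -> 'I_n} | (\sum_i k i <= r)%N)
    g [seq (k i : nat) | i <- enum 'I_d] =
  \sum_(ks <- multi_indices d r) g ks.
Proof.
move=> r_n.
set h := fun k : {ffun 'I_d -> 'I_n} => [seq (k i : nat) | i <- enum 'I_d].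
rewrite (perm_big [seq h k | k <- [seq k <- index_enum _ |
  (\sum_(i < d) (k : {ffun 'I_d -> 'I_n}) i <= r)%N]]) /=; last first.
  apply: uniq_perm; last 1 first.
  - move=> ks; rewrite mem_multi_indices.
    apply/andP/mapP => [[/eqP sz_ks le_ks]|[k + ->]]; last first.
      rewrite mem_filter => /andP[le_k _].
      by rewrite size_map size_enum_ord sumnE big_map big_enum.
    have lt_ks (i : 'I_d) : (nth 0 ks i < n)%N.
      apply: leq_ltn_trans r_n; apply: leq_trans le_ks.
      by rewrite sumnE (big_nth 0) big_mkord (bigD1 (cast_ord (esym sz_ks) i))
                 //= leq_addr.
    exists [ffun i => Ordinal (lt_ks i)].
      rewrite mem_filter mem_index_enum andbT; apply: leq_trans le_ks.
      rewrite sumnE (big_nth 0) big_mkord sz_ks.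
      by under eq_bigr do rewrite ffunE.
    apply: (@eq_from_nth _ 0%N) => [|i]; first by rewrite size_map size_enum_ord.
    rewrite sz_ks => i_d.
    by rewrite (nth_map (Ordinal i_d)) ?size_enum_ord // ffunE /= nth_enum_ord.
  - exact: multi_indices_uniq.
  - rewrite map_inj_uniq ?filter_uniq ?index_enum_uniq // => k1 k2 eq_k.
    apply/ffunP => i; apply/val_inj => /=.
    have /(congr1 (fun s => nth 0%N s i)) := eq_k.
    have nth_h k : nth 0%N (h k) i = k i.
      by rewrite (nth_map i) ?size_enum_ord // nth_ord_enum.
    by rewrite !nth_h.
by rewrite big_map big_filter.
Qed.

(** The multinomial coefficient is built one coordinate at a time, which suits
    induction over the dimension; mweightE is the closed form. *)
Fixpoint mweight (R : comNzRingType) (m : nat) (a : R) (s : seq R)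
    (ks : seq nat) : R :=
  match s, ks with
  | x :: s', k :: ks' => 'C(m, k)%:R * x ^+ k * mweight (m - k) a s' ks'
  | _, _ => a ^+ m
  end.

Lemma sum_mweight (R : comNzRingType) m (a : R) s :
  \sum_(ks <- multi_indices (size s) m) mweight m a s ks =
  (a + \sum_(x <- s) x) ^+ m.
Proof.
elim: s m => [|x s IH] m; first by rewrite big_multi_indices0 big_nil addr0.
rewrite big_multi_indicesS big_cons addrCA addrC exprDn.
apply: eq_bigr => k _ /=; rewrite -mulr_sumr IH.
by rewrite -[in RHS]mulr_natl -mulrA [X in _ * X]mulrC.
Qed.

Lemma big_mkseq (V : nmodType) (f : nat -> V) n :
  \sum_(x <- mkseq f n) x = \sum_(i < n) f i.
Proof. by rewrite big_map -{1}(subn0 n) -/(index_iota 0 n) big_mkord. Qed.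

Lemma mweight_scale (R : comNzRingType) m (a : R) s (c : nat -> R) ks :
  size ks = size s ->
  mweight m a (mkseq (fun i => c i * s`_i) (size s)) ks =
  mweight m a s ks * \prod_(i < size s) c i ^+ nth 0 ks i.
Proof.
elim: s m c ks => [|x s IH] m c [|k ks] //= => [_|[sz]].
  by rewrite big_ord0 mulr1.
rewrite big_ord_recl /=.
have := IH (m - k)%N (fun i => c i.+1) _ sz; rewrite /mkseq => eqIH.
rewrite -[iota 1 _]/(iota (1 + 0) _) iotaDl -map_comp exprMn.
by rewrite [mweight _ _ _ _]eqIH; ring.
Qed.

Lemma mweight_rmorph (R S : comNzRingType) (h : {rmorphism R -> S}) m a s ks :
  h (mweight m a s ks) = mweight m (h a) (map h s) ks.
Proof.
elim: s m ks => [|x s IH] m [|k ks] /=; rewrite ?rmorphXn //.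
by rewrite !rmorphM IH rmorphXn rmorph_nat.
Qed.

Lemma coef_linear_exp (R : comNzRingType) (a b : R) m r :
  ((a%:P + b%:P * 'X) ^+ m)`_r = 'C(m, r)%:R * a ^+ (m - r) * b ^+ r.
Proof.
rewrite exprDn coef_sum; have [r_m|m_r] := leqP r m.
  rewrite (bigD1 (Ordinal (r_m : (r < m.+1)%N))) //= big1 => [|i ne_ir].
    rewrite addr0 coefMn exprMn -!rmorphXn /= coefCM coefCM coefXn eqxx mulr1.
    by rewrite -[LHS]mulr_natl mulrA.
  rewrite coefMn exprMn -!rmorphXn /= coefCM coefCM coefXn.
  case: eqP => [eq_r|_]; last by rewrite !mulr0 mul0rn.
  by case/eqP: ne_ir; apply/val_inj.
rewrite bin_small // mul0r mul0r big1 // => i _.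
rewrite coefMn exprMn -!rmorphXn /= coefCM coefCM coefXn.
by case: eqP (ltn_ord i) => [<-|_ _]; [lia | rewrite !mulr0 mul0rn].
Qed.

(** The factorial moments of a sum of multinomial coordinates are read off the
    multinomial theorem in the ring of polynomials: scaling the selected
    coordinates by 1 + 'X turns the weight of ks into a generating polynomial
    of the binomial coefficients. *)
Lemma mweight_binomial_moment (R : comNzRingType) m (a : R) s (b : nat -> bool)
    r :
  a + \sum_(x <- s) x = 1 ->
  \sum_(ks <- multi_indices (size s) m)
    mweight m a s ks * 'C(\sum_(i < size s | b i) nth 0 ks i, r)%:R =
  'C(m, r)%:R * (\sum_(i < size s | b i) s`_i) ^+ r.
Proof.
move=> sum1.
pose c i : {poly R} := if b i then 1%:P + 1%:P * 'X else 1.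
have := sum_mweight m a%:P (mkseq (fun i => c i * (map polyC s)`_i) (size s)).
rewrite size_mkseq big_mkseq.
rewrite (_ : a%:P + _ = 1%:P + (\sum_(i < size s | b i) s`_i)%:P * 'X).
  move=> /(congr1 (fun p : {poly R} => p`_r)); rewrite coef_linear_exp.
  rewrite expr1n mulr1 => <-; rewrite coef_sum; apply: eq_big_seq => ks.
  rewrite mem_multi_indices => /andP[/eqP sz_ks _].
  have := mweight_scale m a%:P c (s := map polyC s) (ks := ks).
  rewrite size_map => -> //; rewrite -(mweight_rmorph (@polyC R)) coefCM.
  congr (_ * _).
  rewrite (_ : \prod_(i < _) _ =
     (1%:P + 1%:P * 'X) ^+ \sum_(i < size s | b i) nth 0 ks i).
    by rewrite coef_linear_exp !expr1n !mulr1.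
  rewrite expr_sum [RHS]big_mkcond /=; apply: eq_bigr => i _; rewrite /c.
  by case: ifP => // _; rewrite expr1n.
rewrite -sum1 (big_nth 0) big_mkord !rmorphD !rmorph_sum /= -addrA; congr (_ + _).
rewrite mulr_suml [X in _ + X]big_mkcond /= -big_split /=.
apply: eq_bigr => i _; rewrite (nth_map 0) // /c.
by case: ifP => _; [rewrite mulrDl !mul1r mulrC|rewrite mul1r addr0].
Qed.

Lemma mweight_ge0 (R : numDomainType) m (a : R) s ks :
  0 <= a -> all (fun x => 0 <= x) s -> 0 <= mweight m a s ks.
Proof.
move=> a0; elim: s m ks => [|x s IH] m [|k ks] /= => [_|_|_|/andP[x0 s0]];
  rewrite ?exprn_ge0 //.
by rewrite mulr_ge0 ?IH // mulr_ge0 ?exprn_ge0 ?ler0n.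
Qed.

Lemma mweightE (R : numFieldType) m (a : R) s ks :
  size ks = size s -> (sumn ks <= m)%N ->
  mweight m a s ks =
  m`!%:R / ((m - sumn ks)`!%:R * \prod_(i < size s) (nth 0 ks i)`!%:R) *
  a ^+ (m - sumn ks) * \prod_(i < size s) s`_i ^+ nth 0 ks i.
Proof.
have fact_neq0 n : n`!%:R != 0 :> R by rewrite pnatr_eq0 -lt0n fact_gt0.
elim: s m ks => [|x s IH] m [|k ks] //= => [_ _|[sz] le_m].
  by rewrite !big_ord0 subn0 !mulr1 mulfV ?mul1r.
rewrite IH //; last by lia.
rewrite !big_ord_recl /= subnDA.
have -> : m`!%:R = 'C(m, k)%:R * (k`!%:R * (m - k)`!%:R) :> R.
  by rewrite -!natrM bin_fact //; lia.
have : \prod_(i < size s) (nth 0 ks i)`!%:R != 0 :> R.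
  by apply/prodf_neq0 => i _; exact: fact_neq0.
move: (fact_neq0 k) (fact_neq0 (m - k - sumn ks)%N).
rewrite -!/(bump 0 _) => *; field.
by apply/and3P; split.
Qed.

Section MultinomialDistribution.
Context {R : realType}.
Variables (N : nat) (a : R) (s : seq R).
Hypothesis sum1 : a + \sum_(x <- s) x = 1.
Let P := mweight N a s.
Let idx := multi_indices (size s) N.

Lemma mweight_mass1 : \sum_(ks <- idx) P ks = 1.
Proof. by rewrite sum_mweight sum1 expr1n. Qed.

Lemma mweight_binomial2 (n : nat) : 'C(n, 2)%:R *+ 2 = n%:R * (n%:R - 1) :> R.
Proof.
case: n => [|n]; first by rewrite bin_small // mul0rn mul0r.
by rewrite -mulrnA mulnC -mul_bin_diag bin1 natrM -natr1 addrK.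
Qed.

Lemma mweight_moment1 i : (i < size s)%N ->
  \sum_(ks <- idx) P ks * (nth 0%N ks i)%:R = N%:R * s`_i.
Proof.
move=> i_s; have := mweight_binomial_moment N (pred1 i) 1 sum1.
rewrite (big_pred1 (Ordinal i_s)) // expr1 bin1 => <-.
by apply: eq_bigr => ks _; rewrite (big_pred1 (Ordinal i_s)) // bin1.
Qed.

Lemma mweight_moment2 i j : (i < size s)%N -> (j < size s)%N ->
  \sum_(ks <- idx) P ks * ((nth 0%N ks i)%:R * (nth 0%N ks j)%:R) =
  N%:R * (N%:R - 1) * (s`_i * s`_j) + N%:R * s`_i * (i == j)%:R.
Proof.
move=> i_s j_s; pose E g := \sum_(ks <- idx) P ks * g ks.
have E2 k : (k < size s)%N ->
    E (fun ks => 'C(nth 0%N ks k, 2)%:R) = 'C(N, 2)%:R * s`_k ^+ 2.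
  move=> k_s; have := mweight_binomial_moment N (pred1 k) 2 sum1.
  rewrite (big_pred1 (Ordinal k_s)) // => <-.
  by apply: eq_bigr => ks _; rewrite (big_pred1 (Ordinal k_s)).
have [eq_ij|ne_ij] := eqVneq i j; last first.
  have sum2 (V : nmodType) (f : nat -> V) :
      \sum_(k < size s | pred2 i j k) f k = f i + f j.
    rewrite (bigD1 (Ordinal i_s)) /=; last by rewrite eqxx.
    congr (_ + _); rewrite (big_pred1 (Ordinal j_s)) // => k /=.
    rewrite andb_orl -[k == Ordinal i_s]/(k == i :> nat) andbN /=.
    by rewrite -[k == Ordinal j_s]/(k == j :> nat); case: eqP => // ->;
      rewrite eq_sym ne_ij.
  have := mweight_binomial_moment N (pred2 i j) 2 sum1.
  rewrite sum2 sqrrD mulrDr mulrDr -[X in X + _ + _]E2 // -[X in _ + _ + X]E2 //.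
  rewrite (eq_bigr (fun ks => P ks * 'C(nth 0%N ks i, 2)%:R +
     P ks * ((nth 0%N ks i)%:R * (nth 0%N ks j)%:R) +
     P ks * 'C(nth 0%N ks j, 2)%:R)); last first.
    move=> ks _; rewrite sum2 -!mulrDr; congr (_ * _).
    have two0 : 2 != 0 :> R by [].
    apply: (mulIf two0); rewrite !mulrDl !mulr_natr !mweight_binomial2 natrD.
    by ring.
  rewrite !big_split /= -!/(E _) => /addIr /addrI eq_ij.
  by rewrite [LHS]eq_ij mulr0 addr0 mulrnAr -mulrnAl mweight_binomial2.
rewrite -eq_ij mulr1.
rewrite (eq_bigr (fun ks => P ks * 'C(nth 0%N ks i, 2)%:R *+ 2 +
     P ks * (nth 0%N ks i)%:R)); last first.
  move=> ks _; rewrite -mulrnAr -mulrDr mweight_binomial2; congr (_ * _); ring.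
rewrite big_split /= mweight_moment1 // sumrMnl.
by have := E2 _ i_s; rewrite /E => ->; rewrite -mulrnAl mweight_binomial2 expr2.
Qed.

Lemma mweight_mgf i c : (i < size s)%N ->
  \sum_(ks <- idx) P ks * c ^+ nth 0%N ks i = (1 + (c - 1) * s`_i) ^+ N.
Proof.
move=> i_s; pose C k := if k == i then c else 1.
have Ci : C i = c by rewrite /C eqxx.
have := sum_mweight N a (mkseq (fun k => C k * s`_k) (size s)).
rewrite size_mkseq big_mkseq (bigD1 (Ordinal i_s)) //= Ci.
rewrite (_ : a + _ = 1 + (c - 1) * s`_i); last first.
  have -> : 1 + (c - 1) * s`_i = a + \sum_(x <- s) x + (c - 1) * s`_i.
    by rewrite sum1.
  rewrite (big_nth 0) big_mkord [in RHS](bigD1 (Ordinal i_s)) //=.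
  rewrite [X in a + (_ + X)](eq_bigr (fun k : 'I_(size s) => s`_k)).
    by ring.
  by move=> k ne_ki; rewrite /C ifN ?mul1r.
move=> <-; apply: eq_big_seq => ks; rewrite mem_multi_indices.
case/andP => /eqP sz_ks _; rewrite mweight_scale //; congr (_ * _).
rewrite (bigD1 (Ordinal i_s)) //= Ci big1 ?mulr1 // => k ne_ki.
by rewrite /C ifN ?expr1n.
Qed.

Hypothesis a_ge0 : 0 <= a.
Hypothesis s_ge0 : all (fun x => 0 <= x) s.

Lemma mweight_nth_bounds i : 0 <= s`_i <= 1.
Proof.
have [i_s|s_i] := ltnP i (size s); last by rewrite nth_default // lexx ler01.
have s_i0 : 0 <= s`_i by move/all_nthP: s_ge0; exact.
rewrite s_i0 /= -sum1 (big_nth 0) big_mkord (bigD1 (Ordinal i_s)) //= addrCA.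
rewrite lerDl addr_ge0 // sumr_ge0 // => k _.
by move/all_nthP: s_ge0; exact.
Qed.

(** A quadratic upper bound on the exponential, valid on half lines because
    expR y is the inverse of expR (- y), which is at least 1 - y. *)
Lemma expR_le_quadratic (y : R) : y <= 2^-1 -> expR y <= 1 + y + 2 * y ^+ 2.
Proof.
move=> y_le; have y1 : 0 < 1 - y by lra.
have : 1 - y <= expR (- y) by rewrite -[X in X <= _]/(1 + - y) expR_ge1Dx.
rewrite expRN => le1; rewrite -[leLHS]invrK.
have : (expR y)^-1 ^-1 <= (1 - y)^-1 by rewrite lef_pV2 ?posrE ?invr_gt0 ?expR_gt0.
move=> /le_trans; apply; rewrite -[X in X <= _]mul1r ler_pdivrMr //; nra.
Qed.

(** Chernoff's method with the parameter t := +-delta / 4, which is where the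
    constant 8 comes from. *)
Lemma mweight_tail i (delta : R) : (i < size s)%N -> 0 < delta <= 2 ->
  \sum_(ks <- idx | delta * N%:R < `|(nth 0%N ks i)%:R - N%:R * s`_i|) P ks
  <= 2 * expR (- (N%:R * delta ^+ 2 / 8)).
Proof.
move=> i_s /andP[d0 d2].
have [x0 x1] : 0 <= s`_i /\ s`_i <= 1 by apply/andP/mweight_nth_bounds.
set x := s`_i in x0 x1 *.
have P0 ks : 0 <= P ks by exact: mweight_ge0.
pose W (t : R) := \sum_(ks <- idx)
  P ks * expR (t * ((nth 0%N ks i)%:R - N%:R * x) - delta ^+ 2 / 4 * N%:R).
have W_le (t : R) : `|t| = delta / 4 -> W t <= expR (- (N%:R * delta ^+ 2 / 8)).
  move=> t_d; have t2 : t ^+ 2 = delta ^+ 2 / 16.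
    by rewrite -real_normK ?num_real // t_d; field.
  have -> : W t = expR (- (t * N%:R * x) - delta ^+ 2 / 4 * N%:R) *
                  (1 + (expR t - 1) * x) ^+ N.
    rewrite -mweight_mgf // mulr_sumr; apply: eq_bigr => ks _.
    rewrite -expRM_natl mulrCA -expRD; congr (_ * expR _); ring.
  have t_le : t <= 2^-1 by move: (ler_norm t); rewrite t_d; lra.
  have base0 : 0 <= 1 + (expR t - 1) * x.
    by have := expR_gt0 t; nra.
  have base_le : 1 + (expR t - 1) * x <= expR ((t + 2 * t ^+ 2) * x).
    apply: le_trans (expR_ge1Dx _); rewrite lerD2l ler_wpM2r //.
    by have := expR_le_quadratic t_le; lra.
  apply: le_trans (_ : expR (- (t * N%:R * x) - delta ^+ 2 / 4 * N%:R) *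
    expR ((t + 2 * t ^+ 2) * x) ^+ N <= _).
    by rewrite ler_wpM2l ?expR_ge0 // lerXn2r // nnegrE expR_ge0.
  rewrite -expRM_natl -expRD ler_expR t2.
  have -> : - (t * N%:R * x) - delta ^+ 2 / 4 * N%:R +
     N%:R * ((t + 2 * (delta ^+ 2 / 16)) * x) =
     N%:R * (delta ^+ 2 / 8) * x - 2 * (N%:R * (delta ^+ 2 / 8)) by field.
  have : 0 <= N%:R * (delta ^+ 2 / 8).
    by rewrite mulr_ge0 // divr_ge0 ?sqr_ge0.
  by nra.
have -> : 2 * expR (- (N%:R * delta ^+ 2 / 8)) =
   expR (- (N%:R * delta ^+ 2 / 8)) + expR (- (N%:R * delta ^+ 2 / 8)).
  by rewrite mulrDl mul1r.
apply: le_trans (lerD (W_le (delta / 4) _) (W_le (- (delta / 4)) _)).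
- rewrite -big_split /= big_mkcond; apply: ler_sum => ks _.
  rewrite -mulrDr; case: ifP => [dev|_]; last first.
    by rewrite mulr_ge0 // addr_ge0 // expR_ge0.
  rewrite -[X in X <= _]mulr1 ler_wpM2l //.
  set D := _ - _ in dev *.
  have := expR_ge1Dx (delta / 4 * D - delta ^+ 2 / 4 * N%:R).
  have := expR_ge1Dx (- (delta / 4) * D - delta ^+ 2 / 4 * N%:R).
  have := expR_ge0 (delta / 4 * D - delta ^+ 2 / 4 * N%:R).
  have := expR_ge0 (- (delta / 4) * D - delta ^+ 2 / 4 * N%:R).
  have dD : 0 <= delta / 4 * (`|D| - delta * N%:R).
    by rewrite mulr_ge0 ?subr_ge0 ?ltW // divr_gt0.
  move: D dD {dev} => D; have [pos|neg] := leP 0 D.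
    by rewrite ger0_norm //; lra.
  by rewrite ltr0_norm //; lra.
- by rewrite gtr0_norm // divr_gt0.
- by rewrite normrN gtr0_norm // divr_gt0.
Qed.

End MultinomialDistribution.

(** * Collisions of two independent binomial variables *)

(** Two independent copies of a binomial variable differ by a lazy random walk.
    Algebraically, (a + b z) (a z + b) = (a - b)^2 z + a b (1 + z)^2, and the
    identity compares the coefficients of z^N in the N-th powers. *)
Lemma sum_binomial_sqr (R : comNzRingType) N (a b : R) :
  \sum_(k < N.+1) ('C(N, k)%:R * b ^+ k * a ^+ (N - k)) ^+ 2 =
  \sum_(j < N.+1) 'C(N, j)%:R * (a * b) ^+ j * ((a - b) ^+ 2) ^+ (N - j)
                  * 'C(j.*2, j)%:R.
Proof.
pose p := (a%:P + b%:P * 'X) ^+ N * (b%:P + a%:P * 'X) ^+ N.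
transitivity p`_N.
  rewrite coefM; apply: eq_bigr => -[k k_N] _ /=.
  rewrite !coef_linear_exp bin_sub // subKn // expr2; ring.
have -> : p = (((a - b) ^+ 2)%:P * 'X + (a * b)%:P * (1%:P + 1%:P * 'X) ^+ 2) ^+ N.
  by rewrite /p -exprMn; congr (_ ^+ _); rewrite expr2 !polyCM !polyCB polyC1; ring.
rewrite exprDn coef_sum; apply: eq_bigr => -[j j_N] _ /=.
rewrite [X in X * _]exprMn [X in _ * X]exprMn -2!polyC_exp -exprM.
rewrite coefMn mulrACA -polyCM [X in _ * X]mulrC coefCM coefMXn -exprM.
rewrite ltnNge leq_subr /= subKn // coef_linear_exp.
rewrite !expr1n !mulr1 mul2n -[LHS]mulr_natl.
by rewrite mul2n; move: (_ ^+ (N - j).*2) (_ ^+ j) => u v; ring.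
Qed.

Section Wallis.
Context {R : realType}.
Notation mu := (@lebesgue_measure R).

Definition wallis n : R := \int[mu]_(x in `[0, pi / 2]) cos x ^+ n.

Lemma continuous_cosX n : continuous (fun x : R => cos x ^+ n).
Proof.
move=> x; apply: (@continuous_comp _ _ _ cos (fun y : R => y ^+ n)).
  exact: continuous_cos.
exact: exprn_continuous.
Qed.

Lemma continuous_segment_integrable (f : R -> R) a b :
  continuous f -> mu.-integrable `[a, b] (EFin \o f).
Proof.
move=> cf; apply: continuous_compact_integrable; first exact: segment_compact.
exact/continuous_subspaceT.
Qed.

Lemma integrable_cosX n :
  mu.-integrable `[0, pi / 2] (EFin \o (fun x : R => cos x ^+ n)).
Proof. exact/continuous_segment_integrable/continuous_cosX. Qed.

Lemma wallis_FTC (f F : R -> R) : continuous f ->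
  (forall x : R, is_derive x 1 F (f x)) ->
  \int[mu]_(x in `[0, pi / 2]) f x = F (pi / 2) - F 0.
Proof.
move=> cf dF; rewrite /Rintegral (continuous_FTC2 (F := F)) //.
- by rewrite divr_gt0 ?pi_gt0.
- exact/continuous_subspaceT.
- have cF : continuous F.
    by move=> x; apply/differentiable_continuous/derivable1_diffP; case: (dF x).
  split => [x _||]; first by case: (dF x).
  - exact/cvg_at_right_filter/cF.
  - exact/cvg_at_left_filter/cF.
- by move=> x _; rewrite derive1E; case: (dF x).
Qed.

Lemma wallis0 : wallis 0 = pi / 2.
Proof.
rewrite /wallis (wallis_FTC (F := id)) ?subr0 //.
exact: continuous_cosX.
Qed.

Lemma wallis1 : wallis 1 = 1.
Proof.
rewrite /wallis (wallis_FTC (F := sin)) ?sin_pihalf ?sin0 ?subr0 //.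
exact: continuous_cosX.
Qed.

Lemma wallisSS n : n.+2%:R * wallis n.+2 = n.+1%:R * wallis n.
Proof.
apply/eqP; rewrite -subr_eq0; apply/eqP.
pose g (x : R) := n.+2%:R * cos x ^+ n.+2 - n.+1%:R * cos x ^+ n.
have dF (x : R) : is_derive x 1 (sin * cos ^+ n.+1) (g x).
  have := is_deriveM (is_derive_sin x) (is_deriveX n.+1 (is_derive_cos x)).
  move=> dF; apply: (is_derive_eq dF) => /=.
  rewrite /g /GRing.scale /= [in LHS]fctE.
  have := sin2cos2 x => s2.
  transitivity (cos x ^+ 2 * cos x ^+ n -
                n.+1%:R * (sin x ^+ 2) * cos x ^+ n).
    by rewrite !exprS; ring.
  by rewrite s2 [n.+2%:R]mulrS !exprS; ring.
have <- : \int[mu]_(x in `[0, pi / 2]) g x = 0.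
  rewrite (wallis_FTC _ dF).
    by rewrite /= !fctE cos_pihalf sin0 exprS !mul0r mulr0 subr0.
  by move=> x; apply: cvgB; apply: cvgM; try exact: cvg_cst; exact: continuous_cosX.
rewrite /g.
rewrite RintegralB //; last 2 first.
- apply/continuous_segment_integrable => x.
  by apply: cvgM; [exact: cvg_cst|exact: continuous_cosX].
- apply/continuous_segment_integrable => x.
  by apply: cvgM; [exact: cvg_cst|exact: continuous_cosX].
by rewrite RintegralZl ?RintegralZl //; exact: integrable_cosX.
Qed.

Lemma wallis_le n : wallis n.+1 <= wallis n.
Proof.
apply: le_Rintegral; try exact: integrable_cosX; first exact: measurable_itv.
move=> x /=; rewrite in_itv /= => /andP[x0 x1].
rewrite exprS -[leRHS]mul1r ler_wpM2r ?cos_le1 // exprn_ge0 // cos_ge0_pihalf //.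
by rewrite x1 andbT; have := pi_gt0 R; lra.
Qed.

Definition central_binomial (j : nat) : R := 'C(j.*2, j)%:R / 4 ^+ j.

Lemma central_binomialS j :
  j.+1.*2%:R * central_binomial j.+1 = j.*2.+1%:R * central_binomial j.
Proof.
have bin_rec : (j.+1 * 'C(j.+1.*2, j.+1) = 2 * (j.*2.+1 * 'C(j.*2, j)))%N.
  have h1 := mul_bin_diag j.*2.+2 j.
  have h3 : 'C(j.*2.+1, j.+1) = 'C(j.*2.+1, j).
    by rewrite -bin_sub; [congr ('C(_, _))|]; lia.
  have h4 := mul_bin_diag j.*2.+1 j.
  by rewrite /= in h1 h4; rewrite doubleS -h1 h4 h3 -doubleS -mul2n mulnA.
rewrite /central_binomial exprS.
have j0 : j.+1%:R != 0 :> R by rewrite pnatr_eq0.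
have : j.+1%:R * 'C(j.+1.*2, j.+1)%:R = 2 * (j.*2.+1%:R * 'C(j.*2, j)%:R) :> R.
  by rewrite -!natrM bin_rec !natrM.
have p0 : (4 : R) ^+ j != 0 by rewrite expf_neq0.
have -> : j.+1.*2%:R = 2 * j.+1%:R :> R by rewrite -mul2n natrM.
move: ('C(j.+1.*2, j.+1)%:R : R) ('C(j.*2, j)%:R : R) (j.*2.+1%:R : R).
move: (4 ^+ j : R) p0 (j.+1%:R : R) => p p0 m A B n eqb.
transitivity (m * A / p / 2 : R); first by field.
by rewrite eqb; field.
Qed.

Lemma wallis_even j : wallis j.*2 = pi / 2 * central_binomial j.
Proof.
elim: j => [|j IH]; first by rewrite wallis0 /central_binomial bin0 expr0 invr1 !mulr1.
have n0 : (j.*2.+2)%:R != 0 :> R by rewrite pnatr_eq0.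
apply: (mulfI n0); rewrite doubleS wallisSS IH mulrCA.
by rewrite [RHS]mulrCA; congr (_ * _); rewrite -doubleS central_binomialS.
Qed.

Lemma wallis_prod n : n.+1%:R * (wallis n.+1 * wallis n) = pi / 2.
Proof.
elim: n => [|n IH]; first by rewrite wallis1 wallis0 !mul1r.
by rewrite mulrA wallisSS -IH; ring.
Qed.

Lemma wallis_ge0 n : 0 <= wallis n.
Proof.
apply: Rintegral_ge0 => x /=; rewrite in_itv /= => /andP[x0 x1].
by rewrite exprn_ge0 // cos_ge0_pihalf // x1 andbT; have := pi_gt0 R; lra.
Qed.

Lemma central_binomial_ge0 j : 0 <= central_binomial j.
Proof. by rewrite divr_ge0 // exprn_ge0. Qed.

(** The two bounds are wallis n.+1 * wallis n <= wallis n ^+ 2 <=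
    wallis n * wallis n.-1 for n := j.*2. *)
Lemma central_binomial_lower j : 2 <= pi * j.*2.+1%:R * central_binomial j ^+ 2.
Proof.
have := wallis_prod j.*2; have := wallis_le j.*2; have := wallis_ge0 j.*2.
have := wallis_ge0 j.*2.+1; rewrite wallis_even => w1 w0 wle prod.
have := pi_gt0 R; have : 0 <= j.*2.+1%:R :> R by []. 
move: prod; set w := wallis _ in w1 wle *; set c := central_binomial j in w0 wle *.
set n : R := _%:R; move=> prod n0 p0.
have : n * (w * (pi / 2 * c)) <= n * (pi / 2 * c * (pi / 2 * c)).
  by rewrite ler_wpM2l // ler_wpM2r.
rewrite prod => le1.
have : pi * 2 <= pi * (pi * n * c ^+ 2) by nra.
by rewrite ler_pM2l.
Qed.

Lemma central_binomial_upper j : pi * j%:R * central_binomial j ^+ 2 <= 1.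
Proof.
case: j => [|j]; first by rewrite mulr0 mul0r.
have := wallis_prod j.*2.+1; have := wallis_le j.*2.+1; have := wallis_ge0 j.*2.+2.
have := wallis_ge0 j.*2.+1; rewrite -doubleS wallis_even => w1 w0 wle prod.
have := pi_gt0 R; have : 0 <= j.+1.*2%:R :> R by [].
move: prod; set w := wallis _ in w1 wle *; set c := central_binomial _ in w0 wle *.
rewrite -muln2 natrM; set n : R := j.+1%:R; move=> prod n0 p0.
have : n * 2 * ((pi / 2 * c) * (pi / 2 * c)) <= n * 2 * (pi / 2 * c * w).
  by rewrite ler_wpM2l // ler_wpM2l.
rewrite prod => le1.
have : pi * (pi * n * c ^+ 2) <= pi * 1 by nra.
by rewrite ler_pM2l.
Qed.

End Wallis.

(** * Averages against concentrated weights *)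

Section BinomialWeights.
Context {R : realType}.
Implicit Types (p : R).

Definition binomial_weight (N : nat) p (k : nat) : R :=
  'C(N, k)%:R * p ^+ k * (1 - p) ^+ (N - k).

Lemma big_multi_indices1 (V : nmodType) N (g : seq nat -> V) (Q : pred (seq nat)) :
  \sum_(ks <- multi_indices 1 N | Q ks) g ks =
  \sum_(k < N.+1 | Q [:: k : nat]) g [:: k : nat].
Proof.
rewrite big_mkcond big_multi_indicesS [RHS]big_mkcond.
by apply: eq_bigr => k _; rewrite big_seq1.
Qed.

Lemma binomial_weight_ge0 N p k : 0 <= p <= 1 -> 0 <= binomial_weight N p k.
Proof.
by move=> /andP[p0 p1]; rewrite !mulr_ge0 ?exprn_ge0 ?subr_ge0.
Qed.

Lemma binomial_weight_mass1 N p : \sum_(k < N.+1) binomial_weight N p k = 1.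
Proof.
have := @mweight_mass1 R N (1 - p) [:: p]; rewrite big_seq1 subrK => /(_ erefl).
by rewrite big_multi_indices1.
Qed.

Lemma binomial_weight_tail N p (delta : R) : 0 <= p <= 1 -> 0 < delta <= 2 ->
  \sum_(k < N.+1 | delta * N%:R < `|k%:R - N%:R * p|) binomial_weight N p k
  <= 2 * expR (- (N%:R * delta ^+ 2 / 8)).
Proof.
move=> /andP[p0 p1] d02.
have := @mweight_tail R N (1 - p) [:: p]; rewrite big_seq1 subrK subr_ge0 /= p0.
by move=> /(_ erefl p1 isT 0%N delta isT d02); rewrite big_multi_indices1.
Qed.

End BinomialWeights.

Lemma cvg_exprM_expRN (R : realType) (c : R) C : 0 < c ->
  n%:R ^+ C * expR (- (n%:R * c)) @[n --> \oo] --> (0 : R).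
Proof.
move=> c0; pose K := ((C.+1)%:R / c) ^+ C.+1.
apply: (@squeeze_cvgr _ _ _ _ (fun=> 0) (fun n : nat => K * n%:R^-1)); last 2 first.
- exact: cvg_cst.
- rewrite -[X in _ --> X](mulr0 K); apply: cvgM; first exact: cvg_cst.
  by apply/gtr0_cvgV0; [near=> n; rewrite ltr0n; near: n; exact: nbhs_infty_gt|
    exact: cvgr_idn].
near=> n; have n0 : 0 < n%:R :> R.
  by rewrite ltr0n; near: n; exact: nbhs_infty_gt.
rewrite mulr_ge0 ?exprn_ge0 ?expR_ge0 //= expRN ler_pdivrMr ?expR_gt0 //.
set y := n%:R * c / C.+1%:R; have y0 : 0 <= y.
  by rewrite divr_ge0 // mulr_ge0 // ltW.
have -> : n%:R * c = C.+1%:R * y by rewrite /y; field.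
rewrite expRM_natl.
have : y ^+ C.+1 <= expR y ^+ C.+1.
  rewrite lerXn2r // ?nnegrE ?expR_ge0 //; apply: le_trans (expR_ge1Dx y).
  by rewrite lerDr.
have K0 : 0 <= K / n%:R by rewrite divr_ge0 // exprn_ge0 // divr_ge0 // ltW.
move=> /(ler_wpM2l K0); apply: le_trans.
rewrite mulrAC -exprMn; have -> : C.+1%:R / c * y = n%:R.
  have [a0 cn0] : C.+1%:R != 0 :> R /\ c != 0.
    by split; [rewrite pnatr_eq0|rewrite gt_eqF].
  by rewrite /y; move: (C.+1%:R) a0 => a a0; field; apply/andP; split.
by rewrite exprSr mulfK // gt_eqF.
Unshelve. all: by end_near. Qed.

Section Concentration.
Context {R : realType} {I : Type}.
Variables (F : set_system I) (N : I -> nat) (p : I -> R).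
Context {FF : Filter F}.

(** Limits along this filter are limits that hold uniformly over the indices k
    with k / N close to p. *)
Definition concentrated : set_system (I * nat) :=
  [set A | exists2 delta : R, 0 < delta & \forall i \near F, forall k,
    (k <= N i)%N -> `|k%:R - (N i)%:R * p i| <= delta * (N i)%:R -> A (i, k)].

Global Instance concentrated_filter : Filter concentrated.
Proof.
split.
- by exists 1 => //; apply: nearW.
- move=> A B [a a0 FA] [b b0 FB]; exists (Num.min a b); first by rewrite lt_min a0.
  near=> i => k k_N dev; split.
    have [//|HA] := pselect (A (i, k)); have : F setT by exact: filterT.
    move=> _; apply: (near FA i) => //; apply: le_trans dev _.
    by rewrite ler_wpM2r // ge_min lexx.
  apply: (near FB i) => //; apply: le_trans dev _.
  by rewrite ler_wpM2r // ge_min lexx orbT.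
- move=> A B AB [a a0 FA]; exists a => //; apply: filterS FA => i HA k k_N dev.
  exact/AB/HA.
Unshelve. all: by end_near. Qed.

Lemma cvg_concentrated_ratio (l : R) : p @ F --> l -> N @ F --> \oo ->
  (z.2%:R / (N z.1)%:R : R) @[z --> concentrated] --> l.
Proof.
move=> pl Noo; apply/cvgrPdist_le => e e0.
have e2 : 0 < e / 2 by rewrite divr_gt0.
exists (e / 2) => //.
move/cvgrPdist_le : pl => /(_ _ e2) pl.
near=> i.
have N0 : 0 < (N i)%:R :> R.
  by rewrite ltr0n; near: i; exact: (Noo _ (nbhs_infty_gt 0)).
have pl_i : `|l - p i| <= e / 2 by near: i.
move=> k k_N dev /=.
have -> : l - k%:R / (N i)%:R =
  (l - p i) - (k%:R - (N i)%:R * p i) / (N i)%:R by field; rewrite gt_eqF.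
apply: le_trans (ler_normB _ _) _; rewrite (splitr e) lerD //.
by rewrite normrM normfV (gtr0_norm N0) ler_pdivrMr.
Unshelve. all: by end_near. Qed.

(** Indices k with k / N far from p have a binomial mass that is smaller than any
    power of N, so polynomial bounds on W and g are enough there. *)
Lemma cvg_average (W g : I -> nat -> R) (c : nat) (w l : R) :
  N @ F --> \oo ->
  (\forall i \near F, 0 <= p i <= 1) ->
  (\forall i \near F, forall k, (k <= N i)%N ->
    0 <= W i k <= (N i)%:R ^+ c * binomial_weight (N i) (p i) k) ->
  (\forall i \near F, forall k, (k <= N i)%N -> `|g i k| <= (N i)%:R ^+ c) ->
  \sum_(k < (N i).+1) W i k @[i --> F] --> w ->
  g z.1 z.2 @[z --> concentrated] --> l ->
  \sum_(k < (N i).+1) W i k * g i k @[i --> F] --> w * l.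
Proof.
move=> Noo p01 HW Hg cW /cvgrPdist_le cg.
suff dist0 : \sum_(k < (N i).+1) W i k * (g i k - l) @[i --> F] --> 0.
  rewrite -[X in _ --> X]add0r.
  rewrite (_ : (fun i => _) = (fun i =>
      \sum_(k < (N i).+1) W i k * (g i k - l) +
      (\sum_(k < (N i).+1) W i k) * l)).
    by apply: cvgD => //; apply: cvgM => //; exact: cvg_cst.
  apply/funext => i; rewrite mulr_suml -big_split /=.
  by apply: eq_bigr => k _; ring.
have w1 : 0 < `|w| + 1 by rewrite ltr_wpDl.
apply/cvgr0Pnorm_le => e e0.
pose eps := e / 2 / (`|w| + 1); have eps0 : 0 < eps by rewrite !divr_gt0.
have [delta d0 near_g] := cg _ eps0.
pose delta' := Num.min delta 2; have d'0 : 0 < delta' by rewrite lt_min d0 /=.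
have d'02 : 0 < delta' <= 2 by rewrite d'0 /= ge_min lexx orbT.
pose tail (n : nat) : R :=
  n%:R ^+ c * (n%:R ^+ c + `|l|) * (2 * expR (- (n%:R * (delta' ^+ 2 / 8)))).
have tail0 : tail n @[n --> \oo] --> 0.
  have c0 : 0 < delta' ^+ 2 / 8 by rewrite divr_gt0 // exprn_gt0.
  have t1 := cvg_exprM_expRN (c + c) c0; have t2 := cvg_exprM_expRN c c0.
  rewrite (_ : tail = fun n => n%:R ^+ (c + c) *
      expR (- (n%:R * (delta' ^+ 2 / 8))) * 2 +
      n%:R ^+ c * expR (- (n%:R * (delta' ^+ 2 / 8))) * (2 * `|l|)).
    rewrite -[X in _ --> X]addr0 -[X in _ --> X + _](mul0r 2).
    rewrite -[X in _ --> _ + X](mul0r (2 * `|l|)).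
    by apply: cvgD; apply: cvgM => //; exact: cvg_cst.
  by apply/funext => n; rewrite /tail exprD; ring.
have Ftail : \forall i \near F, `|tail (N i)| <= e / 2.
  apply: (Noo [set n | `|tail n| <= e / 2]).
  by move/cvgr0Pnorm_le : tail0; apply; rewrite divr_gt0.
move/cvgrPdist_le : cW => /(_ 1 ltr01) cW.
near=> i; have p01i : 0 <= p i <= 1 by near: i.
have HWi : forall k, (k <= N i)%N ->
    0 <= W i k <= (N i)%:R ^+ c * binomial_weight (N i) (p i) k by near: i.
have Hgi : forall k, (k <= N i)%N -> `|g i k| <= (N i)%:R ^+ c by near: i.
have near_gi : forall k, (k <= N i)%N ->
    `|k%:R - (N i)%:R * p i| <= delta * (N i)%:R -> `|l - g i k| <= eps by near: i.
have sumW : \sum_(k < (N i).+1) W i k <= `|w| + 1.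
  have : `|w - \sum_(k < (N i).+1) W i k| <= 1 by near: i.
  by rewrite ler_distlC => /andP[_ le1]; apply: le_trans le1 _; rewrite lerD2r ler_norm.
apply: le_trans (ler_norm_sum _ _ _) _.
rewrite (bigID (fun k : 'I_(N i).+1 =>
   delta' * (N i)%:R < `|k%:R - (N i)%:R * p i|)) /= addrC (splitr e) lerD //.
  apply: le_trans (_ : \sum_(k < (N i).+1) W i k * eps <= _); last first.
    by rewrite -mulr_suml /eps mulrA ler_pdivrMr // mulrC ler_wpM2l // divr_ge0 // ltW.
  rewrite big_mkcond /=; apply: ler_sum => -[k k_N] _ /=.
  have /andP[W0 _] := HWi k k_N; case: ifP => [|_]; last by rewrite mulr_ge0 // ltW.
  rewrite -leNgt => dev; rewrite normrM (ger0_norm W0) ler_wpM2l // distrC near_gi //.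
  by apply: le_trans dev _; rewrite ler_wpM2r // ge_min lexx.
apply: le_trans (_ : tail (N i) <= _); last first.
  by apply: le_trans (ler_norm _) _; near: i.
have := binomial_weight_tail (N i) p01i d'02.
have C0 : 0 <= (N i)%:R ^+ c * ((N i)%:R ^+ c + `|l|).
  by rewrite mulr_ge0 ?exprn_ge0 // addr_ge0 // exprn_ge0.
move=> /(ler_wpM2l C0); rewrite /tail -[_ * delta' ^+ 2 / 8]mulrA.
apply: le_trans.
rewrite mulr_sumr; apply: ler_sum => -[k k_N] _ /=.
have /andP[W0 Wle] := HWi k k_N; rewrite normrM (ger0_norm W0) mulrAC.
apply: ler_pM => //; apply: le_trans (ler_normB _ _) _; rewrite lerD2r; exact: Hgi.
Unshelve. all: by end_near. Qed.

End Concentration.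

Lemma cvg_concentrated_fst {R : realType} {I T : Type} (F : set_system I)
    {FF : Filter F} (N : I -> nat) (p : I -> R) (h : I -> T) (G : set_system T) :
  h @ F --> G -> h z.1 @[z --> concentrated F N p] --> G.
Proof.
move=> hG A GA; exists 1 => //.
have FA : F (h @^-1` A) by exact: hG.
by apply: filterS FA => i Ai k _ _.
Qed.

Section BinomialCollision.
Context {R : realType}.

Definition binomial_collision N (p : R) : R :=
  \sum_(k < N.+1) binomial_weight N p k ^+ 2.

Lemma binomial_collisionE N (p : R) :
  binomial_collision N p =
  \sum_(j < N.+1) binomial_weight N (4 * (p * (1 - p))) j * central_binomial j.
Proof.
rewrite /binomial_collision /binomial_weight (sum_binomial_sqr N (1 - p) p).
apply: eq_bigr => -[j j_N] _ /=; rewrite /central_binomial.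
have -> : 1 - 4 * (p * (1 - p)) = (1 - p - p) ^+ 2 by ring.
have p0 : (4 : R) ^+ j != 0 by rewrite expf_neq0.
rewrite [(1 - p) * p]mulrC [(4 * _) ^+ j]exprMn.
move: (_ ^+ (N - j)) ((p * (1 - p)) ^+ j) (4 ^+ j : R) p0 => u v w w0.
by field.
Qed.

Lemma central_binomial_le1 j : central_binomial j <= 1 :> R.
Proof.
have := central_binomial_upper (R := R) j; have := central_binomial_ge0 (R := R) j.
have [->|j0] := eqVneq j 0; first by rewrite /central_binomial bin0 invr1 mulr1.
set c := central_binomial j => c0.
have : 1 <= pi * j%:R :> R.
  have : 1 <= j%:R :> R by rewrite ler1n lt0n.
  by have := pi_ge2 R; nra.
by nra.
Qed.

Lemma sqrtr_le_id (x : R) : 1 <= x -> Num.sqrt x <= x.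
Proof.
move=> x1; have x0 : 0 <= x by apply: le_trans x1.
have s1 : 1 <= Num.sqrt x by rewrite -sqrtr1 ler_sqrt.
by rewrite -[leRHS](sqr_sqrtr x0) expr2 ler_peMl ?sqrtr_ge0.
Qed.

(** The number of non-zero steps of the lazy walk concentrates around
    4 l (1 - l) N, and central_binomial j is equivalent to 1 / sqrt (pi j). *)
Lemma cvg_binomial_collision {I : Type} (F : set_system I) {FF : Filter F}
    (N : I -> nat) (p : I -> R) (l : R) :
  N @ F --> \oo -> p @ F --> l -> 0 < l < 1 ->
  Num.sqrt (N i)%:R * binomial_collision (N i) (p i) @[i --> F]
    --> (Num.sqrt (4 * pi * (l * (1 - l))))^-1.
Proof.
move=> Noo pl l01; have /andP[l0 l1] := l01.
pose q i := 4 * (p i * (1 - p i)); pose L := 4 * (l * (1 - l)).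
have L0 : 0 < L by rewrite !mulr_gt0 // subr_gt0.
have qL : q @ F --> L.
  apply: cvgM; first exact: cvg_cst.
  by apply: cvgM => //; apply: cvgB => //; exact: cvg_cst.
have p01 : \forall i \near F, 0 < p i < 1.
  by apply: filterS2 (cvgr_gt _ pl _ l0) (cvgr_lt _ pl _ l1) => i -> ->.
have q01 : \forall i \near F, 0 <= q i <= 1.
  apply: filterS p01 => i /andP[p0 p1]; have := sqr_ge0 (1 - 2 * p i).
  rewrite /q => sq; apply/andP; split; last by nra.
  by rewrite mulr_ge0 ?mulr_ge0 ?subr_ge0 // ltW.
pose g (i : I) j := Num.sqrt (N i)%:R * central_binomial j : R.
have -> : (fun i => Num.sqrt (N i)%:R * binomial_collision (N i) (p i)) =
          (fun i => \sum_(j < (N i).+1) binomial_weight (N i) (q i) j * g i j).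
  apply/funext => i; rewrite binomial_collisionE mulr_sumr.
  by apply: eq_bigr => j _; rewrite mulrCA.
rewrite -[X in _ --> X]mul1r.
have N1 : \forall i \near F, (0 < N i)%N by exact: (Noo _ (nbhs_infty_gt 0)).
apply: (@cvg_average _ _ F N q FF
  (fun i => binomial_weight (N i) (q i)) g 1) => //.
- near=> i => k k_N.
  have p01i : 0 <= q i <= 1 by near: i.
  rewrite binomial_weight_ge0 //= expr1 ler_peMl ?binomial_weight_ge0 //.
  by rewrite ler1n; near: i.
- near=> i => k k_N; rewrite normrM (ger0_norm (sqrtr_ge0 _)).
  rewrite (ger0_norm (central_binomial_ge0 _)) expr1.
  have N1i : 1 <= (N i)%:R :> R by rewrite ler1n; near: i.
  apply: le_trans (_ : Num.sqrt (N i)%:R * 1 <= _).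
    by rewrite ler_wpM2l ?sqrtr_ge0 // central_binomial_le1.
  by rewrite mulr1 sqrtr_le_id.
- rewrite (_ : (fun i => _) = cst 1); first exact: cvg_cst.
  by apply/funext => i; rewrite binomial_weight_mass1.
have Noo' : N z.1 @[z --> concentrated F N q] --> \oo.
  exact: cvg_concentrated_fst.
have ratio : (z.2%:R / (N z.1)%:R : R) @[z --> concentrated F N q] --> L.
  exact: cvg_concentrated_ratio.
have sqr_g : (g z.1 z.2) ^+ 2 @[z --> concentrated F N q] --> (pi * L)^-1.
  pose r (z : I * nat) : R := z.2%:R / (N z.1)%:R.
  pose s (z : I * nat) : R := (N z.1)%:R^-1.
  have s0 : s z @[z --> concentrated F N q] --> 0.
    apply/gtr0_cvgV0.
      by near=> z; rewrite ltr0n; near: z; exact: (Noo' _ (nbhs_infty_gt 0)).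
    exact: (cvg_comp _ _ Noo' (@cvgr_idn R)).
  have piL : pi * L != 0 by rewrite mulf_neq0 ?gt_eqF ?pi_gt0.
  apply: (@squeeze_cvgr _ _ _ _ (fun z => (pi * (r z + s z / 2))^-1)
                                (fun z => (pi * r z)^-1)); last 2 first.
  - apply: cvgV; first by [].
    apply: cvgM; first exact: cvg_cst.
    rewrite -[X in _ --> X]addr0 -[X in _ + X](mul0r 2^-1).
    by apply: cvgD => //; apply: cvgM => //; exact: cvg_cst.
  - by apply: cvgV => //; apply: cvgM => //; exact: cvg_cst.
  near=> z.
  have N0 : 0 < (N z.1)%:R :> R.
    by rewrite ltr0n; near: z; exact: (Noo' _ (nbhs_infty_gt 0)).
  have r0 : 0 < r z by near: z; apply: (cvgr_gt _ ratio).
  have j0 : 0 < z.2%:R :> R by move: r0; rewrite /r pmulr_lgt0 // invr_gt0.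
  rewrite /g exprMn sqr_sqrtr ?ler0n //.
  have := central_binomial_upper (R := R) z.2.
  have := central_binomial_lower (R := R) z.2.
  set c := central_binomial _; have := pi_gt0 R => p0 lo up.
  have rE : r z * (N z.1)%:R = z.2%:R by rewrite /r divfK // gt_eqF.
  apply/andP; split.
    rewrite -[leLHS]mul1r ler_pdivrMr; last first.
      by rewrite mulr_gt0 // addr_gt0 // divr_gt0 // invr_gt0.
    have -> : (N z.1)%:R * c ^+ 2 * (pi * (r z + s z / 2)) =
       (pi * (z.2.*2.+1)%:R * c ^+ 2) / 2.
      have -> : z.2.*2.+1%:R = 2 * z.2%:R + 1 :> R by rewrite -natr1 -mul2n natrM.
      rewrite -rE /s.
      move: (r z) ((N z.1)%:R : R) N0 => a b b0; field.
      by rewrite gt_eqF.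
    by rewrite ler_pdivlMr // mul1r.
  rewrite -[leRHS]mul1r ler_pdivlMr; last by rewrite mulr_gt0.
  by rewrite -rE in up; apply: le_trans up; rewrite le_eqVlt; apply/orP; left; apply/eqP; ring.
have -> : (Num.sqrt (4 * pi * (l * (1 - l))))^-1 = Num.sqrt ((pi * L)^-1).
  by rewrite sqrtrV ?(mulr_ge0 (pi_ge0 R) (ltW L0)) //; congr (Num.sqrt _)^-1; rewrite /L; ring.
rewrite (_ : (fun z => _) = (fun z => Num.sqrt ((g z.1 z.2) ^+ 2))).
  by apply: continuous_cvg; [exact: sqrt_continuous|exact: sqr_g].
apply/funext => z; rewrite sqrtr_sqr ger0_norm // mulr_ge0 ?sqrtr_ge0 //.
exact: central_binomial_ge0.
Unshelve. all: by end_near. Qed.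

End BinomialCollision.

(** * Collisions of Poisson variables *)

Lemma bernoulli_ineq (R : realDomainType) (u : R) k :
  0 <= u <= 1 -> 1 - k%:R * u <= (1 - u) ^+ k.
Proof.
move=> /andP[u0 u1]; elim: k => [|k IH]; first by rewrite mul0r subr0.
rewrite exprS -natr1; have := exprn_ge0 k (_ : 0 <= 1 - u).
rewrite subr_ge0 => /(_ u1) p0; have k0 : 0 <= k%:R :> R by [].
have uk : 0 <= k%:R * u * u by rewrite !mulr_ge0.
have : (1 - u) * (1 - k%:R * u) <= (1 - u) * (1 - u) ^+ k.
  by rewrite ler_wpM2l // subr_ge0.
by apply: le_trans; nra.
Qed.

Section Poisson.
Context {R : realType}.
Implicit Types (l : R).

Definition poisson_weight l (k : nat) : R := expR (- l) * (l ^+ k / k`!%:R).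

(** The probability that two independent Poisson variables of mean l coincide;
    see cvg_poisson_collision. *)
Definition poisson_collision l : R := expR (- 2 * l) * besselI0 (2 * l).

Lemma poisson_weight_ge0 l k : 0 <= l -> 0 <= poisson_weight l k.
Proof. by move=> l0; rewrite mulr_ge0 ?expR_ge0 // divr_ge0 ?exprn_ge0. Qed.

Lemma nondecreasing_partial_sums (a : nat -> R) : (forall k, 0 <= a k) ->
  {homo (fun n => \sum_(k < n) a k) : n m / (n <= m)%N >-> n <= m}.
Proof.
move=> a0; apply/nondecreasing_seqP => n.
by rewrite big_ord_recr lerDl.
Qed.

Lemma nondecreasing_poisson_sqr l :
  {homo (fun n => \sum_(k < n) poisson_weight l k ^+ 2) :
    n m / (n <= m)%N >-> n <= m}.
Proof.
apply: (@nondecreasing_partial_sums (fun k => poisson_weight l k ^+ 2)) => k.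
exact: sqr_ge0.
Qed.

Lemma poisson_weight_mass_le1 l n : 0 <= l -> \sum_(k < n) poisson_weight l k <= 1.
Proof.
move=> l0; rewrite -mulr_sumr expRN ler_pdivrMl ?expR_gt0 // mulr1.
have -> : \sum_(k < n) l ^+ k / k`!%:R = series (exp_coeff l) n.
  by rewrite /series /= big_mkord.
apply: (@nondecreasing_cvgn_le _ (series (exp_coeff l))).
  by apply: nondecreasing_series => k _ _; exact: exp_coeff_ge0.
exact: is_cvg_series_exp_coeff.
Qed.

Lemma poisson_weight_le1 l k : 0 <= l -> poisson_weight l k <= 1.
Proof.
move=> l0; apply: le_trans (poisson_weight_mass_le1 k.+1 l0).
by rewrite big_ord_recr lerDr sumr_ge0 // => i _; exact: poisson_weight_ge0.
Qed.

Lemma sum_sqr_poisson_weight l n :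
  \sum_(k < n) poisson_weight l k ^+ 2 =
  expR (- 2 * l) * series (fun k => (2 * l / 2) ^+ (2 * k) / k`!%:R ^+ 2) n.
Proof.
rewrite /series /= big_mkord mulr_sumr; apply: eq_bigr => k _.
rewrite /poisson_weight exprMn -expRM_natl expr_div_n; congr (expR _ * (_ / _)).
  by ring.
by rewrite -exprM mulnC; congr (_ ^+ _); field.
Qed.

Lemma cvg_poisson_collision l : 0 <= l ->
  \sum_(k < n) poisson_weight l k ^+ 2 @[n --> \oo] --> poisson_collision l.
Proof.
move=> l0.
have cvgS : cvgn (fun n => \sum_(k < n) poisson_weight l k ^+ 2).
  apply: nondecreasing_is_cvgn; first exact: nondecreasing_poisson_sqr.
  exists 1 => _ [n _ <-]; apply: le_trans (poisson_weight_mass_le1 n l0).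
  apply: ler_sum => k _.
  by rewrite expr2 ler_piMl ?poisson_weight_ge0 ?poisson_weight_le1.
have e0 : expR (- 2 * l) != 0 by rewrite gt_eqF ?expR_gt0.
have Sfun : (fun n => \sum_(k < n) poisson_weight l k ^+ 2) =
  (fun n => expR (- 2 * l) * series (fun k => (2 * l / 2) ^+ (2 * k) / k`!%:R ^+ 2) n).
  by apply/funext => n; rewrite sum_sqr_poisson_weight.
have cvgB : cvgn (series (fun k => (2 * l / 2) ^+ (2 * k) / k`!%:R ^+ 2)).
  rewrite (_ : series _ = (fun n =>
    (expR (- 2 * l))^-1 * \sum_(k < n) poisson_weight l k ^+ 2)).
    by apply: is_cvgM => //; exact: is_cvg_cst.
  by apply/funext => n; rewrite sum_sqr_poisson_weight mulrA mulVf ?mul1r.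
rewrite Sfun; apply: cvgM; first exact: cvg_cst.
exact: cvgB.
Qed.

Lemma poisson_collision_ub l n : 0 <= l ->
  \sum_(k < n) poisson_weight l k ^+ 2 <= poisson_collision l.
Proof.
move=> l0; have cvgS := cvg_poisson_collision l0.
rewrite -(cvg_lim (@Rhausdorff R) cvgS).
apply: (@nondecreasing_cvgn_le _ (fun n => \sum_(k < n) poisson_weight l k ^+ 2)).
  exact: nondecreasing_poisson_sqr.
by apply/cvg_ex; exists (poisson_collision l).
Qed.

Lemma poisson_collision_le l (B : R) : 0 <= l ->
  (forall n, \sum_(k < n) poisson_weight l k ^+ 2 <= B) ->
  poisson_collision l <= B.
Proof.
move=> l0 leB; have cvgS := cvg_poisson_collision l0.
rewrite -(cvg_lim (@Rhausdorff R) cvgS); apply: limr_le.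
  by apply/cvg_ex; exists (poisson_collision l).
exact: nearW.
Qed.

Lemma poisson_collision_ge0 l : 0 <= l -> 0 <= poisson_collision l.
Proof.
by move=> l0; apply: le_trans (poisson_collision_ub 0 l0); rewrite big_ord0.
Qed.

Lemma poisson_collision_tail l n : 0 <= l ->
  poisson_collision l - \sum_(k < n) poisson_weight l k ^+ 2 <=
  1 - \sum_(k < n) poisson_weight l k.
Proof.
move=> l0; rewrite lerBlDr; apply: poisson_collision_le => // m.
have sq_le k : poisson_weight l k ^+ 2 <= poisson_weight l k.
  by rewrite expr2 ler_piMl ?poisson_weight_ge0 ?poisson_weight_le1.
have -> : 1 - \sum_(k < n) poisson_weight l k +
  \sum_(k < n) poisson_weight l k ^+ 2 =
  1 - \sum_(k < n) (poisson_weight l k - poisson_weight l k ^+ 2).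
  by rewrite sumrB; ring.
rewrite lerBrDr.
apply: le_trans (poisson_weight_mass_le1 (maxn m n) l0).
have le1 : \sum_(k < m) poisson_weight l k ^+ 2 <=
           \sum_(k < maxn m n) poisson_weight l k ^+ 2.
  by apply: nondecreasing_poisson_sqr; exact: leq_maxl.
have le2 : \sum_(k < n) (poisson_weight l k - poisson_weight l k ^+ 2) <=
           \sum_(k < maxn m n) (poisson_weight l k - poisson_weight l k ^+ 2).
  apply: (@nondecreasing_partial_sums
    (fun k => poisson_weight l k - poisson_weight l k ^+ 2)).
    by move=> k; rewrite subr_ge0.
  exact: leq_maxr.
apply: le_trans (lerD le1 le2) _; rewrite -big_split /=.
by apply: ler_sum => k _; rewrite addrC subrK.
Qed.

Lemma poisson_collision_le1 l : 0 <= l -> poisson_collision l <= 1.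
Proof.
by move=> l0; have := poisson_collision_tail 0 l0; rewrite !big_ord0 !subr0.
Qed.

Lemma poisson_weightS l k : k.+1%:R * poisson_weight l k.+1 = l * poisson_weight l k.
Proof.
rewrite /poisson_weight factS natrM exprS.
have : k`!%:R != 0 :> R by rewrite pnatr_eq0 -lt0n fact_gt0.
have : k.+1%:R != 0 :> R by rewrite pnatr_eq0.
by move: (k.+1%:R : R) (k`!%:R : R) => a b a0 b0; field; apply/andP; split.
Qed.

(** Termwise comparison in both directions: for l' <= l the ratio
    of the weights is (l / l') ^+ k times expR (l' - l), where the first factor
    is at least 1 and the second one at least 1 - (l - l'). *)
Lemma poisson_collision_lipschitz l l' : 0 <= l' <= l ->
  `|poisson_collision l - poisson_collision l'| <= 2 * (l - l').
Proof.
move=> /andP[l'0 l'l]; have l0 := le_trans l'0 l'l.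
set D := l - l'; have D0 : 0 <= D by rewrite subr_ge0.
rewrite ler_distl; apply/andP; split.
  rewrite lerBlDr; apply: poisson_collision_le => // n.
  apply: le_trans (_ : \sum_(k < n) (poisson_weight l k ^+ 2 +
     2 * D * poisson_weight l' k) <= _); last first.
    rewrite big_split /= -mulr_sumr lerD ?poisson_collision_ub //.
    by rewrite ler_piMr ?mulr_ge0 // poisson_weight_mass_le1.
  apply: ler_sum => k _; set w' := poisson_weight l' k.
  have w'0 : 0 <= w' by exact: poisson_weight_ge0.
  have w'1 : w' <= 1 by exact: poisson_weight_le1.
  have le1 : expR (- D) * w' <= poisson_weight l k.
    rewrite /w' /poisson_weight mulrA -expRD.
    have -> : - D - l' = - l by rewrite /D; ring.
    rewrite ler_wpM2l ?expR_ge0 // ler_wpM2r ?invr_ge0 //.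
    by rewrite lerXn2r // nnegrE.
  have le2 : (expR (- D) * w') ^+ 2 <= poisson_weight l k ^+ 2.
    by rewrite !expr2 ler_pM // mulr_ge0 // expR_ge0.
  have le3 : 1 - D *+ 2 <= expR (- D) ^+ 2.
    rewrite -expRM_natl; apply: le_trans (expR_ge1Dx _).
    by rewrite -mulr_natl; lra.
  have le4 : (1 - D *+ 2) * w' ^+ 2 <= (expR (- D) * w') ^+ 2.
    by rewrite [leRHS]exprMn ler_wpM2r ?sqr_ge0.
  have : D * w' ^+ 2 <= D * w' by rewrite ler_wpM2l // expr2 ler_piMl.
  by lra.
apply: poisson_collision_le => // n.
have [l_eq0|l_neq0] := eqVneq l 0.
  have -> : l = l' by apply/le_anti; rewrite l'l l_eq0 l'0.
  by apply: le_trans (poisson_collision_ub n l'0) _; rewrite lerDl mulr_ge0.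
have l_gt0 : 0 < l by rewrite lt_def l_neq0.
apply: le_trans (_ : \sum_(k < n) (poisson_weight l' k ^+ 2 +
   2 * D / l * (k%:R * poisson_weight l k)) <= _); last first.
  rewrite big_split /= -mulr_sumr lerD ?poisson_collision_ub //.
  rewrite -mulrA ler_piMr ?mulr_ge0 // mulrC ler_pdivrMr // mul1r.
  case: n => [|n]; first by rewrite big_ord0.
  rewrite big_ord_recl mul0r add0r.
  under eq_bigr do rewrite poisson_weightS.
  by rewrite -mulr_sumr ler_piMr // poisson_weight_mass_le1.
apply: ler_sum => k _; set w := poisson_weight l k.
have w0 : 0 <= w by exact: poisson_weight_ge0.
have w1 : w <= 1 by exact: poisson_weight_le1.
set u := D / l; have u01 : 0 <= u <= 1.
  by rewrite divr_ge0 //= ler_pdivrMr // mul1r /D lerBlDr lerDl.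
have uE : 1 - u = l' / l by rewrite /u /D; field.
have le1 : (1 - u) ^+ k * w <= poisson_weight l' k.
  rewrite uE /w /poisson_weight mulrCA expr_div_n.
  have -> : l' ^+ k / l ^+ k * (l ^+ k / k`!%:R) = l' ^+ k / k`!%:R.
    by rewrite mulrA divfK // expf_neq0.
  by rewrite ler_wpM2r ?divr_ge0 ?exprn_ge0 // ler_expR lerN2.
have base0 : 0 <= 1 - u by rewrite subr_ge0; case/andP: u01.
have le2 : ((1 - u) ^+ k * w) ^+ 2 <= poisson_weight l' k ^+ 2.
  by rewrite [leLHS]expr2 [leRHS]expr2 ler_pM // mulr_ge0 // exprn_ge0.
have le3 : 1 - (k * 2)%:R * u <= ((1 - u) ^+ k) ^+ 2.
  by rewrite -exprM bernoulli_ineq.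
have le4 : (1 - (k * 2)%:R * u) * w ^+ 2 <= ((1 - u) ^+ k * w) ^+ 2.
  by rewrite [leRHS]exprMn ler_wpM2r ?sqr_ge0.
have ku0 : 0 <= k%:R * u by rewrite mulr_ge0 //; case/andP: u01.
have : k%:R * u * w ^+ 2 <= k%:R * u * w by rewrite ler_wpM2l // expr2 ler_piMl.
have -> : 2 * D / l * (k%:R * w) = 2 * (k%:R * u * w) by rewrite /u; ring.
by rewrite natrM in le4; lra.
Qed.

End Poisson.

Section MultinomialPoisson.
Context {R : realType}.
Implicit Types (s ls : seq R) (ks : seq nat).

Fixpoint poisson_weights ls ks : R :=
  match ls, ks with
  | l :: ls', k :: ks' => poisson_weight l k * poisson_weights ls' ks'
  | _, _ => 1
  end.

Lemma poisson_weights_ge0 ls ks :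
  all (fun x => 0 <= x) ls -> 0 <= poisson_weights ls ks.
Proof.
elim: ls ks => [|l ls IH] [|k ks] //= /andP[l0 ls0].
by rewrite mulr_ge0 ?IH // poisson_weight_ge0.
Qed.

Lemma poisson_weights_le1 ls ks :
  all (fun x => 0 <= x) ls -> poisson_weights ls ks <= 1.
Proof.
elim: ls ks => [|l ls IH] [|k ks] //= /andP[l0 ls0].
rewrite -[leRHS]mulr1 ler_pM ?IH ?poisson_weight_le1 ?poisson_weight_ge0 //.
exact: poisson_weights_ge0.
Qed.

Let mass N ls := \sum_(ks <- multi_indices (size ls) N) poisson_weights ls ks.
Let collision N ls :=
  \sum_(ks <- multi_indices (size ls) N) poisson_weights ls ks ^+ 2.

Let massS N l ls :
  mass N (l :: ls) = \sum_(k < N.+1) poisson_weight l k * mass (N - k) ls.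
Proof.
by rewrite /mass big_multi_indicesS; apply: eq_bigr => k _; rewrite mulr_sumr.
Qed.

Let collisionS N l ls :
  collision N (l :: ls) =
  \sum_(k < N.+1) poisson_weight l k ^+ 2 * collision (N - k) ls.
Proof.
rewrite /collision big_multi_indicesS; apply: eq_bigr => k _; rewrite mulr_sumr.
by apply: eq_bigr => ks _; rewrite /= exprMn.
Qed.

(** Since every weight is at most 1, the collision probability that is lost by
    truncating the product of the Poisson laws is at most the lost mass. *)
Lemma poisson_collision_truncation N ls : all (fun x => 0 <= x) ls ->
  [/\ mass N ls <= 1,
      0 <= \prod_(l <- ls) poisson_collision l <= 1 &
      0 <= \prod_(l <- ls) poisson_collision l - collision N ls <= 1 - mass N ls].
Proof.
elim: ls N => [|l ls IH] N /=.
  by rewrite /mass /collision !big_multi_indices0 big_nil /= expr1n subrr ler01 !lexx.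
move=> /andP[l0 ls0]; rewrite big_cons massS collisionS.
have IH' M := IH M ls0; move: (IH' N) => [_ H01 _].
set H := \prod_(l <- ls) _ in IH' H01 *; case/andP: H01 => H0 H1.
have h0 := poisson_collision_ge0 l0; have h1 := poisson_collision_le1 l0.
have mass_le : \sum_(k < N.+1) poisson_weight l k * mass (N - k) ls <=
               \sum_(k < N.+1) poisson_weight l k.
  apply: ler_sum => k _; have [m1 _ _] := IH' (N - k)%N.
  by rewrite -[leRHS]mulr1 ler_wpM2l ?poisson_weight_ge0.
have hHE : poisson_collision l * H -
    \sum_(k < N.+1) poisson_weight l k ^+ 2 * collision (N - k) ls =
    \sum_(k < N.+1) poisson_weight l k ^+ 2 * (H - collision (N - k) ls) +
    (poisson_collision l - \sum_(k < N.+1) poisson_weight l k ^+ 2) * H.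
  under [in RHS]eq_bigr do rewrite mulrBr.
  by rewrite sumrB -mulr_suml; ring.
split.
- exact: le_trans mass_le (poisson_weight_mass_le1 _ l0).
- by rewrite mulr_ge0 //= -[leRHS]mulr1 ler_pM.
rewrite hHE; apply/andP; split.
  rewrite addr_ge0 //; last by rewrite mulr_ge0 // subr_ge0 poisson_collision_ub.
  apply: sumr_ge0 => k _; have [_ _ /andP[c0 _]] := IH' (N - k)%N.
  by rewrite mulr_ge0 ?sqr_ge0.
have -> : 1 - \sum_(k < N.+1) poisson_weight l k * mass (N - k) ls =
  \sum_(k < N.+1) poisson_weight l k * (1 - mass (N - k) ls) +
  (1 - \sum_(k < N.+1) poisson_weight l k).
  under [in RHS]eq_bigr do rewrite mulrBr mulr1.
  by rewrite sumrB; ring.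
apply: lerD.
  apply: ler_sum => k _; have [m1 _ /andP[c0 c1]] := IH' (N - k)%N.
  have w0 := poisson_weight_ge0 k l0; have w1 := poisson_weight_le1 k l0.
  by rewrite ler_pM ?sqr_ge0 // expr2 ler_piMl.
apply: le_trans (poisson_collision_tail N.+1 l0).
by rewrite ler_piMr // subr_ge0 poisson_collision_ub.
Qed.

Lemma ffact_le_expn n k : (n ^_ k <= n ^ k)%N.
Proof.
elim: k n => [|k IH] n //; rewrite ffactnSr expnSr.
by apply: leq_mul => //; exact: leq_subr.
Qed.

Lemma mweight_le_powers m (a : R) s ks : 0 <= a -> all (fun x => 0 <= x) s ->
  size ks = size s -> (sumn ks <= m)%N ->
  mweight m a s ks * a ^+ sumn ks <=
  a ^+ m * \prod_(i < size s) ((m%:R * s`_i) ^+ nth 0%N ks i / (nth 0%N ks i)`!%:R).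
Proof.
move=> a0; elim: s m ks => [|x s IH] m [|k ks] //=.
  by rewrite big_ord0 expr0.
move=> /andP[x0 s0] [sz] le_m; rewrite big_ord_recl /=.
have le_mk : (sumn ks <= m - k)%N by lia.
have km : (k <= m)%N by lia.
have binle : 'C(m, k)%:R * x ^+ k <= (m%:R * x) ^+ k / k`!%:R.
  rewrite exprMn mulrAC ler_wpM2r ?exprn_ge0 // ler_pdivlMr ?ltr0n ?fact_gt0 //.
  by rewrite -natrM -natrX ler_nat bin_ffact ffact_le_expn.
have prodle : \prod_(i < size s) (((m - k)%:R * s`_i) ^+ nth 0%N ks i /
     (nth 0%N ks i)`!%:R) <=
   \prod_(i < size s) ((m%:R * s`_i) ^+ nth 0%N ks i / (nth 0%N ks i)`!%:R).
  apply: ler_prod => i _; have si0 : 0 <= s`_i by move/all_nthP: s0; exact.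
  rewrite divr_ge0 ?exprn_ge0 ?mulr_ge0 //= ler_wpM2r ?invr_ge0 //.
  by rewrite lerXn2r ?nnegrE ?mulr_ge0 // ler_wpM2r // ler_nat leq_subr.
have := IH (m - k)%N ks s0 sz le_mk => IHle.
rewrite exprD -(subnK km) [a ^+ (m - k + k)]exprD (subnK km).
have -> : 'C(m, k)%:R * x ^+ k * mweight (m - k) a s ks * (a ^+ k * a ^+ sumn ks) =
  a ^+ k * (('C(m, k)%:R * x ^+ k) * (mweight (m - k) a s ks * a ^+ sumn ks)).
  by ring.
rewrite [a ^+ (m - k) * a ^+ k]mulrC -[leRHS]mulrA ler_wpM2l ?exprn_ge0 //.
rewrite [leRHS]mulrCA; apply: ler_pM; rewrite ?mulr_ge0 ?exprn_ge0 ?mweight_ge0 //.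
by apply: le_trans IHle _; rewrite ler_wpM2l ?exprn_ge0.
Qed.

Lemma poisson_weightsE (c : R) s ks : size ks = size s ->
  poisson_weights [seq c * x | x <- s] ks =
  expR (- (c * \sum_(x <- s) x)) *
  \prod_(i < size s) ((c * s`_i) ^+ nth 0%N ks i / (nth 0%N ks i)`!%:R).
Proof.
elim: s ks => [|x s IH] [|k ks] //= => [_|[sz]].
  by rewrite big_nil big_ord0 mulr0 oppr0 expR0 mulr1.
by rewrite IH // big_cons big_ord_recl /= mulrDr opprD expRD /poisson_weight; ring.
Qed.

(** The multinomial weight exceeds the Poisson weight by a factor of at most
    (1 - X) ^- |k|, so that the total variation distance is at most N X^2,
    the expected value of |k| X. *)
Lemma multinomial_collision_poisson N s :
  all (fun x => 0 <= x) s -> \sum_(x <- s) x <= 1 ->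
  `|\sum_(ks <- multi_indices (size s) N) mweight N (1 - \sum_(x <- s) x) s ks ^+ 2
    - \prod_(x <- s) poisson_collision (N%:R * x)|
  <= 5 * (N%:R * (\sum_(x <- s) x) ^+ 2).
Proof.
set X := \sum_(x <- s) x => s0 X1.
have X0 : 0 <= X.
  by rewrite /X big_seq sumr_ge0 // => x xs; move/allP: s0; exact.
set idx := multi_indices _ _; pose P := mweight N (1 - X) s.
pose ls := [seq N%:R * x | x <- s]; pose Q := poisson_weights ls.
have sum1 : 1 - X + X = 1 by rewrite subrK.
have a0 : 0 <= 1 - X by rewrite subr_ge0.
have ls0 : all (fun x => 0 <= x) ls.
  by rewrite all_map; apply: sub_all s0 => x /= x0; rewrite mulr_ge0.
have sz_ls : size ls = size s by rewrite size_map.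
have P0 ks : 0 <= P ks by exact: mweight_ge0.
have Q0 ks : 0 <= Q ks by exact: poisson_weights_ge0.
have sumP : \sum_(ks <- idx) P ks = 1 by exact: mweight_mass1.
have P1 ks : ks \in idx -> P ks <= 1.
  by move=> ks_idx; rewrite -sumP (big_rem ks) //= lerDl sumr_ge0.
have PQ ks : ks \in idx -> P ks - Q ks <= P ks * ((sumn ks)%:R * X).
  rewrite mem_multi_indices => /andP[/eqP sz le_N].
  have le1 : P ks * (1 - X) ^+ sumn ks <= Q ks.
    apply: le_trans (mweight_le_powers a0 s0 sz le_N) _.
    rewrite /Q poisson_weightsE // ler_wpM2r //.
      apply: prodr_ge0 => i _; rewrite divr_ge0 ?exprn_ge0 ?mulr_ge0 //.
      by move/all_nthP: s0; exact.
    rewrite -mulrN expRM_natl lerXn2r ?nnegrE ?expR_ge0 //.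
    exact: expR_ge1Dx.
  have := bernoulli_ineq (sumn ks) (_ : 0 <= X <= 1); rewrite X0 X1 => /(_ isT).
  by move=> /(ler_wpM2l (P0 ks)); lra.
have moment : \sum_(ks <- idx) P ks * (sumn ks)%:R = N%:R * X.
  have := mweight_binomial_moment N xpredT 1 sum1.
  rewrite bin1 expr1 [in LHS]/= => momE; rewrite /X (big_nth 0) big_mkord -momE.
  apply: eq_big_seq => ks; rewrite mem_multi_indices => /andP[/eqP sz _].
  by rewrite bin1 sumnE (big_nth 0%N) big_mkord sz.
pose B := N%:R * X ^+ 2.
have sum_pos : \sum_(ks <- idx) Num.max (P ks - Q ks) 0 <= B.
  have -> : B = \sum_(ks <- idx) P ks * ((sumn ks)%:R * X).
    under eq_bigr do rewrite mulrA.
    by rewrite -mulr_suml moment /B; ring.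
  rewrite big_seq [leRHS]big_seq; apply: ler_sum => ks ks_idx.
  by rewrite ge_max PQ // !mulr_ge0.
have [] := poisson_collision_truncation N ls0.
rewrite /mass /collision sz_ls -/idx -/Q => massQ _ /andP[HQ0 HQ1].
have massB : 1 - \sum_(ks <- idx) Q ks <= B.
  apply: le_trans sum_pos; rewrite -sumP -sumrB; apply: ler_sum => ks _.
  by rewrite le_max lexx.
have sum_abs : \sum_(ks <- idx) `|P ks - Q ks| <= 2 * B.
  have defect : 1 - \sum_(ks <- idx) Q ks = \sum_(ks <- idx) (P ks - Q ks).
    by rewrite sumrB sumP.
  have -> : \sum_(ks <- idx) `|P ks - Q ks| =
      2 * \sum_(ks <- idx) Num.max (P ks - Q ks) 0 -
      (1 - \sum_(ks <- idx) Q ks).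
    rewrite defect mulr_sumr -sumrB; apply: eq_bigr => ks _.
    by have [le0|gt0] := leP (P ks - Q ks) 0; [rewrite ler0_norm|rewrite gtr0_norm]; lra.
  by lra.
have sum_sqr : `|\sum_(ks <- idx) P ks ^+ 2 - \sum_(ks <- idx) Q ks ^+ 2| <= 4 * B.
  rewrite -sumrB; apply: le_trans (ler_norm_sum _ _ _) _.
  apply: le_trans (_ : \sum_(ks <- idx) `|P ks - Q ks| * 2 <= _); last first.
    by rewrite -mulr_suml; lra.
  rewrite big_seq [leRHS]big_seq; apply: ler_sum => ks ks_idx.
  rewrite subr_sqr normrM ler_wpM2l // ger0_norm ?addr_ge0 //.
  by have := P1 ks ks_idx; have := poisson_weights_le1 ks ls0; rewrite -/(Q ks); lra.
rewrite big_map in HQ0 HQ1.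
have := lerD sum_sqr (_ : `|\sum_(ks <- idx) Q ks ^+ 2 -
   \prod_(x <- s) poisson_collision (N%:R * x)| <= B).
rewrite distrC ger0_norm // => /(_ (le_trans HQ1 massB)).
rewrite -[X in _ + X](ger0_norm HQ0) => le5.
apply: le_trans (ler_distD (\sum_(ks <- idx) Q ks ^+ 2) _ _) _.
by rewrite [X in _ + X]distrC; apply: le_trans le5 _; rewrite /B; lra.
Qed.

End MultinomialPoisson.

(** * Collisions of multinomial variables near a face of the simplex *)

Lemma cvg_big_sum (R : realType) (I : Type) (F : set_system I) {FF : Filter F}
    (J : Type) (r : seq J) (P : pred J) (f : J -> I -> R) (l : J -> R) :
  (forall j, P j -> f j @ F --> l j) ->
  \sum_(j <- r | P j) f j i @[i --> F] --> \sum_(j <- r | P j) l j.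
Proof.
move=> fl; elim: r => [|j r IH].
  rewrite big_nil (_ : (fun i => _) = cst 0); first exact: cvg_cst.
  by apply/funext => i; rewrite big_nil.
rewrite big_cons; have := fl j; case: ifP => Pj flj.
  rewrite (_ : (fun i => _) = (fun i => f j i + \sum_(j <- r | P j) f j i)).
    by apply: cvgD => //; exact: flj.
  by apply/funext => i; rewrite big_cons Pj.
by rewrite (_ : (fun i => _) = (fun i => \sum_(j <- r | P j) f j i)) //;
  apply/funext => i; rewrite big_cons Pj.
Qed.

Lemma cvg_exprn (R : realType) (I : Type) (F : set_system I) {FF : Filter F}
    (f : I -> R) (l : R) n :
  f @ F --> l -> f i ^+ n @[i --> F] --> l ^+ n.
Proof.
move=> fl; apply: (@cvg_comp _ _ _ f (fun x : R => x ^+ n) F (nbhs l)) => //.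
exact: exprn_continuous.
Qed.

Lemma cvg_sqrtr (R : realType) (I : Type) (F : set_system I) {FF : Filter F}
    (f : I -> R) (l : R) :
  f @ F --> l -> Num.sqrt (f i) @[i --> F] --> Num.sqrt l.
Proof. by move=> fl; apply: continuous_cvg => //; exact: sqrt_continuous. Qed.

Lemma cvg_natr_inv (R : realType) (I : Type) (F : set_system I) {FF : Filter F}
    (N : I -> nat) : N @ F --> \oo -> ((N i)%:R^-1 : R) @[i --> F] --> (0 : R).
Proof.
move=> Noo; apply/gtr0_cvgV0; last exact: (cvg_comp _ _ Noo (@cvgr_idn R)).
by near=> i; rewrite ltr0n; near: i; exact: (Noo _ (nbhs_infty_gt 0)).
Unshelve. all: by end_near. Qed.

Lemma poisson_collision_dist (R : realType) (l l' : R) : 0 <= l -> 0 <= l' ->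
  `|poisson_collision l - poisson_collision l'| <= 2 * `|l - l'|.
Proof.
move=> l0 l'0; have [l'l|ll'] := leP l' l.
  by rewrite [`|l - l'|]ger0_norm ?subr_ge0 // poisson_collision_lipschitz ?l'0.
rewrite distrC [`|l - l'|]distrC [`|l' - l|]gtr0_norm ?subr_gt0 //.
by rewrite poisson_collision_lipschitz ?l0 ?ltW.
Qed.

Lemma cvg_binomial_collision_poisson (R : realType) (I : Type)
    (F : set_system I) {FF : Filter F} (N : I -> nat) (p : I -> R) (l : R) :
  N @ F --> \oo -> (\forall i \near F, 0 <= p i <= 1) -> 0 <= l ->
  (N i)%:R * p i @[i --> F] --> l ->
  binomial_collision (N i) (p i) @[i --> F] --> poisson_collision l.
Proof.
move=> Noo p01 l_ge0 Npl.
have Np0 : \forall i \near F, 0 <= (N i)%:R * p i.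
  by apply: filterS p01 => i /andP[p0 _]; rewrite mulr_ge0.
pose err i := 5 * (((N i)%:R * p i) ^+ 2 * (N i)%:R^-1) +
              2 * `|(N i)%:R * p i - l|.
have err0 : err @ F --> 0.
  have -> : 0 = 5 * (l ^+ 2 * 0) + 2 * `|l - l| :> R.
    by rewrite subrr normr0 !mulr0 addr0.
  apply: cvgD; (apply: cvgM; first exact: cvg_cst).
    by apply: cvgM; [exact: cvg_exprn|exact: cvg_natr_inv].
  by apply: cvg_norm; apply: cvgB => //; exact: cvg_cst.
apply/cvgrPdist_le => e e0.
move/cvgr0Pnorm_le : err0 => /(_ _ e0) err0.
near=> i.
have /andP[p0 p1] : 0 <= p i <= 1 by near: i.
have N0 : 0 < (N i)%:R :> R.
  by rewrite ltr0n; near: i; exact: (Noo _ (nbhs_infty_gt 0)).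
have := @multinomial_collision_poisson R (N i) [:: p i].
rewrite /= p0 !big_seq1 => /(_ isT p1).
rewrite (_ : \sum_(ks <- _) _ = binomial_collision (N i) (p i)); last first.
  by rewrite big_multi_indices1.
set np := (N i)%:R * p i => le5.
have np0 : 0 <= np by rewrite mulr_ge0.
apply: le_trans (_ : err i <= _); last first.
  by apply: le_trans (ler_norm _) _; near: i.
rewrite distrC; apply: le_trans (ler_distD (poisson_collision np) _ _) _.
apply: lerD; last exact: poisson_collision_dist.
apply: le_trans le5 _.
rewrite /np le_eqVlt; apply/orP; left; apply/eqP; congr (_ * _).
by field; rewrite gt_eqF.
Unshelve. all: by end_near. Qed.

Section MultinomialCollision.
Context {R : realType}.
Implicit Types (s : seq R).

(** The collision probability of two independent multinomial variables whose
    cell probabilities are proportional to a and s. *)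
Definition multinomial_collision N (a : R) s : R :=
  \sum_(ks <- multi_indices (size s) N)
    (mweight N a s ks / (a + \sum_(x <- s) x) ^+ N) ^+ 2.

Lemma multinomial_collision_nil N (a : R) : a != 0 ->
  multinomial_collision N a [::] = 1.
Proof.
move=> a0; rewrite /multinomial_collision big_multi_indices0 big_nil addr0 /=.
by rewrite divff ?expr1n // expf_neq0.
Qed.

Lemma multinomial_collision_cons N (a x : R) s :
  0 < a -> all (fun x => 0 <= x) (x :: s) ->
  multinomial_collision N a (x :: s) =
  \sum_(k < N.+1) binomial_weight N (x / (a + \sum_(y <- x :: s) y)) k ^+ 2 *
    multinomial_collision (N - k) a s.
Proof.
move=> a0 /= /andP[x0 s0]; rewrite /multinomial_collision big_multi_indicesS.
set t := a + \sum_(y <- s) y.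
have t0 : 0 < t.
  rewrite ltr_wpDr // big_seq sumr_ge0 // => y ys; move/allP: s0; exact.
have -> : a + \sum_(y <- x :: s) y = t + x by rewrite big_cons /t; ring.
have tx0 : t + x != 0 by rewrite gt_eqF // ltr_wpDr.
apply: eq_bigr => -[k k_N] _; rewrite mulr_sumr; apply: eq_bigr => ks _ /=.
rewrite -exprMn; congr (_ ^+ 2); rewrite /binomial_weight.
have -> : 1 - x / (t + x) = t / (t + x) by field.
have kN : (k <= N)%N by [].
rewrite -[in LHS](subnKC kN) exprD !expr_div_n.
have := expf_neq0 k tx0; have := expf_neq0 (N - k) tx0.
have := expf_neq0 (N - k) (lt0r_neq0 t0); rewrite subnKC //.
move: (t ^+ (N - k)) ((t + x) ^+ (N - k)) ((t + x) ^+ k) => u v w u0 v0 w0.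
by field; apply/and3P; split.
Qed.

Lemma multinomial_collision_ge0 N (a : R) s : 0 <= multinomial_collision N a s.
Proof. by apply: sumr_ge0 => ks _; exact: sqr_ge0. Qed.

Lemma multinomial_collision_le1 N (a : R) s :
  0 < a -> all (fun x => 0 <= x) s -> multinomial_collision N a s <= 1.
Proof.
move=> a0; elim: s N => [|x s IH] N; first by rewrite multinomial_collision_nil ?gt_eqF.
move=> xs0; rewrite multinomial_collision_cons //; move: xs0 => /= /andP[x0 s0].
have t0 : 0 <= \sum_(y <- s) y.
  by rewrite big_seq sumr_ge0 // => y ys; move/allP: s0; exact.
set p := x / _; have p01 : 0 <= p <= 1.
  have tot : 0 < a + \sum_(y <- x :: s) y.
    by rewrite big_cons ltr_wpDr // addr_ge0.
  by rewrite divr_ge0 ?(ltW tot) //= ler_pdivrMr // mul1r big_cons; lra.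
rewrite -(binomial_weight_mass1 N p); apply: ler_sum => -[k k_N] _ /=.
have w0 := binomial_weight_ge0 N k p01.
have w1 : binomial_weight N p k <= 1.
  rewrite -(binomial_weight_mass1 N p) (bigD1 (Ordinal k_N)) //= lerDl.
  by apply: sumr_ge0 => j _; exact: binomial_weight_ge0.
rewrite -[leRHS]mulr1 ler_pM ?IH ?sqr_ge0 ?multinomial_collision_ge0 //.
by rewrite expr2 ler_piMl.
Qed.

End MultinomialCollision.

Section CollisionLimit.
Context {R : realType}.

(** The limit of a multinomial collision probability, in which the coordinates
    selected by t are Poissonian with limit parameters lam and the other
    coordinates have the non-zero limits sigma. *)
Definition collision_limit d (t : nat -> bool) (lam sigma : nat -> R) (a : R) : R :=
  let c := (\sum_(j < d) ~~ t j)%N in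
  (\prod_(j < d) if t j then poisson_collision (lam j) else 1) *
  (Num.sqrt ((4 * pi) ^+ c * a * (\prod_(j < d) if t j then 1 else sigma j) /
             (a + \sum_(j < d) sigma j) ^+ c.+1))^-1.

Lemma cvg_index_diff {I : Type} (F : set_system I) {FF : Filter F}
    (N : I -> nat) (p : I -> R) (l : R) : N @ F --> \oo -> p @ F --> l -> l < 1 ->
  ((N z.1 - z.2)%N @[z --> concentrated F N p] --> \oo) /\
  (((N z.1 - z.2)%N%:R / (N z.1)%:R : R) @[z --> concentrated F N p] --> 1 - l).
Proof.
move=> Noo pl l1.
have Noo' : N z.1 @[z --> concentrated F N p] --> \oo by exact: cvg_concentrated_fst.
have ratio : (z.2%:R / (N z.1)%:R : R) @[z --> concentrated F N p] --> l.
  exact: cvg_concentrated_ratio.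
have kN : \forall z \near concentrated F N p, (z.2 <= N z.1)%N.
  by exists 1 => //; apply: nearW => i k.
have ratio' : ((N z.1 - z.2)%N%:R / (N z.1)%:R : R) @[z --> concentrated F N p] --> 1 - l.
  have eqf : \forall z \near concentrated F N p,
      1 - z.2%:R / (N z.1)%:R = (N z.1 - z.2)%N%:R / (N z.1)%:R :> R.
    near=> z.
    have kNz : (z.2 <= N z.1)%N by near: z.
    have N0 : (N z.1)%:R != 0 :> R.
      rewrite pnatr_eq0 -lt0n; near: z; exact: (Noo' _ (nbhs_infty_gt 0)).
    by rewrite natrB // mulrBl divff.
  apply: cvg_trans (near_eq_cvg eqf) _.
  by apply: cvgB => //; exact: cvg_cst.
split => //.
have e0 : 0 < (1 - l) / 2 by rewrite divr_gt0 // subr_gt0.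
have lt1 : (1 - l) / 2 < 1 - l.
  by rewrite ltr_pdivrMr // ltr_pMr ?subr_gt0 // ltr1n.
have ratio_gt : \forall z \near concentrated F N p,
    (1 - l) / 2 < (N z.1 - z.2)%N%:R / (N z.1)%:R.
  exact: (cvgr_gt _ ratio').
apply/cvgnyPge => A; pose B := Num.bound (A%:R / ((1 - l) / 2)).
near=> z.
have N0 : 0 < (N z.1)%:R :> R.
  rewrite ltr0n; near: z; exact: (Noo' _ (nbhs_infty_gt 0)).
have BN : (B <= N z.1)%N by near: z; exact: (Noo' _ (nbhs_infty_ge B)).
have : (1 - l) / 2 < (N z.1 - z.2)%N%:R / (N z.1)%:R by near: z.
rewrite ltr_pdivlMr // => lt2.
rewrite -(@ler_nat R); apply: ltW; apply: le_lt_trans lt2.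
rewrite -ler_pdivrMl // mulrC; apply: le_trans (_ : B%:R <= _); last by rewrite ler_nat.
by rewrite ltW // archi_boundP // divr_ge0 // ltW.
Unshelve. all: by end_near. Qed.

Lemma sqrtr_exprn (x : R) n : 0 <= x -> Num.sqrt (x ^+ n) = Num.sqrt x ^+ n.
Proof.
move=> x0; elim: n => [|n IH]; first by rewrite !expr0 sqrtr1.
by rewrite !exprS sqrtrM // IH.
Qed.

Lemma collision_limitS d t (lam sigma : nat -> R) (a : R)
    (p := sigma 0%N / (a + \sum_(j < d.+1) sigma j))
    (c := (\sum_(j < d) ~~ t j.+1)%N) :
  0 < a -> (forall j, (j < d.+1)%N -> if t j then sigma j = 0 else 0 < sigma j) ->
  collision_limit d.+1 t lam sigma a =
  (if t 0%N then poisson_collision (lam 0%N) else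
     (Num.sqrt (4 * pi * (p * (1 - p))))^-1) *
  ((Num.sqrt (1 - p) ^+ c)^-1 *
   collision_limit d (fun j => t j.+1) (fun j => lam j.+1) (fun j => sigma j.+1) a).
Proof.
move=> a0 Hs; rewrite /collision_limit !big_ord_recl /= -/c.
set S := \sum_(j < d) sigma j.+1; set pr := \prod_(j < d) (if t j.+1 then 1 else _).
set ph := \prod_(j < d) _.
have Hs' j : (j < d.+1)%N -> 0 <= sigma j.
  by move=> /Hs; case: ifP => _ => [->|/ltW].
have S0 : 0 <= S by rewrite sumr_ge0 // => j _; apply: Hs'; rewrite ltnS.
have aS0 : 0 < a + S by rewrite ltr_wpDr.
have pr0 : 0 < pr.
  apply: prodr_gt0 => j _; have := Hs j.+1 (ltn_ord j : (j.+1 < d.+1)%N).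
  by case: ifP.
have pi0 := pi_gt0 R.
have /= s0 := Hs' 0%N isT.
have tot : 0 < a + (sigma 0%N + S) by rewrite addrCA ltr_wpDl.
have q0 : 1 - p = (a + S) / (a + (sigma 0%N + S)).
  by rewrite /p big_ord_recl -/S; field; rewrite gt_eqF.
have [t0|nt0] := boolP (t 0%N).
  have sig0 : sigma 0%N = 0 by have := Hs 0%N isT; rewrite t0.
  rewrite /= add0n mul1r sig0 add0r.
  have -> : p = 0 by rewrite /p sig0 mul0r.
  by rewrite subr0 sqrtr1 expr1n invr1 mul1r mulrA.
have s00 : 0 < sigma 0%N by have := Hs 0%N isT; rewrite (negbTE nt0).
have pE : p = sigma 0%N / (a + (sigma 0%N + S)) by rewrite /p big_ord_recl.
have p0 : 0 < p by rewrite pE divr_gt0.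
have p1 : 0 < 1 - p by rewrite q0 divr_gt0.
clearbody p; rewrite /= add1n mul1r [RHS]mulrA [RHS]mulrCA.
congr (_ * _); rewrite -!invfM -sqrtr_exprn ?(ltW p1) //.
have pp0 : 0 <= 4 * pi * (p * (1 - p)) by rewrite !mulr_ge0 // ltW.
rewrite -sqrtrM // -sqrtrM; last by rewrite mulr_ge0 // exprn_ge0 // ltW.
congr ((Num.sqrt _)^-1); rewrite q0 pE [((a + S) / _) ^+ c]expr_div_n !exprS.
move: (4 * pi) => b; have b0 : b ^+ c * pr = b ^+ c * pr by [].
have := expf_neq0 c (lt0r_neq0 tot); have := expf_neq0 c (lt0r_neq0 aS0).
move: (lt0r_neq0 tot) (lt0r_neq0 aS0).
move: (_ ^+ c) ((a + S) ^+ c) ((a + (sigma 0%N + S)) ^+ c) => u v w.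
move: (a + S) (a + (sigma 0%N + S)) => y z z0 y0 v0 w0.
by field; repeat (apply/andP; split).
Qed.

End CollisionLimit.

(** Conditionally on the first coordinate k, the other coordinates follow a
    multinomial law with N - k trials. As k / N concentrates around p, the
    limit for the remaining coordinates may be taken along the filter of
    pairs (i, k) with k / N close to p. *)
Lemma cvg_multinomial_collision {R : realType} d {I : Type} (F : set_system I) {FF : Filter F}
    (N : I -> nat) (a : I -> R) (s : nat -> I -> R) t (lam sigma : nat -> R)
    (a0 : R) :
  let tot i := a i + \sum_(j < d) s j i in
  N @ F --> \oo -> a @ F --> a0 -> 0 < a0 ->
  (forall j, (j < d)%N -> \forall i \near F, 0 <= s j i) ->
  (forall j, (j < d)%N -> s j @ F --> sigma j) ->
  (forall j, (j < d)%N -> if t j then sigma j = 0 else 0 < sigma j) ->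
  (forall j, (j < d)%N -> t j -> 0 <= lam j) ->
  (forall j, (j < d)%N -> t j -> (N i)%:R * (s j i / tot i) @[i --> F] --> lam j) ->
  Num.sqrt (N i)%:R ^+ (\sum_(j < d) ~~ t j)%N *
    multinomial_collision (N i) (a i) (mkseq (fun j => s j i) d) @[i --> F]
  --> collision_limit d t lam sigma a0.
Proof.
elim: d I F FF N a s t lam sigma.
  move=> I F FF N a s t lam sigma tot Noo aa0 a0_gt0 _ _ _ _ _.
  rewrite /collision_limit !big_ord0 mul1r expr0 !expr1 addr0 mul1r mulr1.
  rewrite divff ?gt_eqF // sqrtr1 invr1.
  apply: cvg_trans (@cvg_cst _ (1 : R) _ F _); apply: near_eq_cvg.
  have a_gt0 := cvgr_gt _ aa0 _ a0_gt0.
  near=> i; rewrite /= expr0 mul1r multinomial_collision_nil // gt_eqF //.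
  by near: i; exact: (cvgr_gt _ aa0).
move=> d IH I F FF N a s t lam sigma tot Noo aa0 a0_gt0 s_ge0 ssig Hsig lam0 Nlam.
set c := (\sum_(j < d) ~~ t j.+1)%N.
pose tot' i := a i + \sum_(j < d) s j.+1 i.
pose p i := s 0%N i / tot i.
pose T0 := a0 + \sum_(j < d.+1) sigma j; pose T0' := a0 + \sum_(j < d) sigma j.+1.
have sig0 j : (j < d.+1)%N -> 0 <= sigma j.
  by move=> /Hsig; case: ifP => _ => [->|/ltW].
have T0'_gt0 : 0 < T0'.
  by rewrite ltr_wpDr // sumr_ge0 // => j _; apply: sig0; rewrite ltnS.
have T0E : T0 = sigma 0%N + T0' by rewrite /T0 big_ord_recl /= /T0'; ring.
have T0_gt0 : 0 < T0 by rewrite T0E ltr_wpDl // sig0.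
have totT : tot @ F --> T0.
  by apply: cvgD => //; apply: cvg_big_sum => j _; exact: ssig.
have totT' : tot' @ F --> T0'.
  by apply: cvgD => //; apply: cvg_big_sum => j _; apply: ssig; rewrite ltnS.
have totE i : tot i = s 0%N i + tot' i.
  by rewrite /tot big_ord_recl /tot' /=; ring.
pose p0 := sigma 0%N / T0.
have pp0 : p @ F --> p0.
  by apply: cvgM; [exact: ssig|apply: cvgV => //; rewrite gt_eqF].
have p0_lt1 : p0 < 1 by rewrite ltr_pdivrMr // mul1r T0E ltrDl.
have p0E : 1 - p0 = T0' / T0 by rewrite /p0 T0E; field; rewrite -T0E gt_eqF.
have s_ge0' : \forall i \near F, forall j, (j < d.+1)%N -> 0 <= s j i.
  have := @filter_forall; have : \forall i \near F, forall j : 'I_d.+1, 0 <= s j i.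
    by apply: filter_forall => j; exact: s_ge0.
  by move=> Fs _; apply: filterS Fs => i Hi j j_d; exact: (Hi (Ordinal j_d)).
have a_gt0 : \forall i \near F, 0 < a i by exact: (cvgr_gt _ aa0).
have tot_gt0 : \forall i \near F, 0 < tot i by exact: (cvgr_gt _ totT).
have tot'_gt0 : \forall i \near F, 0 < tot' i by exact: (cvgr_gt _ totT').
have p01 : \forall i \near F, 0 <= p i <= 1.
  near=> i; have tot0 : 0 < tot i by near: i.
  have tot0' : 0 < tot' i by near: i.
  have s0 : 0 <= s 0%N i by near: i; exact: s_ge0.
  by rewrite divr_ge0 ?(ltW tot0) //= ler_pdivrMr // mul1r totE lerDl ltW.
have Noo1 : \forall i \near F, 1 <= (N i)%:R :> R.
  by near=> i; rewrite ler1n; near: i; exact: (Noo _ (nbhs_infty_gt 0)).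
have sqrt_le i n : 1 <= (N i)%:R :> R -> Num.sqrt (N i)%:R ^+ n <= (N i)%:R ^+ n :> R.
  by move=> N1; rewrite lerXn2r ?nnegrE ?sqrtr_ge0 ?sqrtr_le_id.
have [N'oo ratio] := cvg_index_diff Noo pp0 p0_lt1.
pose G := concentrated F N p.
pose N' (z : I * nat) := (N z.1 - z.2)%N.
have liftG (V : topologicalType) (f : I -> V) (l : V) :
    f @ F --> l -> f z.1 @[z --> G] --> l.
  exact: cvg_concentrated_fst.
have near_fst (A : set I) : F A -> \forall z \near G, A z.1.
  by move=> FA; exists 1 => //; apply: filterS FA.
have liftN : N z.1 @[z --> G] --> \oo by exact: cvg_concentrated_fst.
have cvgIH : Num.sqrt (N' z)%:R ^+ c * multinomial_collision (N' z) (a z.1)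
     (mkseq (fun j => s j.+1 z.1) d) @[z --> G] -->
   collision_limit d (fun j => t j.+1) (fun j => lam j.+1) (fun j => sigma j.+1) a0.
  apply: (IH _ G _ N' (a \o fst) (fun j z => s j.+1 z.1)) => //.
  - exact: liftG.
  - by move=> j j_d; exact: near_fst (s_ge0 j.+1 j_d).
  - by move=> j j_d; apply: liftG; exact: ssig.
  - by move=> j j_d; exact: Hsig.
  - by move=> j j_d; exact: lam0.
  - move=> j j_d tj.
    pose f (z : I * nat) := (N' z)%:R / (N z.1)%:R *
      ((N z.1)%:R * (s j.+1 z.1 / tot z.1)) * (tot z.1 * (tot' z.1)^-1) : R.
    have fE : \forall z \near G, f z = (N' z)%:R * (s j.+1 z.1 / tot' z.1).
      near=> z; rewrite /f.
      have N0 : (N z.1)%:R != 0 :> R.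
        by rewrite pnatr_eq0 -lt0n; near: z; exact: (liftN _ (nbhs_infty_gt 0)).
      have t0 : tot z.1 != 0 by rewrite gt_eqF //; near: z; exact: near_fst tot_gt0.
      have t0' : tot' z.1 != 0.
        by rewrite gt_eqF //; near: z; exact: near_fst tot'_gt0.
      by field; apply/and3P; split.
    apply: cvg_trans (near_eq_cvg fE) _.
    have -> : lam j.+1 = (1 - p0) * lam j.+1 * (T0 * T0'^-1).
      by rewrite p0E; field; rewrite !gt_eqF.
    apply: cvgM; first by apply: cvgM => //; exact: (liftG _ _ _ (Nlam j.+1 j_d tj)).
    by apply: cvgM; [exact: liftG|apply: cvgV; [rewrite gt_eqF|exact: liftG]].

have cvg_g : Num.sqrt (N z.1)%:R ^+ c * multinomial_collision (N' z) (a z.1)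
     (mkseq (fun j => s j.+1 z.1) d) @[z --> G] -->
   (Num.sqrt (1 - p0) ^+ c)^-1 *
   collision_limit d (fun j => t j.+1) (fun j => lam j.+1) (fun j => sigma j.+1) a0.
  pose f (z : I * nat) := (Num.sqrt ((N' z)%:R / (N z.1)%:R) ^+ c)^-1 *
    (Num.sqrt (N' z)%:R ^+ c * multinomial_collision (N' z) (a z.1)
     (mkseq (fun j => s j.+1 z.1) d)) : R.
  have fE : \forall z \near G, f z = Num.sqrt (N z.1)%:R ^+ c *
      multinomial_collision (N' z) (a z.1) (mkseq (fun j => s j.+1 z.1) d).
    near=> z; rewrite /f mulrA; congr (_ * _).
    have N0 : 0 < (N z.1)%:R :> R.
      by rewrite ltr0n; near: z; exact: (liftN _ (nbhs_infty_gt 0)).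
    have N'0 : 0 < (N' z)%:R :> R.
      by rewrite ltr0n; near: z; exact: (N'oo _ (nbhs_infty_gt 0)).
    rewrite sqrtrM ?ler0n // sqrtrV ?ler0n // expr_div_n invf_div mulfVK //.
    by rewrite expf_neq0 // gt_eqF // sqrtr_gt0.
  apply: cvg_trans (near_eq_cvg fE) _.
  have sp0 : Num.sqrt (1 - p0) ^+ c != 0.
    by rewrite expf_neq0 // gt_eqF // sqrtr_gt0 subr_gt0.
  apply: cvgM => //; apply: cvgV => //; apply: cvg_exprn; exact: cvg_sqrtr.
pose W i k := Num.sqrt (N i)%:R ^+ (~~ t 0%N) * binomial_weight (N i) (p i) k ^+ 2 : R.
pose g i k := Num.sqrt (N i)%:R ^+ c * multinomial_collision (N i - k) (a i)
  (mkseq (fun j => s j.+1 i) d) : R.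
have massW : \sum_(k < (N i).+1) W i k @[i --> F] -->
    (if t 0%N then poisson_collision (lam 0%N) else
     (Num.sqrt (4 * pi * (p0 * (1 - p0))))^-1).
  have -> : (fun i => \sum_(k < (N i).+1) W i k) =
    (fun i => Num.sqrt (N i)%:R ^+ (~~ t 0%N) * binomial_collision (N i) (p i)).
    by apply/funext => i; rewrite mulr_sumr.
  case: ifP => [t0|t0].
    have -> : (fun i => Num.sqrt (N i)%:R ^+ (~~ true) *
      binomial_collision (N i) (p i)) = (fun i => binomial_collision (N i) (p i)).
      by apply/funext => i; rewrite expr0 mul1r.
    apply: cvg_binomial_collision_poisson => //; first exact: lam0.
    exact: Nlam.
  have p0_gt0 : 0 < p0 by rewrite divr_gt0 //; have := Hsig 0%N isT; rewrite t0.
  have -> : (fun i => Num.sqrt (N i)%:R ^+ (~~ false) *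
      binomial_collision (N i) (p i)) =
    (fun i => Num.sqrt (N i)%:R * binomial_collision (N i) (p i)).
    by apply/funext => i; rewrite expr1.
  by apply: cvg_binomial_collision => //; rewrite p0_gt0.
rewrite collision_limitS // -/c -/T0 -/p0.
have sumE : \forall i \near F, \sum_(k < (N i).+1) W i k * g i k =
    Num.sqrt (N i)%:R ^+ (\sum_(j < d.+1) ~~ t j)%N *
    multinomial_collision (N i) (a i) (mkseq (fun j => s j i) d.+1).
  near=> i.
  have si0 : forall j, (j < d.+1)%N -> 0 <= s j i by near: i.
  have ai0 : 0 < a i by near: i.
  have mkseqE : mkseq (fun j => s j i) d.+1 = s 0%N i :: mkseq (fun j => s j.+1 i) d.
    by rewrite /mkseq /= -[iota 1 d]/(iota (1 + 0) d) iotaDl -map_comp.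
  rewrite mkseqE multinomial_collision_cons //; last first.
    rewrite -mkseqE; apply/(all_nthP 0) => j; rewrite size_mkseq => j_d.
    by rewrite nth_mkseq // si0.
  rewrite -mkseqE big_mkseq -/(tot i) -/(p i) big_ord_recl exprD mulr_sumr -/c.
  by apply: eq_bigr => k _; rewrite /W /g; ring.
apply: cvg_trans (near_eq_cvg sumE) _.
apply: (@cvg_average _ _ F N p FF W g c.+1) => //.
- near=> i => k k_N; have p01i : 0 <= p i <= 1 by near: i.
  have N1 : 1 <= (N i)%:R :> R by near: i.
  have w0 := binomial_weight_ge0 (N i) k p01i.
  have w1 : binomial_weight (N i) (p i) k <= 1.
    rewrite -(binomial_weight_mass1 (N i) (p i)).
    rewrite (bigD1 (Ordinal (k_N : (k < (N i).+1)%N))) //= lerDl.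
    by apply: sumr_ge0 => j _; exact: binomial_weight_ge0.
  rewrite /W mulr_ge0 ?exprn_ge0 ?sqrtr_ge0 ?sqr_ge0 //=.
  apply: ler_pM; rewrite ?exprn_ge0 ?sqrtr_ge0 //; last first.
    by rewrite expr2 ler_piMl.
  apply: le_trans (sqrt_le _ _ N1) _; rewrite ler_weXn2l //.
  by case: (t 0%N).
- near=> i => k k_N; have N1 : 1 <= (N i)%:R :> R by near: i.
  have si0 : forall j, (j < d.+1)%N -> 0 <= s j i by near: i.
  have ai0 : 0 < a i by near: i.
  have C0 := multinomial_collision_ge0 (N i - k) (a i) (mkseq (fun j => s j.+1 i) d).
  rewrite /g ger0_norm ?mulr_ge0 ?exprn_ge0 ?sqrtr_ge0 //.
  rewrite -[leRHS]mulr1 ler_pM ?exprn_ge0 ?sqrtr_ge0 //.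
    by apply: le_trans (sqrt_le _ _ N1) _; rewrite ler_weXn2l.
  apply: multinomial_collision_le1 => //.
  by apply/(all_nthP 0) => j; rewrite size_mkseq => j_d; rewrite nth_mkseq // si0.
Unshelve. all: by end_near. Qed.

(** * Second order Taylor expansions from partial derivatives *)

Section Taylor.
Context {R : realType}.

Lemma is_derive_line {V : normedModType R} (f : V -> R) (y v : V) (s : R) :
  derivable f (s *: v + y) v ->
  is_derive s 1 (fun t : R => f (t *: v + y)) ('D_v f (s *: v + y)).
Proof.
have E : (fun h : R => h^-1 *: (f ((h *: (1 : R) + s) *: v + y) - f (s *: v + y))) =
  (fun h => h^-1 *: (f (h *: v + (s *: v + y)) - f (s *: v + y))).
  by apply/funext => h; rewrite scalerDl addrA [h *: 1]mulr1.
by move=> df; apply: DeriveDef; rewrite /derivable /derive E.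
Qed.

Lemma line_MVT {V : normedModType R} (f : V -> R) (y v : V) (t : R) :
  (forall s, `|s| <= `|t| -> derivable f (s *: v + y) v) ->
  exists2 s, `|s| <= `|t| & f (t *: v + y) - f y = t * 'D_v f (s *: v + y).
Proof.
move=> df; pose phi (s : R) := f (s *: v + y).
have dphi (s : R) : `|s| <= `|t| -> is_derive s 1 phi ('D_v f (s *: v + y)).
  by move=> /df; exact: is_derive_line.
have phi0 : phi 0 = f y by rewrite /phi scale0r add0r.
have cphi a b : {in `[a, b], forall s, `|s| <= `|t|} ->
    {within `[a, b], continuous phi}.
  move=> le_t; apply: derivable_within_continuous => s s_ab.
  by have [] := dphi s (le_t s s_ab).
have [t0|t0] := leP 0 t.
  have le_t : {in `[0, t], forall s, `|s| <= `|t|}.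
    by move=> s; rewrite in_itv /= => /andP[s0 st]; rewrite !ger0_norm.
  have [s|s s_t] := MVT_segment (df := fun s => 'D_v f (s *: v + y)) t0 _ (cphi _ _ le_t).
    by move=> s_t; apply/dphi/le_t/subset_itv_oo_cc.
  by rewrite phi0 subr0 mulrC => eq_phi; exists s => //; exact: le_t.
have le_t : {in `[t, 0], forall s, `|s| <= `|t|}.
  move=> s; rewrite in_itv /= => /andP[ts s0].
  by rewrite ler0_norm // ltr0_norm // lerN2.
have [s|s s_t] := MVT_segment (df := fun s => 'D_v f (s *: v + y)) (ltW t0) _ (cphi _ _ le_t).
  by move=> s_t; apply/dphi/le_t/subset_itv_oo_cc.
rewrite phi0 sub0r => eq_phi; exists s; first exact: le_t.
by apply: oppr_inj; rewrite opprB eq_phi; ring.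
Qed.

(** Continuous partial derivatives are enough for the directional derivatives
    to be given by the gradient: the coordinates are moved one at a time. *)
Lemma is_derive_partial {d : nat} (g : 'rV[R]_d -> R) (x h : 'rV[R]_d) :
  (forall i, \forall y \near x, derivable g y (delta_mx ord0 i)) ->
  (forall i, {for x, continuous (partial i g)}) ->
  is_derive x h g (\sum_i h ord0 i * partial i g x).
Proof.
move=> dg cg; pose e i : 'rV[R]_d := delta_mx ord0 i.
pose hr (r : seq 'I_d) : 'rV[R]_d := \sum_(i <- r) h ord0 i *: e i.
suff lim r : t^-1 *: (g (t *: hr r + x) - g x) @[t --> (0 : R)^'] -->
    \sum_(i <- r) h ord0 i * partial i g x.
  have hE : h = hr (index_enum 'I_d) by rewrite /hr {1}[h]row_sum_delta.
  have := lim (index_enum 'I_d); rewrite -hE => lim_h.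
  by apply: DeriveDef; [apply/cvg_ex; eexists; exact: lim_h|exact: cvg_lim lim_h].
elim: r => [|i r IH].
  rewrite big_nil (_ : (fun t => _) = cst 0); first exact: cvg_cst.
  by apply/funext => t; rewrite /hr big_nil scaler0 add0r subrr scaler0.
rewrite big_cons.
pose A (t : R) := t^-1 *: (g ((t * h ord0 i) *: e i + (t *: hr r + x)) -
                   g (t *: hr r + x)).
have -> : (fun t => t^-1 *: (g (t *: hr (i :: r) + x) - g x)) =
    (fun t => A t + t^-1 *: (g (t *: hr r + x) - g x)).
  apply/funext => t; rewrite /A -scalerDr addrA subrK /hr big_cons.
  by rewrite [t *: (_ + _)]scalerDr scalerA addrA.
apply: cvgD => //.
pose c := h ord0 i; pose K := `|c| * `|e i| + `|hr r| + 1.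
have K0 : 0 < K by rewrite ltr_wpDl // addr_ge0 // mulr_ge0.
apply/cvgrPdist_le => eps eps0.
have c1 : 0 < `|c| + 1 by rewrite ltr_wpDl.
have e1 : 0 < eps / (`|c| + 1) by rewrite divr_gt0.
have /nbhs_ballP[del /= del0 Hdel] : \forall y \near x, derivable g y (e i) /\
    `|partial i g x - partial i g y| <= eps / (`|c| + 1).
  near=> y; split; first by near: y; exact: dg.
  by near: y; move/cvgrPdist_le : (cg i); exact.
near=> t.
have t0 : t != 0 by near: t; exact: nbhs_dnbhs_neq.
have t_lt : `|t| < del / K.
  near: t; apply: dnbhs0_lt; exact: divr_gt0.
have inball s : `|s| <= `|t * c| -> ball x del (s *: e i + (t *: hr r + x)).
  move=> s_le; rewrite -ball_normE /= distrC addrA addrK.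
  apply: le_lt_trans (ler_normD _ _) _; rewrite !normrZ.
  apply: le_lt_trans (_ : `|t| * K < _); last by rewrite -ltr_pdivlMr.
  rewrite /K mulrDr mulrDr mulr1; apply: le_trans (_ : `|t| * (`|c| * `|e i|) +
     `|t| * `|hr r| <= _); last by rewrite lerDl.
  by rewrite lerD2r mulrA -normrM ler_wpM2r.
have [s s_le eq_g] := @line_MVT _ g (t *: hr r + x) (e i) (t * c)
  (fun s s_le => (Hdel _ (inball s s_le)).1).
rewrite /A -/c eq_g; have := (Hdel _ (inball s s_le)).2.
rewrite -/(partial i g (s *: e i + (t *: hr r + x))) => close.
rewrite -/(partial i g x) [_ *: _]mulrA mulrA mulVf // mul1r -mulrBr normrM.
apply: le_trans (_ : `|c| * (eps / (`|c| + 1)) <= _); first by rewrite ler_wpM2l.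
by rewrite mulrA ler_pdivrMr // mulrC ler_wpM2l ?(ltW eps0) // lerDl.
Unshelve. all: by end_near. Qed.

(** Taylor's formula for t |-> f (y + t h), by Rolle's theorem. *)
Lemma taylor2 {d : nat} (U : set 'rV[R]_d) (f : 'rV[R]_d -> R) (y h : 'rV[R]_d) :
  open U -> C2_on U f -> (forall s : R, 0 <= s <= 1 -> U (s *: h + y)) ->
  exists2 s : R, 0 <= s <= 1 &
    f (h + y) = f y + \sum_i h ord0 i * partial i f y +
      2^-1 * \sum_i \sum_j h ord0 i * h ord0 j *
        partial j (partial i f) (s *: h + y).
Proof.
move=> oU fU segU.
have dU x i : U x -> derivable f x (delta_mx ord0 i) by move=> /fU[_ /(_ i)[]].
have nearU x : U x -> \forall z \near x, U z.
  by move=> Ux; apply: open_nbhs_nbhs; split.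
pose phi (s : R) := f (s *: h + y).
pose phi1 (s : R) := \sum_i h ord0 i * partial i f (s *: h + y).
pose phi2 (s : R) := \sum_i h ord0 i *
  (\sum_j h ord0 j * partial j (partial i f) (s *: h + y)).
have dphi (s : R) : 0 <= s <= 1 -> is_derive s 1 phi (phi1 s).
  move=> s01; have Us := segU s s01.
  have [df Df] : is_derive (s *: h + y) h f (phi1 s).
    apply: is_derive_partial => i.
      by apply: filterS (nearU _ Us) => z; exact: dU.
    by have [_ /(_ i)[]] := fU _ Us.
  by rewrite -Df; exact: is_derive_line.
have dpartial i (s : R) : 0 <= s <= 1 ->
    is_derive s 1 (fun s => partial i f (s *: h + y))
      (\sum_j h ord0 j * partial j (partial i f) (s *: h + y)).
  move=> s01; have Us := segU s s01.
  have [df Df] : is_derive (s *: h + y) h (partial i f)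
      (\sum_j h ord0 j * partial j (partial i f) (s *: h + y)).
    apply: is_derive_partial => j.
      apply: filterS (nearU _ Us) => z Uz.
      by have [_ /(_ i)[_ _ /(_ j)[]]] := fU _ Uz.
    by have [_ /(_ i)[_ _ /(_ j)[]]] := fU _ Us.
  by rewrite -Df; exact: is_derive_line.
have dphi1 (s : R) : 0 <= s <= 1 -> is_derive s 1 phi1 (phi2 s).
  move=> s01; rewrite /phi1 (_ : (fun s => _) =
    \sum_i (fun s : R => h ord0 i * partial i f (s *: h + y))); last first.
    by apply/funext => z; rewrite fct_sumE.
  apply: is_derive_sum => i; have := is_deriveZ (h ord0 i) (dpartial i s s01).
  by [].
pose K := phi 1 - phi 0 - phi1 0.
pose psi (s : R) := phi 1 - phi s - phi1 s * (1 - s) - K * (1 - s) ^+ 2.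
have dpsi (s : R) : 0 <= s <= 1 ->
    is_derive s 1 psi (2 * K * (1 - s) - phi2 s * (1 - s)).
  move=> s01; have d1 := dphi s s01; have d2 := dphi1 s s01.
  have -> : psi = cst (phi 1) - phi - phi1 * (cst 1 - id) -
      cst K * ((cst 1 - id) * (cst 1 - id)) by apply/funext.
  have d3 : is_derive s 1 (cst 1 - id : R -> R) (0 - 1) by exact: is_deriveB.
  have d4 := is_deriveB (is_deriveB (is_deriveB (is_derive_cst (phi 1) s 1) d1)
    (is_deriveM d2 d3)) (is_deriveM (is_derive_cst K s 1) (is_deriveM d3 d3)).
  by apply: (is_derive_eq d4); rewrite /GRing.scale /= !fctE /cst; ring.
have psi0 : psi 0 = psi 1 by rewrite /psi /K; ring.
have [||s s01 [_ Ds]] := @Rolle R psi 0 1 ltr01 _ _ psi0.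
- by move=> s s01; have [] := dpsi s (subset_itv_oo_cc s01).
- by apply: derivable_within_continuous => s s01; have [] := dpsi s s01.
have s01' : 0 <= s <= 1 by exact: subset_itv_oo_cc s01.
have [_ Ds'] := dpsi s s01'.
move: s01; rewrite in_itv /= => /andP[_ s1].
have KE : K = 2^-1 * phi2 s.
  move: Ds; rewrite Ds' => eq0.
  have s10 : 1 - s != 0 by rewrite subr_eq0 gt_eqF.
  by apply: (mulIf s10); lra.
exists s => //.
have -> : f (h + y) = phi 1 by rewrite /phi scale1r.
have -> : f y = phi 0 by rewrite /phi scale0r add0r.
have -> : \sum_i h ord0 i * partial i f y = phi1 0.
  by rewrite /phi1 scale0r add0r.
have -> : \sum_i \sum_j h ord0 i * h ord0 j * partial j (partial i f) (s *: h + y)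
   = phi2 s.
  by apply: eq_bigr => i _; rewrite mulr_sumr; apply: eq_bigr => j _; rewrite mulrA.
by rewrite -KE /K; ring.
Qed.

End Taylor.

(** * Cell probabilities *)

Section CellIntegral.
Context {R : realType}.
Notation mu := (@lebesgue_measure R).

(** Integrals are defined from suprema over simple functions, so they are
    monotone even for functions that are not known to be measurable. *)
Lemma integral_monotone (f g : R -> \bar R) :
  (forall x, f x <= g x)%E ->
  (\int[mu]_(x in [set: R]) f x <= \int[mu]_(x in [set: R]) g x)%E.
Proof.
move=> fg; rewrite /integral !patch_setT; apply: leeB; apply: ereal_sup_le.
  move=> _ [h hf <-]; exists h => // x; apply: le_trans (hf x) _.
  by rewrite funeposE funeposE ge_max !le_max fg lexx orbT.
move=> _ [h hf <-]; exists h => // x; apply: le_trans (hf x) _.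
by rewrite funenegE funenegE ge_max !le_max leeN2 fg lexx orbT.
Qed.

(** The slope does not contribute, by symmetry around the midpoint. *)
Lemma integral_affine_cell (c w a b : R) : 0 < w ->
  (\int[mu]_(x in [set: R])
     ((a + b * (x - c - w / 2)) * \1_(`]c, (c + w)]%classic : set R) x)%:E
   = (a * w)%:E)%E.
Proof.
move=> w0.
pose f (x : R) := a + b * (x - c - w / 2).
transitivity (\int[mu]_(x in `]c, (c + w)%R]) (f x)%:E)%E.
  rewrite [RHS]integral_mkcond; apply: eq_integral => x _.
  rewrite patchE indicE; case: ifPn => _; first by rewrite mulr1.
  by rewrite mulr0.
have cf : continuous f.
  move=> x; apply: cvgD; first exact: cvg_cst.
  apply: cvgM; first exact: cvg_cst.
  by apply: cvgB; [apply: cvgB; [exact: cvg_id|exact: cvg_cst]|exact: cvg_cst].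
rewrite integral_itv_obnd_cbnd; last first.
  by apply/measurable_EFinP; apply: measurable_funTS; exact: continuous_measurable_fun.
pose G (x : R) := a * x + b / 2 * ((x - c - w / 2) * (x - c - w / 2)).
have dG (x : R) : is_derive x 1 G (f x).
  have d0 : is_derive x 1 (id - cst c - cst (w / 2) : R -> R) (1 - 0 - 0).
    by exact: is_deriveB.
  have := is_deriveD (is_deriveM (is_derive_cst a x 1) (is_derive_id x 1))
    (is_deriveM (is_derive_cst (b / 2) x 1) (is_deriveM d0 d0)).
  have -> : cst a * id + cst (b / 2) * ((id - cst c - cst (w / 2)) *
     (id - cst c - cst (w / 2))) = G by apply/funext.
  move=> dG; apply: (is_derive_eq dG).
  by rewrite /GRing.scale /= !fctE /cst /f; field.
have cG : continuous G.
  by move=> x; apply/differentiable_continuous/derivable1_diffP; case: (dG x).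
rewrite (continuous_FTC2 (F := G)).
- by rewrite -EFinB /G; congr EFin; field.
- by rewrite ltrDl.
- exact/continuous_subspaceT.
- split => [x _||]; first by case: (dG x).
  - exact/cvg_at_right_filter/cG.
  - exact/cvg_at_left_filter/cG.
- by move=> x _; rewrite derive1E; case: (dG x).
Qed.

Definition box d (c : nat -> R) (w : R) : set (d.-tuple R) :=
  [set t | forall i : 'I_d, c i < tnth t i <= c i + w].

(** An approximation by an affine function on a cell gives an approximation of
    the integral by the value at the centre of the cell. *)
Lemma integral_tuple_affine d (G : d.-tuple R -> R) (c b : nat -> R) (w a e : R) :
  0 < w -> (forall t, ~ box c w t -> G t = 0) ->
  (forall t, box c w t ->
     `|G t - (a + \sum_(i < d) b i * (tnth t i - c i - w / 2))| <= e) ->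
  exists2 v, integral_tuple (fun t => (G t)%:E) = v%:E &
    `|v - a * w ^+ d| <= e * w ^+ d.
Proof.
move=> w0; elim: d G c b a e => [|d IH] G c b a e G0 Ge.
  exists (G [tuple]) => //; rewrite expr0 !mulr1.
  have := Ge [tuple]; rewrite big_ord0 addr0; apply.
  by case.
pose I := (`]c 0%N, (c 0%N + w)]%classic : set R).
have boxS s (t : d.-tuple R) :
    box c w [tuple of s :: t] <-> I s /\ box (fun i => c i.+1) w t.
  rewrite /box /I /=; split => [bt|[Is bt] i].
    split; first by have := bt ord0; rewrite /= in_itv.
    by move=> i; have := bt (lift ord0 i); rewrite tnthS.
  case: (unliftP ord0 i) => [j ->|->]; first by rewrite tnthS; exact: bt.
  by move: Is; rewrite in_itv.
have slice s : exists v, integral_tuple (fun t => (G [tuple of s :: t])%:E) = v%:E /\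
    (I s -> `|v - (a + b 0%N * (s - c 0%N - w / 2)) * w ^+ d| <= e * w ^+ d) /\
    (~ I s -> v = 0).
  have [Is|nIs] := pselect (I s).
    have [|t bt|v vE ve] := IH (fun t => G [tuple of s :: t]) (fun i => c i.+1)
        (fun i => b i.+1) (a + b 0%N * (s - c 0%N - w / 2)) e.
    - by move=> t nbt; apply: G0 => /boxS[].
    - have := Ge [tuple of s :: t]; rewrite big_ord_recl.
      have -> : \sum_(i < d) b (lift ord0 i) * (tnth [tuple of s :: t] (lift ord0 i) -
          c (lift ord0 i) - w / 2) = \sum_(i < d) b i.+1 * (tnth t i - c i.+1 - w / 2).
        by apply: eq_bigr => i _; rewrite tnthS.
      by rewrite addrA; apply; apply/boxS.
    by exists v.
  have [|t bt|v vE ve] := IH (fun t => G [tuple of s :: t]) (fun i => c i.+1)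
      (fun=> 0) 0 0.
  - by move=> t _; apply: G0 => /boxS[].
  - rewrite G0; last by move=> /boxS[].
    by rewrite big1 ?addr0 ?subr0 ?normr0 // => i _; rewrite mul0r.
  exists v; split => //; split => // _.
  by move: ve; rewrite !mul0r subr0 normr_le0 => /eqP.
have [H HE] := choice slice.
pose L (r s : R) := ((r * w ^+ d + b 0%N * w ^+ d * (s - c 0%N - w / 2)) * \1_I s)%:E.
have intL r : (\int[mu]_(s in [set: R]) L r s)%E = (r * w ^+ d.+1)%:E.
  by rewrite /L integral_affine_cell // exprSr mulrA.
have HL s : (L (a - e)%R s <= (H s)%:E <= L (a + e)%R s)%E.
  have [_ [HI HnI]] := HE s; rewrite /L indicE.
  have [Is|nIs] := pselect (I s).
    rewrite mem_set // !mulr1 !lee_fin; have := HI Is.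
    by rewrite ler_distl => /andP[le1 le2]; apply/andP; split; lra.
  by rewrite memNset // !mulr0 HnI // !lexx.
have intE : integral_tuple (fun t : d.+1.-tuple R => (G t)%:E) =
    (\int[mu]_(s in [set: R]) (H s)%:E)%E.
  by apply: eq_integral => s _; have [eqH _] := HE s; exact: eqH.
have lo : (((a - e) * w ^+ d.+1)%:E <=
    integral_tuple (fun t : d.+1.-tuple R => (G t)%:E))%E.
  rewrite intE -intL; apply: integral_monotone => s; by case/andP: (HL s).
have up : (integral_tuple (fun t : d.+1.-tuple R => (G t)%:E) <= ((a + e) * w ^+ d.+1)%:E)%E.
  rewrite intE -intL; apply: integral_monotone => s; by case/andP: (HL s).
move: lo up; case: integral_tuple => [v| |] //; rewrite !lee_fin => lo up.
by exists v => //; rewrite ler_distl; apply/andP; split; lra.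
Qed.

End CellIntegral.

(** * The mean squared error in terms of cell probabilities *)

Section Expectation.
Context {R : realType} {disp : measure_display} {T : measurableType disp}.
Variable P : probability T R.

Lemma fineK_probability (A : set T) : measurable A -> (fine (P A))%:E = P A.
Proof. by move=> mA; rewrite fineK // fin_num_measure. Qed.

Lemma expectation_sum_indic (Q : finType) (a : Q -> R) (B : Q -> set T) :
  (forall q, measurable (B q)) ->
  ('E_P[fun w => (\sum_q a q * \1_(B q) w)%R : R])%E = (\sum_q a q * fine (P (B q)))%:E.
Proof.
move=> mB; rewrite unlock.
transitivity (\int[P]_w (\sum_q ((a q)%:E * (\1_(B q) w)%:E)))%E.
  by apply: eq_integral => w _; rewrite -sumEFin.
have int1 q : P.-integrable setT (fun w => (\1_(B q) w)%:E : \bar R).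
  exact: integrable_indic.
rewrite integral_sum //; last by move=> q; exact: integrableZl.
rewrite -sumEFin; apply: eq_bigr => q _.
by rewrite integralZl // integral_indic // setIT EFinM fineK_probability.
Qed.

Lemma expectation_sqr_sum_indic (Q : finType) (a : Q -> R) (B : Q -> set T) :
  (forall q, measurable (B q)) ->
  ('E_P[fun w => ((\sum_q a q * \1_(B q) w) ^+ 2)%R : R])%E =
  (\sum_q \sum_q' a q * a q' * fine (P (B q `&` B q')))%:E.
Proof.
move=> mB.
have -> : (fun w => (\sum_q a q * \1_(B q) w) ^+ 2 : R) =
  (fun w => \sum_(z : Q * Q) (a z.1 * a z.2) * \1_(B z.1 `&` B z.2) w).
  apply/funext => w; rewrite expr2 mulr_suml -(pair_big xpredT xpredT
    (fun q q' => (a q * a q') * \1_(B q `&` B q') w)) /=.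
  apply: eq_bigr => q _; rewrite mulr_sumr; apply: eq_bigr => q' _.
  by rewrite indicI /=; ring.
rewrite expectation_sum_indic; last by move=> z; exact: measurableI.
by rewrite -(pair_big xpredT xpredT
  (fun q q' => (a q * a q') * fine (P (B q `&` B q')))).
Qed.

End Expectation.

Section CellProbability.
Context {R : realType} {d : nat}.
Implicit Types (f : 'rV[R]_d -> R) (k : 'I_d -> nat).

Definition cell_prob f m k : R :=
  fine (integral_tuple (fun t : d.-tuple R => (f (row_of_tuple t) * \1_(cell m k) t)%:E)).

Lemma measurable_cell m k : measurable (cell (R := R) m k).
Proof.
have -> : cell m k = \bigcap_(i in [set: 'I_d])
    ((fun t : d.-tuple R => tnth t i) @^-1`
      `](k i)%:R / m%:R, (k i).+1%:R / m%:R]%classic).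
  apply/seteqP; split => [t kt i _|t kt i]; first by rewrite /= in_itv /= kt.
  by have := kt i I; rewrite /= in_itv.
apply: fin_bigcap_measurable => [|i _]; first exact: finite_finset.
by rewrite -[X in measurable X]setTI; apply: measurable_tnth => //; exact: measurable_itv.
Qed.

Lemma cell_disjoint m k k' : k <> k' -> cell (R := R) m k `&` cell m k' = set0.
Proof.
move=> ne_kk'; apply/seteqP; split => // t [kt k't]; apply: ne_kk'.
apply/funext => i; have /andP[lo hi] := kt i; have /andP[lo' hi'] := k't i.
have m0 : 0 < m%:R :> R.
  rewrite ltr0n lt0n; apply/eqP => m0.
  by move: lo hi; rewrite m0 !invr0 !mulr0 => lo; rewrite leNgt lo.
have := lt_le_trans lo hi'; have := lt_le_trans lo' hi.
by rewrite !ltr_pM2r ?invr_gt0 // !ltr_nat => ? ?; lia.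
Qed.

Definition bernstein_mean f m (x : 'rV[R]_d) : R :=
  \sum_(k : {ffun 'I_d -> 'I_m} | (\sum_i k i <= m.-1)%N)
    m%:R ^+ d * cell_prob f m (fun j => k j) * multinomial_prob (fun j => k j) m.-1 x.

Definition bernstein_second_moment f m (x : 'rV[R]_d) : R :=
  \sum_(k : {ffun 'I_d -> 'I_m} | (\sum_i k i <= m.-1)%N)
    (m%:R ^+ d * multinomial_prob (fun j => k j) m.-1 x) ^+ 2 *
    cell_prob f m (fun j => k j).

Section MSE.
Context {disp : measure_display} {T : measurableType disp}.
Variables (P : probability T R) (X : nat -> {RV P >-> d.-tuple R}).
Variable f : 'rV[R]_d -> R.
Hypothesis iidX : iid_density X f.

Lemma measurable_preimage_cell i m k : measurable (X i @^-1` cell m k).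
Proof. by rewrite -[X in measurable X]setTI; apply: measurable_funPT => //; exact: measurable_cell. Qed.

Lemma prob_cell i m k : P (X i @^-1` cell m k) = (cell_prob f m k)%:E.
Proof.
have [_ dens] := iidX; have := dens i _ (measurable_cell m k).
rewrite /distribution /pushforward => PE.
by rewrite /cell_prob -PE fineK_probability //; exact: measurable_preimage_cell.
Qed.

Lemma prob_cell2 i j m k k' : i <> j ->
  P (X i @^-1` cell m k `&` X j @^-1` cell m k') =
  (cell_prob f m k * cell_prob f m k')%:E.
Proof.
move=> ne_ij; have [ind _] := iidX.
pose B n : set (d.-tuple R) :=
  if n == i then cell m k else if n == j then cell m k' else setT.
have mB n : measurable (B n).
  by rewrite /B; case: ifP => _; [|case: ifP => _]; first [exact: measurable_cell|exact: measurableT].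
have Bi : B i = cell m k by rewrite /B eqxx.
have Bj : B j = cell m k'.
  by rewrite /B eqxx; case: eqP => // eq_ji; case: ne_ij.
have i_n : (i < (maxn i j).+1)%N by rewrite ltnS leq_maxl.
have j_n : (j < (maxn i j).+1)%N by rewrite ltnS leq_maxr.
have := ind (maxn i j).+1 B mB.
have -> : \bigcap_(n in `I_(maxn i j).+1) (X n @^-1` B n) =
    X i @^-1` cell m k `&` X j @^-1` cell m k'.
  apply/seteqP; split => [w capw|w [wi wj] n _].
    by split; [have := capw i i_n|have := capw j j_n]; rewrite ?Bi ?Bj.
  rewrite /B /preimage /=; case: eqP => [->//|_]; case: eqP => [->//|_] //.
move=> ->; rewrite (bigD1 (Ordinal i_n)) //= (bigD1 (Ordinal j_n)) /=; last first.
  by apply/eqP => /(congr1 val) /= /esym.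
rewrite Bi Bj !prob_cell big1 ?mule1 // => n /andP[/eqP ni /eqP nj].
rewrite /B; case: eqP => [eq_n|_]; first by case: ni; apply/val_inj.
case: eqP => [eq_n|_]; first by case: nj; apply/val_inj.
by rewrite preimage_setT probability_setT.
Qed.

(** Distinct cells are disjoint, so the second moment of the contribution of one
    observation has no cross terms; the contributions of distinct observations
    are uncorrelated. *)
Lemma MSE_bernstein n m x : (0 < n)%N ->
  MSE X f n m x =
  (n%:R^-1 * (bernstein_second_moment f m x - bernstein_mean f m x ^+ 2)
   + (bernstein_mean f m x - f x) ^+ 2)%:E.
Proof.
move=> n_gt0; have n0 : n%:R != 0 :> R by rewrite pnatr_eq0 -lt0n.
pose K := {ffun 'I_d -> 'I_m}.
pose c (k : K) : R := if (\sum_i k i <= m.-1)%N then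
  m%:R ^+ d * multinomial_prob (fun j => k j) m.-1 x else 0.
pose p (k : K) : R := cell_prob f m (fun j => k j).
pose Q := option ('I_n * K).
pose a (q : Q) : R := if q is Some z then n%:R^-1 * c z.2 else - f x.
pose B (q : Q) : set T :=
  if q is Some z then X z.1 @^-1` cell m (fun j => z.2 j) else setT.
have mB q : measurable (B q).
  by case: q => [z|] /=; [exact: measurable_preimage_cell|exact: measurableT].
have sumQ (V : nmodType) (g : Q -> V) :
    \sum_q g q = g None + \sum_(i < n) \sum_(k : K) g (Some (i, k)).
  rewrite (bigD1 None) //=; congr (_ + _).
  rewrite pair_big /= (reindex_omap Some id) => [|[]//].
  by apply: eq_big => [z|[i k] _] //=; rewrite eqxx.
have estE w : bernstein_estimator X n m x w - f x = \sum_q a q * \1_(B q) w.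
  rewrite sumQ /= indicT mulr1 addrC; congr (_ + _).
  rewrite exchange_big /bernstein_estimator [LHS]big_mkcond /=.
  apply: eq_bigr => k _; rewrite /c; case: ifP => _; last first.
    by rewrite big1 // => i _; rewrite mulr0 mul0r.
  rewrite !mulr_sumr mulr_suml; apply: eq_bigr => i _.
  have -> : \1_(X i @^-1` cell m (fun j => k j)) w =
      \1_(cell m (fun j => k j)) (X i w) :> R by [].
  by ring.
have -> : MSE X f n m x = ('E_P[fun w => ((\sum_q a q * \1_(B q) w) ^+ 2)%R : R])%E.
  by rewrite /MSE; congr expectation; apply/funext => w; rewrite estE.
rewrite expectation_sqr_sum_indic //; congr EFin.
have pB i (k : K) : fine (P (B (Some (i, k)))) = p k by rewrite /= prob_cell.
have pBB i (k k' : K) : fine (P (B (Some (i, k)) `&` B (Some (i, k')))) =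
    (k == k')%:R * p k.
  case: eqP => [->|ne_k]; first by rewrite setIid pB mul1r.
  rewrite /= -preimage_setI cell_disjoint ?preimage_set0 ?measure0 ?mul0r //.
  move=> eq_k; apply: ne_k; apply/ffunP => j; apply/val_inj.
  exact: (congr1 (fun h => h j) eq_k).
have pBB' i i' (k k' : K) : i != i' ->
    fine (P (B (Some (i, k)) `&` B (Some (i', k')))) = p k * p k'.
  move=> ne_i; rewrite /= prob_cell2 // => eq_i.
  by case/eqP: ne_i; apply/val_inj.
pose mu := \sum_(k : K) c k * p k; pose S2 := \sum_(k : K) c k ^+ 2 * p k.
have muE : bernstein_mean f m x = mu.
  rewrite /bernstein_mean [LHS]big_mkcond; apply: eq_bigr => k _.
  by rewrite /c /p; case: ifP => _; [ring|rewrite mul0r].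
have S2E : bernstein_second_moment f m x = S2.
  rewrite /bernstein_second_moment [LHS]big_mkcond; apply: eq_bigr => k _.
  by rewrite /c /p; case: ifP => _ //; rewrite expr0n mul0r.
have row_None : \sum_q a None * a q * fine (P (B None `&` B q)) =
    f x ^+ 2 - f x * mu.
  rewrite sumQ /= setIT probability_setT /= mulr1 mulrNN -expr2; congr (_ + _).
  have -> : \sum_(i < n) \sum_(k : K) - f x * (n%:R^-1 * c k) *
      fine (P (setT `&` X i @^-1` cell m (fun j => k j))) =
      \sum_(i < n) (- f x * n%:R^-1 * mu).
    apply: eq_bigr => i _; rewrite mulr_sumr; apply: eq_bigr => k _.
    by rewrite setTI -[fine _]/(fine (P (B (Some (i, k))))) pB; ring.
  by rewrite sumr_const card_ord -mulr_natl; field.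
have row_Some i : \sum_(k : K) \sum_q a (Some (i, k)) * a q *
    fine (P (B (Some (i, k)) `&` B q)) =
    n%:R^-1 * (- f x * mu) + n%:R^-1 ^+ 2 * (S2 + (n%:R - 1) * mu ^+ 2).
  have row (k : K) : \sum_q a (Some (i, k)) * a q * fine (P (B (Some (i, k)) `&` B q)) =
      n%:R^-1 * (- f x * (c k * p k)) +
      n%:R^-1 ^+ 2 * (c k ^+ 2 * p k + (n%:R - 1) * (c k * p k * mu)).
    rewrite sumQ; congr (_ + _).
      by rewrite [B None]/= setIT pB /=; ring.
    rewrite (bigD1 i) //= mulrDr; congr (_ + _).
      rewrite (bigD1 k) //= big1 => [|k' ne_k].
        by have := pBB i k k; rewrite eqxx /= => ->; ring.
      by have := pBB i k k'; rewrite eq_sym (negbTE ne_k) /= => ->; rewrite mul0r mulr0.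
    have -> : \sum_(i' < n | i' != i) \sum_(k' : K) n%:R^-1 * c k * (n%:R^-1 * c k') *
       fine (P (X i @^-1` cell m (fun j => k j) `&` X i' @^-1` cell m (fun j => k' j)))
      = \sum_(i' < n | i' != i) n%:R^-1 ^+ 2 * (c k * p k * mu).
      apply: eq_bigr => i' ne_i; rewrite /mu !mulr_sumr; apply: eq_bigr => k' _.
      have := @pBB' i i' k k'; rewrite eq_sym ne_i /= => -> //.
      by ring.
    rewrite sumr_const cardC1 card_ord -[LHS]mulr_natl.
    by rewrite -subn1 natrB //; ring.
  transitivity (\sum_(k : K) (n%:R^-1 * (- f x * (c k * p k)) +
      n%:R^-1 ^+ 2 * (c k ^+ 2 * p k + (n%:R - 1) * (c k * p k * mu)))).
    by apply: eq_bigr => k _; exact: row.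
  rewrite big_split /= -!mulr_sumr big_split /=.
  by rewrite -!mulr_sumr -mulr_suml -/mu -/S2 expr2.
rewrite sumQ row_None.
transitivity (f x ^+ 2 - f x * mu + \sum_(i < n) (n%:R^-1 * (- f x * mu) +
    n%:R^-1 ^+ 2 * (S2 + (n%:R - 1) * mu ^+ 2))).
  by congr (_ + _); apply: eq_bigr => i _; exact: row_Some.
by rewrite sumr_const card_ord muE S2E -mulr_natl; field.
Qed.

End MSE.

End CellProbability.

(** * Bias and variance bounds *)

Section BernsteinSums.
Context {R : realType} {d : nat}.
Implicit Types (y : 'rV[R]_d) (ks : seq nat).

Definition coords y : seq R := [seq y ord0 i | i <- enum 'I_d].

Lemma size_coords y : size (coords y) = d.
Proof. by rewrite size_map size_enum_ord. Qed.

Lemma nth_coords y (i : 'I_d) : (coords y)`_i = y ord0 i.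
Proof. by rewrite (nth_map i) ?size_enum_ord // nth_ord_enum. Qed.

Lemma simplex_ge0 y i : simplex y -> 0 <= y ord0 i.
Proof. by case=> /(_ i)/andP[]. Qed.

Lemma simplex_le1 y i : simplex y -> y ord0 i <= 1.
Proof. by case=> /(_ i)/andP[]. Qed.

Lemma norm1_simplex y : simplex y -> norm1 y = \sum_i y ord0 i.
Proof. by move=> yS; apply: eq_bigr => i _; rewrite ger0_norm ?simplex_ge0. Qed.

Lemma sum_coords y : \sum_(x <- coords y) x = \sum_i y ord0 i.
Proof. by rewrite big_map big_enum. Qed.

Lemma coords_ge0 y : simplex y -> all (fun x => 0 <= x) (coords y).
Proof. by move=> yS; rewrite all_map; apply/allP => i _ /=; exact: simplex_ge0. Qed.

Definition point_weight y N ks : R := mweight N (1 - norm1 y) (coords y) ks.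

Lemma point_weight_sum1 y : simplex y -> 1 - norm1 y + \sum_(x <- coords y) x = 1.
Proof. by move=> yS; rewrite sum_coords norm1_simplex // subrK. Qed.

Lemma point_weight_ge0 y N ks : simplex y -> 0 <= point_weight y N ks.
Proof.
by move=> yS; apply: mweight_ge0 (coords_ge0 yS); rewrite subr_ge0; case: yS.
Qed.

Lemma point_weight_mass1 y N : simplex y ->
  \sum_(ks <- multi_indices d N) point_weight y N ks = 1.
Proof.
move=> yS; have := mweight_mass1 N (point_weight_sum1 yS).
by rewrite size_coords.
Qed.

Lemma point_weight_le1 y N ks : simplex y -> ks \in multi_indices d N ->
  point_weight y N ks <= 1.
Proof.
move=> yS ks_in; rewrite -(point_weight_mass1 N yS) (big_rem ks) //= lerDl.
by apply: sumr_ge0 => ? _; exact: point_weight_ge0.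
Qed.

Lemma multinomial_probE y N (k : 'I_d -> nat) : (\sum_i k i <= N)%N ->
  multinomial_prob k N y = point_weight y N [seq k i | i <- enum 'I_d].
Proof.
move=> leN; have sumk : sumn [seq k i | i <- enum 'I_d] = (\sum_i k i)%N.
  by rewrite sumnE big_map big_enum.
have nthk (i : 'I_d) : nth 0%N [seq k i | i <- enum 'I_d] i = k i.
  by rewrite (nth_map i) ?size_enum_ord // nth_ord_enum.
rewrite /point_weight mweightE ?sumk //; last first.
  by rewrite size_coords size_map size_enum_ord.
rewrite size_coords.
rewrite /multinomial_prob.
congr (_ / (_ * _) * _ * _); apply: eq_bigr => i _; rewrite ?nthk //.
by rewrite nth_coords.
Qed.

(** The mean value of f over a cell. *)
Definition cell_density (f : 'rV[R]_d -> R) m ks : R :=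
  m%:R ^+ d * cell_prob f m (fun i : 'I_d => nth 0%N ks i).

Lemma bernstein_meanE f m y : (0 < m)%N ->
  bernstein_mean f m y =
  \sum_(ks <- multi_indices d m.-1) cell_density f m ks * point_weight y m.-1 ks.
Proof.
move=> m0; rewrite -(@big_ffun_multi_indices _ d m m.-1) ?prednK //.
apply: eq_bigr => k le_k; rewrite multinomial_probE // /cell_density.
congr (_ * cell_prob _ _ _ * _); apply/funext => j.
by rewrite (nth_map j) ?size_enum_ord // nth_ord_enum.
Qed.

Lemma bernstein_second_momentE f m y : (0 < m)%N ->
  bernstein_second_moment f m y = m%:R ^+ d *
  \sum_(ks <- multi_indices d m.-1) cell_density f m ks * point_weight y m.-1 ks ^+ 2.
Proof.
move=> m0; rewrite -(@big_ffun_multi_indices _ d m m.-1) ?prednK // mulr_sumr.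
apply: eq_bigr => k le_k; rewrite multinomial_probE // /cell_density.
rewrite (_ : (fun i : 'I_d => nth 0%N _ i) = (fun j => k j)); first by ring.
apply/funext => j; by rewrite (nth_map j) ?size_enum_ord // nth_ord_enum.
Qed.

Definition cell_center m ks (i : nat) : R := ((nth 0%N ks i)%:R + 2^-1) / m%:R.

Lemma cell_density_affine (f : 'rV[R]_d -> R) m ks (b : nat -> R) (a e : R) :
  (0 < m)%N ->
  (forall t : d.-tuple R, cell m (fun i : 'I_d => nth 0%N ks i) t ->
     `|f (row_of_tuple t) -
       (a + \sum_(i < d) b i * (tnth t i - cell_center m ks i))| <= e) ->
  `|cell_density f m ks - a| <= e.
Proof.
move=> m0 Hf; have m0R : 0 < m%:R :> R by rewrite ltr0n.
set A := cell m _ in Hf.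
have boxE t : box (fun i => (nth 0%N ks i)%:R / m%:R) m%:R^-1 t <-> A t.
  rewrite /A /cell /box /=; split=> bt i; have := bt i;
  by rewrite -natr1 mulrDl mul1r.
have [||t bt|v vE ve] := @integral_tuple_affine R d
  (fun t => f (row_of_tuple t) * \1_A t) (fun i => (nth 0%N ks i)%:R / m%:R) b
  m%:R^-1 a e.
- by rewrite invr_gt0.
- by move=> t; rewrite boxE => nAt; rewrite indicE memNset // mulr0.
- rewrite indicE mem_set ?mulr1; last exact/boxE.
  have := Hf t ((boxE t).1 bt).
  rewrite (eq_bigr (fun i : 'I_d => b i * (tnth t i - (nth 0%N ks i)%:R / m%:R -
    m%:R^-1 / 2))) // => i _.
  by rewrite /cell_center; congr (_ * _); field; rewrite gt_eqF.
rewrite /cell_density /cell_prob vE /=.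
have mV : m%:R^-1 ^+ d = (m%:R ^+ d)^-1 :> R by rewrite exprVn.
have md0 : 0 < m%:R ^+ d :> R by rewrite exprn_gt0.
move: ve; rewrite mV ler_pdivlMr // -[X in _ * X](gtr0_norm md0) -normrM.
by rewrite mulrBl divfK ?gt_eqF // [v * _]mulrC.
Qed.

Lemma cell_density_bound (f : 'rV[R]_d -> R) m ks (M : R) :
  (0 < m)%N -> (forall x, `|f x| <= M) -> `|cell_density f m ks| <= M.
Proof.
move=> m0 fM; rewrite -[cell_density _ _ _]subr0.
apply: (@cell_density_affine f m ks (fun=> 0)) => // t _.
by rewrite big1 ?addr0 ?subr0 // => i _; rewrite mul0r.
Qed.

Definition near_point y m delta ks : bool :=
  [forall i : 'I_d, `|(nth 0%N ks i)%:R - (m.-1)%:R * y ord0 i| <= delta * (m.-1)%:R].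

Lemma point_weight_tail y m (delta : R) : simplex y -> 0 < delta <= 2 ->
  \sum_(ks <- multi_indices d m.-1 | ~~ near_point y m delta ks)
    point_weight y m.-1 ks <= d%:R * (2 * expR (- ((m.-1)%:R * delta ^+ 2 / 8))).
Proof.
move=> yS d02; set idx := multi_indices _ _.
apply: le_trans (_ : \sum_(i < d) \sum_(ks <- idx |
   delta * (m.-1)%:R < `|(nth 0%N ks i)%:R - (m.-1)%:R * y ord0 i|)
     point_weight y m.-1 ks <= _).
  rewrite [leRHS](eq_bigr (fun i => \sum_(ks <- idx) if
    delta * (m.-1)%:R < `|(nth 0%N ks (i : 'I_d))%:R - (m.-1)%:R * y ord0 i|
    then point_weight y m.-1 ks else 0)); last by move=> i _; rewrite big_mkcond.
  rewrite exchange_big /= big_mkcond; apply: ler_sum => ks _.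
  have W0 := point_weight_ge0 m.-1 ks yS.
  case: ifP => [|_]; last by apply: sumr_ge0 => i _; case: ifP.
  rewrite negb_forall => /existsP[i]; rewrite -ltNge => dev.
  rewrite (bigD1 i) //= dev lerDl; apply: sumr_ge0 => j _; by case: ifP.
have -> : d%:R * (2 * expR (- ((m.-1)%:R * delta ^+ 2 / 8))) =
    \sum_(i < d) (2 * expR (- ((m.-1)%:R * delta ^+ 2 / 8))) :> R.
  by rewrite sumr_const card_ord mulr_natl.
apply: ler_sum => i _.
have a0 : 0 <= 1 - norm1 y by rewrite subr_ge0; case: yS.
have := @mweight_tail R m.-1 _ _ (point_weight_sum1 yS) a0 (coords_ge0 yS) i delta.
by rewrite size_coords nth_coords; apply.
Qed.

Lemma cell_center_moment1 y m (i : 'I_d) : simplex y -> (0 < m)%N ->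
  \sum_(ks <- multi_indices d m.-1)
    point_weight y m.-1 ks * (cell_center m ks i - y ord0 i) =
  (2^-1 - y ord0 i) / m%:R.
Proof.
move=> yS m0; have m0R : m%:R != 0 :> R by rewrite pnatr_eq0 -lt0n.
have := @mweight_moment1 R m.-1 _ _ (point_weight_sum1 yS) i.
rewrite size_coords nth_coords => /(_ (ltn_ord i)) mom.
have mass := point_weight_mass1 m.-1 yS.
transitivity (m%:R^-1 * (\sum_(ks <- multi_indices d m.-1)
     point_weight y m.-1 ks * (nth 0%N ks i)%:R) +
  (2^-1 / m%:R - y ord0 i) * \sum_(ks <- multi_indices d m.-1) point_weight y m.-1 ks).
  rewrite !mulr_sumr -big_split /=; apply: eq_bigr => ks _.
  by rewrite /cell_center; field.
rewrite mass [X in _ * X + _]mom -subn1 natrB //; by field.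
Qed.

Definition cell_center_cov y m (i j : 'I_d) : R :=
  ((m%:R - 1) * (i == j)%:R * y ord0 i + (2 - m%:R) * (y ord0 i * y ord0 j) -
   (y ord0 i + y ord0 j) / 2 + 4^-1) / m%:R ^+ 2.

Lemma cell_center_moment2 y m (i j : 'I_d) : simplex y -> (0 < m)%N ->
  \sum_(ks <- multi_indices d m.-1) point_weight y m.-1 ks *
    ((cell_center m ks i - y ord0 i) * (cell_center m ks j - y ord0 j)) =
  cell_center_cov y m i j.
Proof.
move=> yS m0; have m0R : m%:R != 0 :> R by rewrite pnatr_eq0 -lt0n.
have mom1 k := @mweight_moment1 R m.-1 _ _ (point_weight_sum1 yS) k.
have := @mweight_moment2 R m.-1 _ _ (point_weight_sum1 yS) i j.
rewrite size_coords !nth_coords => /(_ (ltn_ord i) (ltn_ord j)) mom2.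
have := mom1 i; have := mom1 j; rewrite size_coords !nth_coords.
move=> /(_ (ltn_ord j)) momj /(_ (ltn_ord i)) momi.
have mass := point_weight_mass1 m.-1 yS.
pose E g := \sum_(ks <- multi_indices d m.-1) point_weight y m.-1 ks * g ks.
pose u (k : 'I_d) := 2^-1 / m%:R - y ord0 k.
transitivity (m%:R ^- 2 * E (fun ks => (nth 0%N ks i)%:R * (nth 0%N ks j)%:R) +
  u j / m%:R * E (fun ks => (nth 0%N ks i)%:R) +
  u i / m%:R * E (fun ks => (nth 0%N ks j)%:R) +
  u i * u j * \sum_(ks <- multi_indices d m.-1) point_weight y m.-1 ks).
  rewrite /E !mulr_sumr -!big_split /=; apply: eq_bigr => ks _.
  by rewrite /cell_center /u; field.
rewrite mass; have -> : E (fun ks => (nth 0%N ks i)%:R) = (m.-1)%:R * y ord0 i by exact: momi.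
have -> : E (fun ks => (nth 0%N ks j)%:R) = (m.-1)%:R * y ord0 j by exact: momj.
have -> : E (fun ks => (nth 0%N ks i)%:R * (nth 0%N ks j)%:R) =
    (m.-1)%:R * ((m.-1)%:R - 1) * (y ord0 i * y ord0 j) +
    (m.-1)%:R * y ord0 i * (i == j)%:R by exact: mom2.
have -> : (m.-1)%:R = m%:R - 1 :> R by rewrite -subn1 natrB.
rewrite /u /cell_center_cov -[i == j]/(i == j :> nat).
by move: (i == j :> nat)%:R => del; field.
Qed.

End BernsteinSums.

(** The mixed terms are split by the arithmetic-geometric mean inequality with
    weight kappa, which keeps the coefficient of the sum of the z i ^+ 2 small. *)
Lemma quadratic_perturbation {R : realType} {d : nat} (H : 'I_d -> 'I_d -> R)
    (z v : 'I_d -> R) (B kappa w : R) :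
  0 < kappa -> (forall i j, `|H i j| <= B) -> (forall i, v i ^+ 2 <= w) ->
  `|\sum_i \sum_j H i j * (z i * v j + v i * z j + v i * v j)| <=
  B * (kappa * d%:R * \sum_i z i ^+ 2 + d%:R ^+ 2 * (w * kappa^-1 + w)).
Proof.
move=> kappa0 HB v2; pose S := \sum_i z i ^+ 2.
have sumd (x : R) : \sum_(i < d) x = d%:R * x.
  by rewrite sumr_const card_ord mulr_natl.
pose c := w * kappa^-1 + w.
apply: le_trans (_ : \sum_i \sum_j B * (kappa / 2 * (z i ^+ 2 + z j ^+ 2) + c) <= _).
  apply: le_trans (ler_norm_sum _ _ _) _; apply: ler_sum => i _.
  apply: le_trans (ler_norm_sum _ _ _) _; apply: ler_sum => j _.
  rewrite normrM; apply: ler_pM => //.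
  have amgm (p q : R) : q ^+ 2 <= w ->
      `|p * q| <= kappa / 2 * p ^+ 2 + w * kappa^-1 / 2.
    move=> q2; rewrite normrM.
    have sq := sqr_ge0 (kappa * `|p| - `|q|).
    have pp : `|p| ^+ 2 = p ^+ 2 by rewrite real_normK ?num_real.
    have qq : `|q| ^+ 2 = q ^+ 2 by rewrite real_normK ?num_real.
    rewrite -(ler_pM2l kappa0).
    have -> : kappa * (kappa / 2 * p ^+ 2 + w * kappa^-1 / 2) =
      kappa ^+ 2 / 2 * p ^+ 2 + w / 2 by field; rewrite !gt_eqF.
    have : (kappa * `|p| - `|q|) ^+ 2 = kappa ^+ 2 * p ^+ 2 -
      2 * (kappa * (`|p| * `|q|)) + q ^+ 2 by rewrite -pp -qq; ring.
    by move=> sqE; rewrite sqE in sq; lra.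
  apply: le_trans (ler_normD _ _) _; apply: le_trans (lerD (ler_normD _ _) (lexx _)) _.
  have h1 := amgm (z i) (v j) (v2 j).
  have h2 := amgm (z j) (v i) (v2 i); rewrite [z j * v i]mulrC in h2.
  have h3 : `|v i * v j| <= w.
    have sq := sqr_ge0 (`|v i| - `|v j|).
    have pp : `|v i| ^+ 2 = v i ^+ 2 by rewrite real_normK ?num_real.
    have qq : `|v j| ^+ 2 = v j ^+ 2 by rewrite real_normK ?num_real.
    have : (`|v i| - `|v j|) ^+ 2 = v i ^+ 2 - 2 * (`|v i| * `|v j|) + v j ^+ 2.
      by rewrite -pp -qq; ring.
    by move=> sqE; rewrite sqE in sq; rewrite normrM; have := v2 i; have := v2 j; lra.
  by rewrite /c; lra.
rewrite (eq_bigr (fun i => B * (kappa / 2 * (d%:R * z i ^+ 2 + S) + d%:R * c))).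
  rewrite -mulr_sumr big_split /= -mulr_sumr big_split /= -mulr_sumr -/S.
  rewrite !sumd -/c le_eqVlt; apply/orP; left; apply/eqP.
  by congr (B * _); move: S c => S c; field.
move=> i _; rewrite -mulr_sumr big_split /= -mulr_sumr big_split /= -/S.
by rewrite !sumd.
Qed.

Section BernsteinBounds.
Context {R : realType} {d : nat}.
Variables (f : 'rV[R]_d -> R) (m : nat) (y : 'rV[R]_d) (delta M : R).
Hypotheses (m_gt0 : (0 < m)%N) (yS : simplex y) (delta02 : 0 < delta <= 2).
Hypotheses (m_delta : 1 <= delta * m%:R).
Hypotheses (y_delta : 2 * d%:R * delta <= 1 - norm1 y).
Hypothesis fM : forall x, `|f x| <= M.

Let m0 : 0 < m%:R :> R. Proof. by rewrite ltr0n. Qed.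
Let W := point_weight y m.-1.
Let idx := multi_indices d m.-1.
Let tail : R := d%:R * (2 * expR (- ((m.-1)%:R * delta ^+ 2 / 8))).
Let M0 : 0 <= M. Proof. exact: le_trans (normr_ge0 _) (fM y). Qed.

(** The hypothesis 2 d delta <= 1 - norm1 y keeps the whole cell inside the simplex,
    where f has a Taylor expansion. *)
Lemma near_point_cell ks (t : d.-tuple R) : near_point y m delta ks ->
  cell m (fun i : 'I_d => nth 0%N ks i) t ->
  simplex (row_of_tuple t) /\ forall i, `|tnth t i - y ord0 i| <= 2 * delta.
Proof.
move=> /forallP near_ks kt; have /andP[d0 d2] := delta02.
have mE : (m.-1)%:R = m%:R - 1 :> R by rewrite -subn1 natrB.
have dist i : `|tnth t i - y ord0 i| <= 2 * delta.
  have y0 := simplex_ge0 i yS; have y1 := simplex_le1 i yS.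
  have /andP[lo hi] := kt i; have := near_ks i.
  rewrite mE ler_distl => /andP[k_lo k_hi].
  move: lo; rewrite ltr_pdivrMr // => lo; move: hi; rewrite ler_pdivlMr // -natr1 => hi.
  rewrite ler_distl; apply/andP; split; rewrite -(ler_pM2r m0).
    by move: m_delta; lra.
  by move: m_delta; lra.
have t0 i : 0 <= tnth t i.
  by have /andP[lo _] := kt i; apply: ltW; apply: le_lt_trans lo; rewrite divr_ge0.
have sum_le : \sum_i tnth t i <= 1.
  apply: le_trans (_ : \sum_(i < d) (y ord0 i + 2 * delta) <= _).
    by apply: ler_sum => i _; have := dist i; rewrite ler_distl => /andP[]; lra.
  rewrite big_split /= -norm1_simplex // sumr_const card_ord -mulr_natl.
  by move: y_delta; lra.
split => //; split => [i|].
  rewrite mxE t0 /=; apply: le_trans sum_le; rewrite (bigD1 i) //= lerDl.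
  by rewrite sumr_ge0.
by apply: le_trans sum_le; apply: ler_sum => i _; rewrite mxE ger0_norm.
Qed.

Lemma cell_center_dist ks (t : d.-tuple R) i :
  cell m (fun i : 'I_d => nth 0%N ks i) t ->
  `|tnth t i - cell_center m ks i| <= (2 * m%:R)^-1.
Proof.
move=> /(_ i)/andP[lo hi]; rewrite ler_distl /cell_center.
move: lo; rewrite ltr_pdivrMr // => lo; move: hi; rewrite ler_pdivlMr // -natr1 => hi.
have e1 : ((2 * m%:R)^-1 : R) * m%:R = 2^-1 by field; rewrite gt_eqF.
have e2 : ((nth 0%N ks i)%:R + 2^-1) / m%:R * m%:R = (nth 0%N ks i)%:R + 2^-1 :> R.
  by rewrite divfK // gt_eqF.
move: e1 e2; move: (_^-1) (_ / m%:R) => w c e1 e2.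
by apply/andP; split; rewrite -(ler_pM2r m0); lra.
Qed.

Lemma cell_center_bounded ks (i : 'I_d) : ks \in idx ->
  `|cell_center m ks i - y ord0 i| <= 1.
Proof.
rewrite mem_multi_indices => /andP[/eqP sz le_ks].
have y0 := simplex_ge0 i yS; have y1 := simplex_le1 i yS.
have k_le : ((nth 0%N ks i).+1 <= m)%N.
  rewrite -(prednK m_gt0) ltnS; apply: leq_trans le_ks.
  by rewrite sumnE (big_nth 0%N) big_mkord sz (bigD1 i) //= leq_addr.
have c0 : 0 <= cell_center m ks i :> R by rewrite /cell_center divr_ge0 // addr_ge0.
have c1 : cell_center m ks i <= 1 :> R.
  rewrite /cell_center ler_pdivrMr // mul1r; apply: le_trans (_ : (nth 0%N ks i).+1%:R <= _).
    by rewrite -[leRHS]natr1; lra.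
  by rewrite ler_nat.
by rewrite ler_distl; apply/andP; split; lra.
Qed.

Let W0 ks : 0 <= W ks. Proof. exact: point_weight_ge0. Qed.
Let W1 ks : ks \in idx -> W ks <= 1. Proof. exact: point_weight_le1. Qed.
Let W_mass : \sum_(ks <- idx) W ks = 1. Proof. exact: point_weight_mass1. Qed.

(** Multi-indices far from (m - 1) y are charged to the tail probability with the
    crude bound A. *)
Lemma sum_near_tail (h e : seq nat -> R) (A : R) : 0 <= A ->
  (forall ks, ks \in idx -> 0 <= e ks) ->
  (forall ks, ks \in idx -> near_point y m delta ks -> `|h ks| <= e ks) ->
  (forall ks, ks \in idx -> `|h ks| <= A) ->
  `|\sum_(ks <- idx) W ks * h ks| <= \sum_(ks <- idx) W ks * e ks + A * tail.
Proof.
move=> A0 e0 h_near h_tail; apply: le_trans (ler_norm_sum _ _ _) _.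
apply: le_trans (_ : \sum_(ks <- idx) (W ks * e ks +
    A * (if ~~ near_point y m delta ks then W ks else 0)) <= _); last first.
  rewrite big_split /= -mulr_sumr -big_mkcond /= lerD2l ler_wpM2l //.
  exact: point_weight_tail.
rewrite big_seq [leRHS]big_seq; apply: ler_sum => ks ks_in.
rewrite normrM (ger0_norm (W0 ks)); case: ifPn => [_|]; last first.
  by rewrite negbK mulr0 addr0 => near_ks; rewrite ler_wpM2l // h_near.
rewrite -[leLHS]add0r lerD ?mulr_ge0 ?e0 // mulrC ler_wpM2r //; exact: h_tail.
Qed.

(** The linear part of the expansion is integrated exactly over each cell, by
    symmetry around the midpoint. The deviations t - y are then replaced by
    those of the midpoint, at the cost of terms of order m^-2, and the moments
    of the midpoint finish the computation. The parameter kappa trades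
    variance of the midpoint against the size of the cell. *)
Lemma bernstein_bias_bound (g : 'I_d -> R) (H : 'I_d -> 'I_d -> R)
    (G B eta kappa : R) :
  0 <= eta -> 0 < kappa ->
  (forall i, `|g i| <= G) -> (forall i j, `|H i j| <= B) ->
  (forall u, simplex u -> (forall i, `|u ord0 i - y ord0 i| <= 2 * delta) ->
    `|f u - (f y + \sum_i g i * (u ord0 i - y ord0 i) +
       2^-1 * \sum_i \sum_j H i j * ((u ord0 i - y ord0 i) * (u ord0 j - y ord0 j)))|
    <= eta * \sum_i (u ord0 i - y ord0 i) ^+ 2) ->
  `|bernstein_mean f m y - f y - \sum_i g i * ((2^-1 - y ord0 i) / m%:R)
    - 2^-1 * \sum_i \sum_j H i j * cell_center_cov y m i j|
  <= (2 * eta + B * d%:R * kappa / 2) * \sum_i cell_center_cov y m i i +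
     (2 * eta * d%:R + B * d%:R ^+ 2 * (kappa^-1 + 1) / 2) * (4^-1 / m%:R ^+ 2) +
     (2 * M + d%:R * G + d%:R ^+ 2 * B / 2) * tail.
Proof.
move=> eta0 kappa0 gG HB HT.
have B0 : 0 <= d%:R ^+ 2 * B.
  rewrite (_ : d%:R ^+ 2 * B = \sum_(i < d) \sum_(j < d) B); last first.
    by rewrite !sumr_const !card_ord -mulrnA mulnn -natrX mulr_natl.
  by apply: sumr_ge0 => i _; apply: sumr_ge0 => j _; apply: le_trans (HB i j).
have dG0 : 0 <= d%:R * G.
  rewrite (_ : d%:R * G = \sum_(i < d) G); last by rewrite sumr_const card_ord mulr_natl.
  by apply: sumr_ge0 => i _; apply: le_trans (gG i).
pose z ks (i : 'I_d) := cell_center m ks i - y ord0 i.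
pose lin ks := \sum_i g i * z ks i.
pose quad ks := 2^-1 * \sum_i \sum_j H i j * (z ks i * z ks j).
pose a ks := f y + (lin ks + quad ks).
pose S ks := \sum_i z ks i ^+ 2.
pose alpha := 2 * eta + B * d%:R * kappa / 2.
pose w : R := 4^-1 / m%:R ^+ 2.
pose beta := (2 * eta * d%:R + B * d%:R ^+ 2 * (kappa^-1 + 1) / 2) * w.
have S0 ks : 0 <= S ks by apply: sumr_ge0 => i _; exact: sqr_ge0.
have mom1 : \sum_(ks <- idx) W ks * (a ks - f y) =
    \sum_i g i * ((2^-1 - y ord0 i) / m%:R) +
    2^-1 * \sum_i \sum_j H i j * cell_center_cov y m i j.
  transitivity (\sum_(ks <- idx) (\sum_i g i * (W ks * z ks i) +
      2^-1 * \sum_i \sum_j H i j * (W ks * (z ks i * z ks j)))).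
    apply: eq_bigr => ks _; rewrite /a [f y + _]addrC addrK mulrDr; congr (_ + _).
      by rewrite mulr_sumr; apply: eq_bigr => i _; rewrite mulrCA.
    rewrite mulrCA mulr_sumr; congr (_ * _); apply: eq_bigr => i _.
    by rewrite mulr_sumr; apply: eq_bigr => j _; rewrite mulrCA.
  rewrite big_split /=; congr (_ + _).
    rewrite exchange_big /=; apply: eq_bigr => i _.
    by rewrite -mulr_sumr cell_center_moment1.
  rewrite -mulr_sumr; congr (_ * _); rewrite exchange_big /=; apply: eq_bigr => i _.
  rewrite exchange_big /=; apply: eq_bigr => j _.
  by rewrite -mulr_sumr cell_center_moment2.
have -> : bernstein_mean f m y - f y - \sum_i g i * ((2^-1 - y ord0 i) / m%:R)
    - 2^-1 * \sum_i \sum_j H i j * cell_center_cov y m i j =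
    \sum_(ks <- idx) W ks * (cell_density f m ks - a ks).
  rewrite -addrA -opprD -mom1 bernstein_meanE //.
  have -> : f y = \sum_(ks <- idx) W ks * f y by rewrite -mulr_suml W_mass mul1r.
  by rewrite -!sumrB; apply: eq_bigr => ks _; rewrite -/W -mulr_suml W_mass mul1r; ring.
have A0 : 0 <= 2 * M + d%:R * G + d%:R ^+ 2 * B / 2.
  by move: M0; lra.
rewrite -/w -/alpha -/beta; have -> : alpha * \sum_i cell_center_cov y m i i + beta =
    \sum_(ks <- idx) W ks * (alpha * S ks + beta).
  under [RHS]eq_bigr do rewrite mulrDr mulrCA.
  have W_beta : \sum_(ks <- idx) W ks * beta = beta by rewrite -mulr_suml W_mass mul1r.
  rewrite big_split /= W_beta -mulr_sumr; congr (alpha * _ + _).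
  under [RHS]eq_bigr do rewrite mulr_sumr.
  rewrite exchange_big /=; apply: eq_bigr => i _.
  by rewrite -cell_center_moment2 //; apply: eq_bigr => ks _; rewrite expr2.
have Bd0 : 0 <= B * d%:R.
  have [->|d0] := posnP d; first by rewrite mulr0.
  by move: B0; rewrite expr2 -mulrA pmulr_rge0 ?ltr0n // mulrC.
have Bdd0 : 0 <= B * d%:R ^+ 2 by rewrite mulrC.
have alpha0 : 0 <= alpha.
  by have := mulr_ge0 Bd0 (ltW kappa0); rewrite /alpha; lra.
have beta0 : 0 <= beta.
  apply: mulr_ge0; last by rewrite divr_ge0 // exprn_ge0.
  have k0 : 0 <= kappa^-1 by rewrite invr_ge0 ltW.
  have h1 : 0 <= eta * d%:R by rewrite mulr_ge0.
  have h2 : 0 <= B * d%:R ^+ 2 * (kappa^-1 + 1) by rewrite mulr_ge0 ?addr_ge0.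
  by lra.
apply: sum_near_tail => //.
- by move=> ks _; rewrite addr_ge0 // mulr_ge0.
- move=> ks ks_in near_ks; apply: (@cell_density_affine _ _ f m ks
    (fun i => if insub i is Some i' then g i' else 0)) => // t kt.
  have [tS t_dist] := near_point_cell near_ks kt.
  pose v i := tnth t i - cell_center m ks i.
  have v_le i : `|v i| <= (2 * m%:R)^-1 by exact: cell_center_dist.
  have tE i : tnth t i - y ord0 i = z ks i + v i by rewrite /z /v; ring.
  have -> : \sum_(i < d) (if insub (i : nat) is Some i' then g i' else 0) *
      (tnth t i - cell_center m ks i) = \sum_i g i * v i.
    by apply: eq_bigr => i _; rewrite valK.
  have := HT (row_of_tuple t) tS.
  have rowE i : row_of_tuple t ord0 i - y ord0 i = z ks i + v i by rewrite mxE tE.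
  have row_dist i : `|row_of_tuple t ord0 i - y ord0 i| <= 2 * delta.
    by rewrite mxE; exact: t_dist.
  move=> /(_ row_dist).
  rewrite [X in f y + X](eq_bigr (fun i => g i * z ks i + g i * v i)); last first.
    by move=> i _; rewrite rowE mulrDr.
  rewrite [X in _ + 2^-1 * X](eq_bigr (fun i => \sum_j (H i j * (z ks i * z ks j) +
    H i j * (z ks i * v j + v i * z ks j + v i * v j)))); last first.
    by move=> i _; apply: eq_bigr => j _; rewrite !rowE; ring.
  rewrite [X in _ <= _ * X](eq_bigr (fun i => (z ks i + v i) ^+ 2)); last first.
    by move=> i _; rewrite rowE.
  under [X in _ + 2^-1 * X]eq_bigr do rewrite big_split /=.
  rewrite !big_split /= -/(lin ks) mulrDr -/(quad ks).
  set r2 := \sum_i \sum_j H i j * (z ks i * v j + v i * z ks j + v i * v j).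
  set gv := \sum_i g i * v i => Hle.
  have v2 i : v i ^+ 2 <= w.
    apply: le_trans (_ : ((2 * m%:R)^-1) ^+ 2 <= _).
      by rewrite -real_normK ?num_real // lerXn2r ?nnegrE ?invr_ge0 ?mulr_ge0 ?(ltW m0).
    rewrite /w exprVn exprMn invfM ler_wpM2r ?invr_ge0 ?exprn_ge0 //; lra.
  have sumd (x : R) : \sum_(i < d) x = d%:R * x.
    by rewrite sumr_const card_ord mulr_natl.
  have r2_le := quadratic_perturbation (z ks) kappa0 HB v2; rewrite -/r2 -/(S ks) in r2_le.
  have s2_le : \sum_i (z ks i + v i) ^+ 2 <= 2 * S ks + d%:R * (2 * w).
    have -> : 2 * S ks + d%:R * (2 * w) = \sum_(i < d) (2 * z ks i ^+ 2 + 2 * w).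
      by rewrite big_split /= sumd -mulr_sumr.
    apply: ler_sum => i _; have := v2 i; have := sqr_ge0 (z ks i - v i).
    have -> : (z ks i - v i) ^+ 2 = 2 * z ks i ^+ 2 + 2 * v i ^+ 2 - (z ks i + v i) ^+ 2 by ring.
    by move: (w) => ?; lra.
  have eta_le := le_trans Hle (ler_wpM2l eta0 s2_le).
  have -> : f (row_of_tuple t) - (a ks + gv) =
    (f (row_of_tuple t) - (f y + (lin ks + gv) + (quad ks + 2^-1 * r2))) + 2^-1 * r2.
    by rewrite /a; move: (f y) (f _) (lin ks) (quad ks) => ? ? ? ?; ring.
  apply: le_trans (ler_normD _ _) _; rewrite [`|2^-1 * _|]normrM [`|2^-1|]ger0_norm //.
  rewrite /alpha /beta; move: eta_le r2_le.
  move: `|r2| `|f _ - _| (S ks) (kappa^-1) (w) (d%:R) => r e s k' w' D; lra.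
move=> ks ks_in; have z1 i : `|z ks i| <= 1 by exact: cell_center_bounded.
apply: le_trans (ler_normB _ _) _; have := cell_density_bound ks m_gt0 fM.
have : `|lin ks| <= d%:R * G.
  apply: le_trans (ler_norm_sum _ _ _) _.
  have -> : d%:R * G = \sum_(i < d) G by rewrite sumr_const card_ord mulr_natl.
  by apply: ler_sum => i _; rewrite normrM -[leRHS]mulr1 ler_pM.
have : `|quad ks| <= d%:R ^+ 2 * B / 2.
  rewrite /quad normrM [`|2^-1|]ger0_norm // [leRHS]mulrC ler_wpM2l //.
  apply: le_trans (ler_norm_sum _ _ _) _.
  have -> : d%:R ^+ 2 * B = \sum_(i < d) \sum_(j < d) B.
    by rewrite !sumr_const !card_ord -mulrnA mulnn -natrX mulr_natl.
  apply: ler_sum => i _; apply: le_trans (ler_norm_sum _ _ _) _.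
  apply: ler_sum => j _; rewrite normrM -[leRHS]mulr1 ler_pM // normrM.
  by rewrite -[leRHS]mulr1 ler_pM.
have := ler_normD (f y) (lin ks + quad ks); have := ler_normD (lin ks) (quad ks).
by have := fM y; rewrite -/(a ks); lra.
Qed.

Lemma bernstein_mean_bound : `|bernstein_mean f m y| <= M.
Proof.
rewrite bernstein_meanE //; apply: le_trans (ler_norm_sum _ _ _) _.
rewrite -[M]mul1r -W_mass mulr_suml; apply: ler_sum => ks _.
rewrite normrM (ger0_norm (W0 _)) mulrC ler_wpM2l //; exact: cell_density_bound.
Qed.

(** Here f is only compared with a constant f0. The term with L is of order 1 / m
    when y is: coordinates are nonnegative, so that the mean distance between
    those of the midpoint and of y is at most the sum of their means. The term with
    eps serves points y that converge. *)
Lemma bernstein_second_moment_bound (f0 eps L : R) : 0 <= eps -> 0 <= L ->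
  (forall u, simplex u -> (forall i, `|u ord0 i - y ord0 i| <= 2 * delta) ->
    `|f u - f0| <= eps + L * \sum_i `|u ord0 i - y ord0 i|) ->
  `|bernstein_second_moment f m y / m%:R ^+ d - f0 * \sum_(ks <- idx) W ks ^+ 2|
  <= eps * \sum_(ks <- idx) W ks ^+ 2 +
     L * \sum_i ((2^-1 - y ord0 i) / m%:R + 2 * y ord0 i + (2 * m%:R)^-1) +
     (M + `|f0|) * tail.
Proof.
move=> eps0 L0 Hf; have md0 : m%:R ^+ d != 0 :> R by rewrite expf_neq0 ?gt_eqF.
pose z ks (i : 'I_d) := cell_center m ks i - y ord0 i.
rewrite bernstein_second_momentE // mulrC mulKf // -/W -/idx.
have -> : \sum_(ks <- idx) cell_density f m ks * W ks ^+ 2 -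
    f0 * \sum_(ks <- idx) W ks ^+ 2 =
    \sum_(ks <- idx) W ks * (W ks * (cell_density f m ks - f0)).
  by rewrite mulr_sumr -sumrB; apply: eq_bigr => ks _; ring.
pose e ks := W ks * eps + L * \sum_i (`|z ks i| + (2 * m%:R)^-1).
have m20 : 0 <= (2 * m%:R)^-1 :> R by rewrite invr_ge0 mulr_ge0 // ltW.
apply: le_trans (@sum_near_tail _ e (M + `|f0|) _ _ _ _) _.
- by rewrite addr_ge0.
- move=> ks _; rewrite addr_ge0 ?mulr_ge0 ?W0 //.
  by apply: sumr_ge0 => i _; rewrite addr_ge0.
- move=> ks ks_in near_ks; rewrite normrM (ger0_norm (W0 ks)).
  apply: le_trans (_ : W ks * (eps + L * \sum_i (`|z ks i| + (2 * m%:R)^-1)) <= _).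
    apply: (ler_wpM2l (W0 ks)); apply: (@cell_density_affine _ _ f m ks (fun=> 0)) => // t kt.
    rewrite big1 ?addr0; last by move=> i _; rewrite mul0r.
    have [tS t_dist] := near_point_cell near_ks kt.
    apply: le_trans (Hf _ tS _) _; first by move=> i; rewrite mxE.
    rewrite lerD2l ler_wpM2l //; apply: ler_sum => i _; rewrite mxE.
    have -> : tnth t i - y ord0 i = z ks i + (tnth t i - cell_center m ks i).
      by rewrite /z; ring.
    by apply: le_trans (ler_normD _ _) _; rewrite lerD2l cell_center_dist.
  rewrite mulrDr lerD2l -[leRHS]mul1r ler_wpM2r ?W1 ?mulr_ge0 //.
  by apply: sumr_ge0 => i _; rewrite addr_ge0.
- move=> ks ks_in; rewrite normrM (ger0_norm (W0 ks)) -[leRHS]mul1r.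
  apply: ler_pM => //; first exact: W1.
  apply: le_trans (ler_normB _ _) _; rewrite lerD2r; exact: cell_density_bound.
rewrite lerD2r.
have -> : \sum_(ks <- idx) W ks * e ks = eps * \sum_(ks <- idx) W ks ^+ 2 +
    L * \sum_i \sum_(ks <- idx) W ks * (`|z ks i| + (2 * m%:R)^-1).
  rewrite exchange_big /= !mulr_sumr -big_split /=; apply: eq_bigr => ks _.
  by rewrite /e -mulr_sumr mulrDr mulrA -expr2 mulrC; congr (_ + _); rewrite mulrCA.
rewrite lerD2l ler_wpM2l //; apply: ler_sum => i _.
have y0 := simplex_ge0 i yS.
rewrite -(cell_center_moment1 i yS m_gt0).
have -> : \sum_(ks <- multi_indices d m.-1)
      point_weight y m.-1 ks * (cell_center m ks i - y ord0 i) + 2 * y ord0 i + (2 * m%:R)^-1 =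
    \sum_(ks <- idx) W ks * (z ks i + 2 * y ord0 i + (2 * m%:R)^-1).
  under [RHS]eq_bigr do rewrite 2!mulrDr.
  by rewrite !big_split /= -!mulr_suml W_mass !mul1r.
apply: ler_sum => ks _; rewrite ler_wpM2l ?W0 // lerD2r /z.
have c0 : 0 <= cell_center m ks i :> R by rewrite /cell_center divr_ge0 // addr_ge0.
by rewrite ler_norml; apply/andP; split; lra.
Qed.

End BernsteinBounds.

(** * Compactness *)

Lemma ultra_cvg_segment {R : realType} {I : Type} (F : set_system I)
    (u : I -> R) (a b : R) : UltraFilter F ->
  (\forall i \near F, a <= u i <= b) -> exists2 l, a <= l <= b & u @ F --> l.
Proof.
move=> FU u_ab; have FP : ProperFilter F by exact: ultra_proper.
have [|l [l_ab lF]] := @segment_compact R a b (u @ F) _.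
  by near=> i; rewrite /= in_itv /=; near: i.
exists l; first by move: l_ab; rewrite /= in_itv.
move=> A /= lA; rewrite nbhs_simpl /=.
have [//|nA] := in_ultra_setVsetC (u @^-1` A) FU.
by have [z [/= nAz Az]] := lF (~` A) A nA lA.
Unshelve. all: by end_near. Qed.

Lemma near_coords {R : realType} {d : nat} (x : 'rV[R]_d) (P : set 'rV[R]_d) :
  nbhs x P -> exists2 r : R, 0 < r &
    forall u : 'rV[R]_d, (forall i, `|u ord0 i - x ord0 i| < r) -> P u.
Proof.
move=> /nbhs_ballP[r /= r0 rP]; exists r => // u ux; apply: rP; split=> [//|i j].
by rewrite (ord1 i) -ball_normE /= distrC.
Qed.

Lemma cvg_coords {R : realType} {d : nat} {I : Type} (F : set_system I) {FF : Filter F}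
    (y : I -> 'rV[R]_d) (x : 'rV[R]_d) :
  (forall j, y i ord0 j @[i --> F] --> x ord0 j) -> y @ F --> x.
Proof.
move=> yx A /near_coords[r r0 rA]; rewrite nbhs_simpl /=.
have : \forall i \near F, forall j, `|y i ord0 j - x ord0 j| < r.
  by apply: filter_forall => j; move/cvgrPdistC_lt: (yx j); exact.
by apply: filterS => i; exact: rA.
Qed.

Section Bounded.
Context {R : realType} {d : nat}.

Lemma cube_compact : compact [set v : 'rV[R]_d | forall i, `[0, 1]%classic (v ord0 i)].
Proof. exact: (@rV_compact R d (fun=> _) (fun i => @segment_compact R 0 1)). Qed.

Lemma simplex_compact : compact (@simplex R d).
Proof.
have -> : @simplex R d = [set v : 'rV[R]_d | forall i, `[0, 1]%classic (v ord0 i)] `&`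
    (@norm1 R d) @^-1` [set s | s <= 1].
  by apply/seteqP; split=> [v [v01 v1]|v [v01 v1]]; split=> // i;
     have := v01 i; rewrite /= ?in_itv.
apply: (@subclosed_compact _ _ [set v : 'rV[R]_d | forall i, `[0, 1]%classic (v ord0 i)]).
- apply: closedI.
    apply: compact_closed; first exact: norm_hausdorff.
    exact: cube_compact.
  apply: closed_comp; last exact: closed_le.
  move=> v _; apply: (@cvg_big_sum _ _ (nbhs v) (nbhs_filter v)) => i _.
  by apply: cvg_norm; exact: coord_continuous.
- exact: cube_compact.
by move=> v [].
Qed.

Lemma bounded_on_simplex (f g : 'rV[R]_d -> R) :
  (forall x, simplex x -> g x = f x) -> (forall x, ~ simplex x -> f x = 0) ->
  (forall x, simplex x -> {for x, continuous g}) ->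
  exists M, forall x, `|f x| <= M.
Proof.
move=> gf f0 cg.
have S0 : @simplex R d !=set0.
  exists 0; split => [i|]; first by rewrite mxE lexx ler01.
  by rewrite /norm1 big1 // => i _; rewrite mxE normr0.
have [|c cS cmax] := @EVT_max_rV R d (fun x => `|g x|) simplex S0 simplex_compact.
  apply: continuous_in_subspaceT => x /set_mem xS.
  by apply: (continuous_comp (cg x xS)); exact: norm_continuous.
exists `|g c| => x; have [xS|nS] := pselect (simplex x).
  by rewrite -gf //; apply: cmax; rewrite inE.
by rewrite f0 // normr0.
Qed.

End Bounded.

(** * Limits of the bias and of the variance *)

Lemma le_sum_norm {R : numDomainType} {d : nat} (a : 'I_d -> R) k :
  `|a k| <= \sum_j `|a j|.
Proof. by rewrite (bigD1 k) //= lerDl; apply: sumr_ge0. Qed.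

Lemma sum_norm2_bound {R : realType} {d : nat} (H : 'I_d -> 'I_d -> R) :
  exists2 B : R, 0 <= B & forall j k, `|H j k| <= B.
Proof.
exists (\sum_j \sum_k `|H j k|) => [|j k].
  by apply: sumr_ge0 => j _; apply: sumr_ge0 => k _; exact: normr_ge0.
rewrite (bigD1 j) //= (bigD1 k) //= -addrA lerDl addr_ge0 //.
  by apply: sumr_ge0 => i _; exact: normr_ge0.
by apply: sumr_ge0 => i _; apply: sumr_ge0 => l _; exact: normr_ge0.
Qed.

Lemma cvg_tail {R : realType} (d : nat) (delta : R) (C : nat) : 0 < delta ->
  n%:R ^+ C * (d%:R * (2 * expR (- ((n.-1)%:R * delta ^+ 2 / 8)))) @[n --> \oo] --> (0 : R).
Proof.
move=> d0; pose c := delta ^+ 2 / 8; have c0 : 0 < c by rewrite divr_gt0 // exprn_gt0.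
have fE : \forall n \near \oo, (n%:R ^+ C * expR (- (n%:R * c))) * (2 * d%:R * expR c) =
    n%:R ^+ C * (d%:R * (2 * expR (- ((n.-1)%:R * delta ^+ 2 / 8)))).
  near=> n; have n0 : (0 < n)%N by near: n; exact: nbhs_infty_gt.
  have -> : expR (- ((n.-1)%:R * delta ^+ 2 / 8)) = expR (- (n%:R * c)) * expR c.
    rewrite -expRD; congr expR; rewrite -subn1 natrB // /c; by field.
  by ring.
have H : n%:R ^+ C * expR (- (n%:R * c)) * (2 * d%:R * expR c) @[n --> \oo] -->
    (0 * (2 * d%:R * expR c) : R) by apply: cvgMl; exact: cvg_exprM_expRN.
by rewrite mul0r in H; exact: cvg_trans (near_eq_cvg fE) H.
Unshelve. all: by end_near. Qed.

Section Limits.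
Context {R : realType} {d : nat}.
Variables (f fext : 'rV[R]_d -> R) (U : set 'rV[R]_d) (M : R).
Hypotheses (U_open : open U) (simplex_U : simplex `<=` U).
Hypothesis fext_f : forall x, simplex x -> fext x = f x.
Hypothesis fext_C2 : C2_on U fext.
Hypothesis fM : forall x, `|f x| <= M.

(** The second derivatives are frozen at xs, since they are merely continuous;
    the first ones are taken at the moving point y. *)
Lemma taylor_local (xs : 'rV[R]_d) (e : R) : U xs -> 0 < e ->
  exists2 r : R, 0 < r & forall y u : 'rV[R]_d,
    (forall i, `|y ord0 i - xs ord0 i| < r) -> (forall i, `|u ord0 i - xs ord0 i| < r) ->
    `|fext u - (fext y + \sum_i partial i fext y * (u ord0 i - y ord0 i) +
        2^-1 * \sum_i \sum_j partial j (partial i fext) xs *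
          ((u ord0 i - y ord0 i) * (u ord0 j - y ord0 j)))|
    <= e * \sum_i (u ord0 i - y ord0 i) ^+ 2.
Proof.
move=> Uxs e0; pose e' := e / d.+1%:R.
have e'0 : 0 < e' by rewrite divr_gt0.
have Unear : \forall z \near xs, U z by apply: open_nbhs_nbhs.
have Dnear : \forall z \near xs, forall i j,
    `|partial j (partial i fext) z - partial j (partial i fext) xs| <= e'.
  pose Q i j (z : 'rV[R]_d) :=
    `|partial j (partial i fext) z - partial j (partial i fext) xs| <= e'.
  suff HQ i j : nbhs xs (Q i j).
    have FN : Filter (nbhs xs) := nbhs_filter xs.
    exact: (filter_forall FN (fun i => filter_forall FN (HQ i))).
  have [_ /(_ i)[_ _ /(_ j)[_ cD]]] := fext_C2 Uxs.
  by move/cvgrPdistC_le : cD; exact.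
have [r r0 rP] := near_coords (filterI Unear Dnear).
exists r => // y u yr ur; pose h := u - y.
have hE i : h ord0 i = u ord0 i - y ord0 i by rewrite !mxE.
have seg s : 0 <= s <= 1 -> forall i, `|(s *: h + y) ord0 i - xs ord0 i| < r.
  move=> /andP[s0 s1] i; rewrite mxE mxE hE.
  have := yr i; have := ur i; rewrite !ltr_norml => /andP[u1 u2] /andP[y1 y2].
  rewrite (_ : s * _ + _ - _ = s * (u ord0 i - xs ord0 i) +
    (1 - s) * (y ord0 i - xs ord0 i)); last by ring.
  move: s0; rewrite le_eqVlt => /orP[/eqP <-|s0].
    by rewrite mul0r add0r subr0 mul1r y1 y2.
  move: u1 u2 y1 y2; move: (u _ _ - _) (y _ _ - _) => a b a1 a2 b1 b2.
  by apply/andP; split; nra.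
have segU s : 0 <= s <= 1 -> U (s *: h + y) by move=> /seg/rP[].
have [s s01] := taylor2 U_open fext_C2 segU.
rewrite subrK => ->; have [_ close] := rP _ (seg s s01).
rewrite (eq_bigr (fun i => partial i fext y * (u ord0 i - y ord0 i))); last first.
  by move=> i _; rewrite hE mulrC.
rewrite opprD addrACA subrr add0r -mulrBr -sumrB normrM ger0_norm //.
apply: le_trans (_ : 2^-1 * \sum_i \sum_j e' * ((h ord0 i ^+ 2 + h ord0 j ^+ 2) / 2) <= _).
  apply: ler_wpM2l => //; apply: le_trans (ler_norm_sum _ _ _) _; apply: ler_sum => i _.
  rewrite -sumrB; apply: le_trans (ler_norm_sum _ _ _) _; apply: ler_sum => j _.
  rewrite -!hE [h ord0 i * _ * _]mulrC -mulrBl normrM.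
  apply: ler_pM => //.
  have := sqr_ge0 (h ord0 i - h ord0 j); have := sqr_ge0 (h ord0 i + h ord0 j).
  by rewrite ler_norml => ? ?; apply/andP; split; nra.
have sumd (x : R) : \sum_(i < d) x = d%:R * x.
  by rewrite sumr_const card_ord mulr_natl.
pose S := \sum_i (u ord0 i - y ord0 i) ^+ 2.
have SE : \sum_i h ord0 i ^+ 2 = S by apply: eq_bigr => i _; rewrite hE.
rewrite (eq_bigr (fun i => e' / 2 * (d%:R * h ord0 i ^+ 2 + S))); last first.
  move=> i _; rewrite -SE -sumd -big_split /= mulr_sumr; apply: eq_bigr => j _.
  by rewrite mulrCA mulrC.
rewrite -mulr_sumr big_split /= -mulr_sumr SE sumd -/S.
have S0 : 0 <= S by apply: sumr_ge0 => i _; exact: sqr_ge0.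
have -> : 2^-1 * (e' / 2 * (d%:R * S + d%:R * S)) = (e' * d%:R / 2) * S by field.
apply: ler_wpM2r => //.
have -> : e' * d%:R / 2 = (e * d%:R / 2) / d.+1%:R by rewrite /e'; ring.
rewrite ler_pdivrMr //.
have : 0 <= e * d%:R by rewrite mulr_ge0 // ltW.
by rewrite -[d.+1%:R]natr1 mulrDr; move: e0; lra.
Qed.

(** The coefficient of 1 / m in the bias at an arbitrary point of the simplex;
    bcoefE identifies it with bcoef. *)
Definition bias_limit (xs : 'rV[R]_d) : R :=
  \sum_j partial j fext xs * (2^-1 - xs ord0 j) +
  2^-1 * \sum_j \sum_k partial k (partial j fext) xs *
    ((j == k)%:R * xs ord0 j - xs ord0 j * xs ord0 k).

Section Along.
Context {I : Type} (F : set_system I) {FF : Filter F}.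
Variables (m : I -> nat) (y : I -> 'rV[R]_d) (xs : 'rV[R]_d).
Hypotheses (moo : m @ F --> \oo) (yS : \forall i \near F, simplex (y i)).
Hypotheses (xsS : simplex xs) (xs1 : norm1 xs < 1).
Hypothesis yx : forall j, y i ord0 j @[i --> F] --> xs ord0 j.

Let m_inv : ((m i)%:R^-1 : R) @[i --> F] --> (0 : R). Proof. exact: cvg_natr_inv. Qed.
Let Uxs : U xs. Proof. exact: simplex_U. Qed.

(** A common choice of the radius delta for which the nonasymptotic bounds apply
    and for which the cells that are close to y stay in a given neighbourhood
    of xs. *)
Lemma near_delta (r : R) : 0 < r -> exists2 delta, 0 < delta <= 2 &
  \forall i \near F, [/\ (0 < m i)%N, simplex (y i), 1 <= delta * (m i)%:R,
    2 * d%:R * delta <= 1 - norm1 (y i) &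
    (forall j, `|y i ord0 j - xs ord0 j| < r) /\
    forall u : 'rV[R]_d, (forall j, `|u ord0 j - y i ord0 j| <= 2 * delta) ->
      forall j, `|u ord0 j - xs ord0 j| < r].
Proof.
move=> r0; pose s := 1 - norm1 xs; have s0 : 0 < s by rewrite subr_gt0.
pose delta := Num.min (r / 4) (Num.min (s / (4 * d.+1%:R)) 1).
have delta0 : 0 < delta by rewrite !lt_min !divr_gt0 // ?mulr_gt0 // ltr01.
have delta1 : delta <= 1 by rewrite !ge_min lexx !orbT.
have delta_r : delta <= r / 4 by rewrite ge_min lexx.
have delta_s : delta <= s / (4 * d.+1%:R) by rewrite !ge_min lexx !orbT.
exists delta; first by rewrite delta0 (le_trans delta1) //; lra.
have norm_y : norm1 (y i) @[i --> F] --> norm1 xs.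
  by apply: cvg_big_sum => j _; apply: cvg_norm; exact: yx.
have near_y : \forall i \near F, forall j, `|y i ord0 j - xs ord0 j| < r / 2.
  suff Q j : \forall i \near F, `|y i ord0 j - xs ord0 j| < r / 2 by exact: (filter_forall FF Q).
  by move/cvgrPdistC_lt : (@yx j); apply; rewrite divr_gt0.
have near_n : \forall i \near F, `|norm1 (y i) - norm1 xs| < s / 2.
  by move/cvgrPdistC_lt : norm_y; apply; rewrite divr_gt0.
have near_m : \forall i \near F, (Num.truncn delta^-1 < m i)%N.
  by near=> i; near: i; exact: (moo (nbhs_infty_gt _)).
near=> i.
have ym : (Num.truncn delta^-1 < m i)%N by near: i.
have yr : forall j, `|y i ord0 j - xs ord0 j| < r / 2 by near: i.
have yn : `|norm1 (y i) - norm1 xs| < s / 2 by near: i.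
split.
- by apply: leq_trans ym.
- by near: i.
- rewrite -(ler_pM2l (_ : 0 < delta^-1)) ?invr_gt0 // mulr1 mulKf ?gt_eqF //.
  by apply: le_trans (ltW (truncnS_gt _)) _; rewrite ler_nat.
- have : 2 * d%:R * delta <= s / 2.
    apply: le_trans (_ : 2 * d%:R * (s / (4 * d.+1%:R)) <= _).
      by rewrite ler_wpM2l // mulr_ge0.
    have -> : 2 * d%:R * (s / (4 * d.+1%:R)) = (d%:R * s / 2) / d.+1%:R :> R.
      by rewrite invfM; field.
    rewrite ler_pdivrMr // -[d.+1%:R]natr1; move: s0; lra.
  by move: yn; rewrite ltr_norml /s => /andP[]; lra.
split=> [j|u uy j]; first by apply: lt_trans (yr j) _; move: r0; lra.
have := yr j; have := uy j; rewrite ltr_norml ler_norml ltr_norml.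
by move=> /andP[? ?] /andP[? ?]; apply/andP; split; lra.
Unshelve. all: by end_near. Qed.

Lemma cvg_cell_center_cov j k :
  (m i)%:R * cell_center_cov (y i) (m i) j k @[i --> F] -->
  (j == k)%:R * xs ord0 j - xs ord0 j * xs ord0 k.
Proof.
pose g i : R := (1 - (m i)%:R^-1) * ((j == k)%:R * y i ord0 j) +
  (2 * (m i)%:R^-1 - 1) * (y i ord0 j * y i ord0 k) +
  (m i)%:R^-1 * (4^-1 - (y i ord0 j + y i ord0 k) / 2).
have fE : \forall i \near F, g i = (m i)%:R * cell_center_cov (y i) (m i) j k.
  near=> i; have m0 : (m i)%:R != 0 :> R.
    by rewrite pnatr_eq0 -lt0n; near: i; exact: (moo (nbhs_infty_gt 0)).
  by rewrite /g /cell_center_cov; field.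
have H : g i @[i --> F] --> (1 - 0) * ((j == k)%:R * xs ord0 j) +
    (2 * 0 - 1) * (xs ord0 j * xs ord0 k) +
    0 * (4^-1 - (xs ord0 j + xs ord0 k) / 2).
  apply: cvgD; [apply: cvgD|]; apply: cvgM => //.
  - by apply: cvgB => //; exact: cvg_cst.
  - by apply: cvgM => //; exact: cvg_cst.
  - by apply: cvgB; [apply: cvgM => //|]; exact: cvg_cst.
  - exact: cvgM.
  - apply: cvgB; first exact: cvg_cst.
    by apply: cvgM; [exact: cvgD|exact: cvg_cst].
rewrite (_ : (j == k)%:R * _ - _ = (1 - 0) * ((j == k)%:R * xs ord0 j) +
    (2 * 0 - 1) * (xs ord0 j * xs ord0 k) +
    0 * (4^-1 - (xs ord0 j + xs ord0 k) / 2)); last by ring.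
exact: cvg_trans (near_eq_cvg fE) H.
Unshelve. all: by end_near. Qed.

Lemma cvg_partial j : partial j fext (y i) @[i --> F] --> partial j fext xs.
Proof.
have [_ /(_ j)[_ cD _]] := fext_C2 Uxs.
apply: (@cvg_comp _ _ _ y (partial j fext) F (nbhs xs)) => //.
exact: cvg_coords.
Qed.

(** After multiplication by m the bound of bernstein_bias_bound tends to at most
    2 eta + B d kappa / 2, where eta and kappa are arbitrarily small. *)
Lemma cvg_bias :
  (m i)%:R * (bernstein_mean f (m i) (y i) - f (y i)) @[i --> F] --> bias_limit xs.
Proof.
pose H j k := partial k (partial j fext) xs.
pose P i := \sum_j partial j fext (y i) * (2^-1 - y i ord0 j) +
  2^-1 * \sum_j \sum_k H j k * ((m i)%:R * cell_center_cov (y i) (m i) j k).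
have P_lim : P i @[i --> F] --> bias_limit xs.
  apply: cvgD.
    apply: cvg_big_sum => j _; apply: cvgM; first exact: cvg_partial.
    by apply: cvgB => //; exact: cvg_cst.
  apply: cvgM; first exact: cvg_cst.
  apply: cvg_big_sum => j _; apply: cvg_big_sum => k _; apply: cvgM; first exact: cvg_cst.
  exact: cvg_cell_center_cov.
suff D_lim : (m i)%:R * (bernstein_mean f (m i) (y i) - f (y i)) - P i @[i --> F] --> 0.
  rewrite -[bias_limit xs]add0r.
  rewrite (_ : (fun i => _) = (fun i => (m i)%:R *
    (bernstein_mean f (m i) (y i) - f (y i)) - P i + P i)); first exact: cvgD.
  by apply/funext => i; rewrite subrK.
have [B B0 HB] := sum_norm2_bound H.
pose G : R := \sum_j `|partial j fext xs| + 1.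
have gG : \forall i \near F, forall j, `|partial j fext (y i)| <= G.
  suff Q j : \forall i \near F, `|partial j fext (y i)| <= G by exact: (filter_forall FF Q).
  have norm_lim : `|partial j fext (y i)| @[i --> F] --> `|partial j fext xs|.
    by apply: cvg_norm; exact: cvg_partial.
  move/cvgrPdistC_le : norm_lim => /(_ _ ltr01); apply: filterS => i.
  have := le_sum_norm (fun j => partial j fext xs) j.
  by rewrite /G => h1 /ler_normlP[_ h2]; move: h1 h2; lra.
apply/cvgr0Pnorm_le => /= e e0.
(* With these choices the coefficient alpha is at most e / 2. *)
pose eta : R := e / 8; have eta0 : 0 < eta by rewrite divr_gt0.
have Bd1 : 0 < B * d%:R + 1 by rewrite ltr_wpDl // mulr_ge0.
pose kappa : R := e / (2 * (B * d%:R + 1)).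
have kappa0 : 0 < kappa by rewrite divr_gt0 // mulr_gt0.
pose alpha : R := 2 * eta + B * d%:R * kappa / 2.
have alpha_le : alpha <= e / 2.
  have : B * d%:R * kappa <= e / 2.
    rewrite /kappa (_ : B * d%:R * _ = (B * d%:R * e / 2) / (B * d%:R + 1)).
      by rewrite ler_pdivrMr //; move: e0; lra.
    by rewrite invfM; ring.
  by rewrite /alpha /eta; lra.
have alpha0 : 0 <= alpha.
  have : 0 <= B * d%:R * kappa by exact: mulr_ge0 (mulr_ge0 B0 (ler0n _ _)) (ltW kappa0).
  by rewrite /alpha; move: eta0; lra.
have [r r0 rP] := taylor_local Uxs eta0.
have [delta delta02 near_i] := near_delta r0.
pose beta := (2 * eta * d%:R + B * d%:R ^+ 2 * (kappa^-1 + 1) / 2) * 4^-1.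
pose A := 2 * M + d%:R * G + d%:R ^+ 2 * B / 2.
pose tail i : R := d%:R * (2 * expR (- (((m i).-1)%:R * delta ^+ 2 / 8))).
pose E i := alpha * \sum_j ((m i)%:R * cell_center_cov (y i) (m i) j j) +
  beta * (m i)%:R^-1 + A * ((m i)%:R ^+ 1 * tail i).
have E_lim : E i @[i --> F] -->
    alpha * (\sum_j ((j == j)%:R * xs ord0 j - xs ord0 j * xs ord0 j)) + beta * 0 + A * 0.
  apply: cvgD; [apply: cvgD|]; apply: cvgM; try exact: cvg_cst.
  - by apply: cvg_big_sum => j _; exact: cvg_cell_center_cov.
  - exact: m_inv.
  - apply: (@cvg_comp _ _ _ m (fun n => n%:R ^+ 1 *
      (d%:R * (2 * expR (- ((n.-1)%:R * delta ^+ 2 / 8))))) F \oo) => //.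
    by apply: cvg_tail; case/andP: delta02.
have E_lt : alpha * (\sum_j ((j == j)%:R * xs ord0 j - xs ord0 j * xs ord0 j)) + beta * 0 + A * 0 < e.
  rewrite !mulr0 !addr0; apply: le_lt_trans (_ : e / 2 < e); last by move: e0; lra.
  apply: le_trans alpha_le; rewrite -[leRHS]mulr1 ler_wpM2l //.
  apply: le_trans (ltW xs1); rewrite norm1_simplex //; apply: ler_sum => j _.
  by rewrite eqxx mul1r gerBl mulr_ge0 // simplex_ge0.
have E_le : \forall i \near F, E i < e by move/cvgr_lt : E_lim; apply.
near=> i; apply: le_trans (ltW (_ : E i < e)); last by near: i.
have [m0 iS d1 d2 [yr ur]] : [/\ (0 < m i)%N, simplex (y i), 1 <= delta * (m i)%:R,
    2 * d%:R * delta <= 1 - norm1 (y i) &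
    (forall j, `|y i ord0 j - xs ord0 j| < r) /\
    forall u : 'rV[R]_d, (forall j, `|u ord0 j - y i ord0 j| <= 2 * delta) ->
      forall j, `|u ord0 j - xs ord0 j| < r] by near: i.
have gi : forall j, `|partial j fext (y i)| <= G by near: i.
have m0R : 0 < (m i)%:R :> R by rewrite ltr0n.
have bound := @bernstein_bias_bound _ _ f (m i) (y i) delta M m0 iS delta02 d1 d2 fM
  (fun j => partial j fext (y i)) H G B eta kappa (ltW eta0) kappa0 gi HB
  (fun u uS uy => ltac:(by rewrite -!fext_f //; apply: rP => // j; exact: ur)).
have -> : (m i)%:R * (bernstein_mean f (m i) (y i) - f (y i)) - P i = (m i)%:R *
   (bernstein_mean f (m i) (y i) - f (y i) -
     \sum_j partial j fext (y i) * ((2^-1 - y i ord0 j) / (m i)%:R) -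
     2^-1 * \sum_j \sum_k H j k * cell_center_cov (y i) (m i) j k).
  rewrite -[in RHS]addrA -opprD [RHS]mulrBr; congr (_ - _); rewrite /P [RHS]mulrDr.
  congr (_ + _).
    by rewrite mulr_sumr; apply: eq_bigr => j _; field; rewrite gt_eqF.
  rewrite [RHS]mulrCA; congr (_ * _); rewrite mulr_sumr; apply: eq_bigr => j _.
  by rewrite mulr_sumr; apply: eq_bigr => k _; rewrite mulrCA.
rewrite normrM gtr0_norm //; apply: le_trans (ler_wpM2l (ltW m0R) bound) _.
rewrite le_eqVlt; apply/orP; left; apply/eqP.
rewrite /E -mulr_sumr -/alpha -/A /beta -/(tail i) expr1.
move: (tail i) (\sum_j cell_center_cov _ _ j j) (alpha) (A) => t S al A'.
move: (2 * eta * d%:R + _) => b; field; by rewrite gt_eqF.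
Unshelve. all: by end_near. Qed.

(** The power of sqrt m makes the sum of the squared weights converge, and the
    exponential tail is negligible against every power of m. *)
Lemma cvg_second_moment (c : nat) (cl : R) :
  Num.sqrt (m i)%:R ^+ c * \sum_(ks <- multi_indices d (m i).-1)
    point_weight (y i) (m i).-1 ks ^+ 2 @[i --> F] --> cl ->
  Num.sqrt (m i)%:R ^+ c * (bernstein_second_moment f (m i) (y i) / (m i)%:R ^+ d)
    @[i --> F] --> fext xs * cl.
Proof.
pose W2 i := \sum_(ks <- multi_indices d (m i).-1) point_weight (y i) (m i).-1 ks ^+ 2.
rewrite -/(W2 _) => W2_lim.
pose D i := Num.sqrt (m i)%:R ^+ c *
  (bernstein_second_moment f (m i) (y i) / (m i)%:R ^+ d - fext xs * W2 i).
suff D_lim : D i @[i --> F] --> 0.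
  rewrite -[fext xs * cl]add0r.
  rewrite (_ : (fun i => _) = (fun i => D i + fext xs * (Num.sqrt (m i)%:R ^+ c * W2 i))).
    by apply: cvgD => //; apply: cvgM => //; exact: cvg_cst.
  by apply/funext => i; rewrite /D; ring.
apply/cvgr0Pnorm_le => /= e e0.
have cl1 : 0 < `|cl| + 1 by rewrite ltr_wpDl.
pose eps : R := e / (2 * (`|cl| + 1)).
have eps0 : 0 < eps by rewrite divr_gt0 // mulr_gt0.
have cf : {for xs, continuous fext} by case: (fext_C2 Uxs).
have cf' : \forall u \near xs, `|fext u - fext xs| <= eps.
  by move/cvgrPdistC_le : cf; exact.
have [r r0 rP] := near_coords cf'.
have [delta delta02 near_i] := near_delta r0.
pose tail i : R := d%:R * (2 * expR (- (((m i).-1)%:R * delta ^+ 2 / 8))).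
pose E i := eps * (Num.sqrt (m i)%:R ^+ c * W2 i) +
  (M + `|fext xs|) * ((m i)%:R ^+ c * tail i).
have E_lim : E i @[i --> F] --> eps * cl + (M + `|fext xs|) * 0.
  apply: cvgD; apply: cvgM => //; try exact: cvg_cst.
  apply: (@cvg_comp _ _ _ m (fun n => n%:R ^+ c *
      (d%:R * (2 * expR (- ((n.-1)%:R * delta ^+ 2 / 8))))) F \oo) => //.
  by apply: cvg_tail; case/andP: delta02.
have E_lt : eps * cl + (M + `|fext xs|) * 0 < e.
  rewrite mulr0 addr0; apply: le_lt_trans (_ : e / 2 < e); last by move: e0; lra.
  apply: le_trans (_ : eps * `|cl| <= _); first by rewrite ler_wpM2l ?ler_norm // ltW.
  have -> : eps * `|cl| = (e / 2 * `|cl|) / (`|cl| + 1) by rewrite /eps invfM; ring.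
  by rewrite ler_pdivrMr // ler_wpM2l ?lerDl // divr_ge0 // ltW.
have E_le : \forall i \near F, E i < e by move/cvgr_lt : E_lim; apply.
near=> i; apply: le_trans (ltW (_ : E i < e)); last by near: i.
have [m0 iS d1 d2 [yr ur]] : [/\ (0 < m i)%N, simplex (y i), 1 <= delta * (m i)%:R,
    2 * d%:R * delta <= 1 - norm1 (y i) &
    (forall j, `|y i ord0 j - xs ord0 j| < r) /\
    forall u : 'rV[R]_d, (forall j, `|u ord0 j - y i ord0 j| <= 2 * delta) ->
      forall j, `|u ord0 j - xs ord0 j| < r] by near: i.
have bound := @bernstein_second_moment_bound _ _ f (m i) (y i) delta M m0 iS delta02 d1 d2 fM
  (fext xs) eps 0 (ltW eps0) (lexx 0)
  (fun u uS uy => ltac:(by rewrite mul0r addr0 -fext_f //; apply: rP => // j; exact: ur)).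
rewrite mul0r addr0 -/(W2 i) -/(tail i) in bound.
have s0 : 0 <= Num.sqrt (m i)%:R ^+ c :> R by rewrite exprn_ge0 ?sqrtr_ge0.
rewrite /D normrM (ger0_norm s0); apply: le_trans (ler_wpM2l s0 bound) _.
rewrite mulrDr mulrCA [X in _ + X]mulrCA /E lerD2l.
apply: ler_wpM2l; first by rewrite addr_ge0 // (le_trans _ (fM 0)).
rewrite ler_wpM2r //; first by rewrite /tail mulr_ge0 // mulr_ge0 // expR_ge0.
rewrite lerXn2r ?nnegrE ?sqrtr_ge0 // -[leRHS]sqr_sqrtr // expr2 ler_peMr ?sqrtr_ge0 //.
have : Num.sqrt 1 <= Num.sqrt (m i)%:R :> R by rewrite ler_wsqrtr // ler1n.
by rewrite sqrtr1.
Unshelve. all: by end_near. Qed.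

Lemma cvg_bias_limit (z : I -> 'rV[R]_d) :
  (forall j, z i ord0 j @[i --> F] --> xs ord0 j) ->
  bias_limit (z i) @[i --> F] --> bias_limit xs.
Proof.
move=> zx; have zxs : z @ F --> xs by exact: cvg_coords.
have [_ cD] := fext_C2 Uxs.
apply: cvgD.
  apply: cvg_big_sum => j _; have [_ cDj _] := cD j; apply: cvgM.
    exact: (@cvg_comp _ _ _ z (partial j fext) F (nbhs xs)).
  by apply: cvgB => //; exact: cvg_cst.
apply: cvgM; first exact: cvg_cst.
apply: cvg_big_sum => j _; apply: cvg_big_sum => k _; apply: cvgM.
  have [_ _ /(_ k)[_ cDjk]] := cD j.
  exact: (@cvg_comp _ _ _ z (partial k (partial j fext)) F (nbhs xs)).
by apply: cvgB; apply: cvgM => //; exact: cvg_cst.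
Qed.

Lemma cvg_fext (z : I -> 'rV[R]_d) :
  (forall j, z i ord0 j @[i --> F] --> xs ord0 j) ->
  fext (z i) @[i --> F] --> fext xs.
Proof.
move=> zx; have zxs : z @ F --> xs by exact: cvg_coords.
have [cD _] := fext_C2 Uxs; exact: (@cvg_comp _ _ _ z fext F (nbhs xs)).
Qed.

Lemma cvg_mean : bernstein_mean f (m i) (y i) @[i --> F] --> fext xs.
Proof.
have fE : \forall i \near F, (m i)%:R^-1 * ((m i)%:R *
    (bernstein_mean f (m i) (y i) - f (y i))) + fext (y i) =
    bernstein_mean f (m i) (y i).
  near=> i; have m0 : (m i)%:R != 0 :> R.
    by rewrite pnatr_eq0 -lt0n; near: i; exact: (moo (nbhs_infty_gt 0)).
  by rewrite mulKf // fext_f ?subrK //; near: i.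
have H : (m i)%:R^-1 * ((m i)%:R *
    (bernstein_mean f (m i) (y i) - f (y i))) + fext (y i) @[i --> F] -->
    0 * bias_limit xs + fext xs.
  apply: cvgD; last exact: cvg_fext.
  by apply: cvgM => //; exact: cvg_bias.
by rewrite mul0r add0r in H; exact: cvg_trans (near_eq_cvg fE) H.
Unshelve. all: by end_near. Qed.

Section Boundary.
Variables (J : {set 'I_d}) (lams : 'rV[R]_d).
Hypotheses (xsJ : forall j, j \in J -> xs ord0 j = 0).
Hypotheses (xs_gt0 : forall j, j \notin J -> 0 < xs ord0 j).
Hypotheses (lams_ge0 : forall j, j \in J -> 0 <= lams ord0 j).
Hypothesis y_lams : forall j, j \in J -> (m i)%:R * y i ord0 j @[i --> F] --> lams ord0 j.

Let tJ (j : nat) : bool := nth false [seq k \in J | k <- enum 'I_d] j.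

Let tJE (j : 'I_d) : tJ j = (j \in J).
Proof. by rewrite /tJ (nth_map j) ?size_enum_ord // nth_ord_enum. Qed.

Let card_tJ : (\sum_(j < d) ~~ tJ j)%N = #|~: J|.
Proof.
rewrite -sum1_card [RHS]big_mkcond /=; apply: eq_bigr => j _.
by rewrite tJE inE; case: (j \in J).
Qed.

Lemma collision_limit_psi :
  collision_limit d tJ (fun j => (coords lams)`_j) (fun j => (coords xs)`_j) (1 - norm1 xs) =
  psi (~: J) xs * \prod_(j in J) poisson_collision (lams ord0 j).
Proof.
rewrite /collision_limit card_tJ mulrC; congr (_ * _); last first.
  rewrite [RHS]big_mkcond /=; apply: eq_bigr => j _.
  by rewrite tJE nth_coords.
have sumE : \sum_(j < d) (coords xs)`_j = norm1 xs.
  by rewrite norm1_simplex //; apply: eq_bigr => j _; rewrite nth_coords.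
rewrite sumE subrK expr1n divr1 /psi.
have normE : norm1 xs = \sum_(j in ~: J) xs ord0 j.
  rewrite norm1_simplex // [RHS]big_mkcond /=; apply: eq_bigr => j _.
  by rewrite inE; case: ifPn => //; rewrite negbK => /xsJ.
have prodE : \prod_(j < d) (if tJ j then 1 else (coords xs)`_j) =
    \prod_(j in ~: J) xs ord0 j.
  rewrite [RHS]big_mkcond /=; apply: eq_bigr => j _.
  by rewrite tJE nth_coords inE; case: (j \in J).
rewrite prodE normE powRN powR12_sqrt // !mulr_ge0 //.
- by rewrite exprn_ge0 // mulr_ge0 // pi_ge0.
- by rewrite -normE subr_ge0 ltW.
by apply: prodr_ge0 => j _; exact: simplex_ge0.
Qed.

(** The multinomial law has m - 1 trials, so the limit theorem is applied with
    m - 1 and rescaled by the ratio of the square roots, which tends to 1. *)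
Lemma cvg_point_weight2 :
  Num.sqrt (m i)%:R ^+ #|~: J| * \sum_(ks <- multi_indices d (m i).-1)
    point_weight (y i) (m i).-1 ks ^+ 2 @[i --> F] -->
  psi (~: J) xs * \prod_(j in J) poisson_collision (lams ord0 j).
Proof.
pose N i := (m i).-1; pose s j i := (coords (y i))`_j.
pose W2 i := \sum_(ks <- multi_indices d (m i).-1) point_weight (y i) (m i).-1 ks ^+ 2.
have sE i : mkseq (fun j => s j i) d = coords (y i).
  by rewrite -[in X in mkseq _ X](size_coords (y i)) mkseq_nth.
have totE i : simplex (y i) -> 1 - norm1 (y i) + \sum_(j < d) s j i = 1.
  move=> iS; rewrite -[RHS](point_weight_sum1 iS); congr (_ + _); rewrite sum_coords.
  by apply: eq_bigr => j _; rewrite /s nth_coords.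
have NE : \forall i \near F, (N i)%:R = (m i)%:R - 1 :> R.
  near=> i; rewrite /N -subn1 natrB //; near: i; exact: (moo (nbhs_infty_gt 0)).
have Noo : N @ F --> \oo.
  apply: (@cvg_comp _ _ _ m predn F \oo) => //.
  by move=> A [n _ nA]; exists n.+1 => // -[|k] //= nk; exact: nA.
have H : Num.sqrt (N i)%:R ^+ #|~: J| *
    multinomial_collision (N i) (1 - norm1 (y i)) (mkseq (fun j => s j i) d) @[i --> F] -->
    psi (~: J) xs * \prod_(j in J) poisson_collision (lams ord0 j).
  rewrite -collision_limit_psi -card_tJ.
  apply: cvg_multinomial_collision => //.
  - apply: cvgB; first exact: cvg_cst.
    by apply: cvg_big_sum => j _; apply: cvg_norm; exact: yx.
  - by rewrite subr_gt0.
  - move=> j jd; near=> i; rewrite /s -[j]/(val (Ordinal jd)) nth_coords.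
    by apply: simplex_ge0; near: i.
  - move=> j jd; rewrite -[j]/(val (Ordinal jd)) nth_coords.
    rewrite (_ : s _ = (fun i => y i ord0 (Ordinal jd))); first exact: yx.
    by apply/funext => i; rewrite /s nth_coords.
  - move=> j jd; rewrite -[j]/(val (Ordinal jd)) tJE nth_coords.
    by case: ifPn => [/xsJ|/xs_gt0].
  - by move=> j jd; rewrite -[j]/(val (Ordinal jd)) tJE nth_coords => /lams_ge0.
  - move=> j jd; rewrite -[j]/(val (Ordinal jd)) tJE nth_coords => jJ.
    have fE : \forall i \near F, (m i)%:R * y i ord0 (Ordinal jd) - y i ord0 (Ordinal jd) =
        (N i)%:R * (s (Ordinal jd) i / (1 - norm1 (y i) + \sum_(j < d) s j i)).
      near=> i; have iS : simplex (y i) by near: i.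
      have -> : (N i)%:R = (m i)%:R - 1 :> R by near: i.
      by rewrite totE // divr1 /s nth_coords mulrBl mul1r.
    have H : (m i)%:R * y i ord0 (Ordinal jd) - y i ord0 (Ordinal jd) @[i --> F] -->
        lams ord0 (Ordinal jd) - xs ord0 (Ordinal jd).
      by apply: cvgB; [exact: y_lams|exact: yx].
    by rewrite xsJ // subr0 in H; exact: cvg_trans (near_eq_cvg fE) H.
have ratio : (Num.sqrt (1 - (m i)%:R^-1) ^+ #|~: J|)^-1 @[i --> F] --> (1 : R).
  rewrite -[X in _ --> X]invr1; apply: cvgV; first exact: oner_neq0.
  rewrite -[X in _ --> X](expr1n _ #|~: J|); apply: cvg_exprn.
  rewrite -[X in _ --> X]sqrtr1; apply: cvg_sqrtr.
  rewrite -[X in _ --> X]subr0; apply: cvgB => //; exact: cvg_cst.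
have fE : \forall i \near F, (Num.sqrt (1 - (m i)%:R^-1) ^+ #|~: J|)^-1 *
    (Num.sqrt (N i)%:R ^+ #|~: J| *
    multinomial_collision (N i) (1 - norm1 (y i)) (mkseq (fun j => s j i) d)) =
    Num.sqrt (m i)%:R ^+ #|~: J| * W2 i.
  near=> i; have iS : simplex (y i) by near: i.
  have m1 : (1 < m i)%N by near: i; exact: (moo (nbhs_infty_gt 1)).
  have m0 : 0 < (m i)%:R :> R by rewrite ltr0n ltnW.
  have -> : multinomial_collision (N i) (1 - norm1 (y i)) (mkseq (fun j => s j i) d) = W2 i.
    rewrite sE /multinomial_collision size_coords; apply: eq_bigr => ks _.
    by rewrite point_weight_sum1 // expr1n divr1.
  rewrite mulrA; congr (_ * _).
  have -> : (N i)%:R = (m i)%:R * (1 - (m i)%:R^-1) :> R.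
    have -> : (N i)%:R = (m i)%:R - 1 :> R by near: i.
    by rewrite mulrBr mulr1 divff ?gt_eqF.
  rewrite sqrtrM ?(ltW m0) // exprMn mulrCA mulVf ?mulr1 //.
  rewrite expf_neq0 // sqrtr_eq0 -ltNge subr_gt0 invf_lt1 //.
  by rewrite ltr1n.
have H2 : (Num.sqrt (1 - (m i)%:R^-1) ^+ #|~: J|)^-1 *
    (Num.sqrt (N i)%:R ^+ #|~: J| *
    multinomial_collision (N i) (1 - norm1 (y i)) (mkseq (fun j => s j i) d)) @[i --> F] -->
    1 * (psi (~: J) xs * \prod_(j in J) poisson_collision (lams ord0 j)).
  exact: cvgM.
by rewrite mul1r in H2; exact: cvg_trans (near_eq_cvg fE) H2.
Unshelve. all: by end_near. Qed.

(** The exponents match because m^d = sqrt m ^ |~: J| * sqrt m ^ (d + |J|); the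
    square of the mean is bounded and d + |J| > 0. *)
Lemma cvg_variance : (0 < d)%N ->
  (bernstein_second_moment f (m i) (y i) - bernstein_mean f (m i) (y i) ^+ 2) /
    (m i)%:R `^ ((d + #|J|)%:R / 2) @[i --> F] -->
  fext xs * (psi (~: J) xs * \prod_(j in J) poisson_collision (lams ord0 j)).
Proof.
move=> d_gt0; pose sq i : R := Num.sqrt (m i)%:R.
have fE : \forall i \near F, sq i ^+ #|~: J| *
      (bernstein_second_moment f (m i) (y i) / (m i)%:R ^+ d) -
    bernstein_mean f (m i) (y i) ^+ 2 * Num.sqrt ((m i)%:R^-1) ^+ (d + #|J|) =
    (bernstein_second_moment f (m i) (y i) - bernstein_mean f (m i) (y i) ^+ 2) /
    (m i)%:R `^ ((d + #|J|)%:R / 2).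
  near=> i; have m0 : (0 < m i)%N by near: i; exact: (moo (nbhs_infty_gt 0)).
  have m0R : 0 < (m i)%:R :> R by rewrite ltr0n.
  have s0 : sq i != 0 by rewrite sqrtr_eq0 -ltNge.
  have -> : (m i)%:R `^ ((d + #|J|)%:R / 2) = sq i ^+ (d + #|J|).
    by rewrite mulrC powRrM powR12_sqrt ?(ltW m0R) // powR_mulrn // sqrtr_ge0.
  have -> : (m i)%:R ^+ d = sq i ^+ #|~: J| * sq i ^+ (d + #|J|).
    rewrite -exprD (_ : (#|~: J| + (d + #|J|))%N = (2 * d)%N).
      by rewrite exprM sqr_sqrtr ?(ltW m0R).
    by rewrite addnCA [(#|~: J| + _)%N]addnC cardsC card_ord mul2n addnn.
  have -> : Num.sqrt ((m i)%:R^-1) = (sq i)^-1 by rewrite sqrtrV.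
  rewrite exprVn mulrBl; congr (_ - _).
  by rewrite invfM mulrCA mulVKf ?expf_neq0.
have H : sq i ^+ #|~: J| *
      (bernstein_second_moment f (m i) (y i) / (m i)%:R ^+ d) -
    bernstein_mean f (m i) (y i) ^+ 2 * Num.sqrt ((m i)%:R^-1) ^+ (d + #|J|) @[i --> F] -->
    fext xs * (psi (~: J) xs * \prod_(j in J) poisson_collision (lams ord0 j)) -
    fext xs ^+ 2 * (Num.sqrt 0) ^+ (d + #|J|).
  apply: cvgB; first by apply: cvg_second_moment; exact: cvg_point_weight2.
  apply: cvgM; first by apply: cvg_exprn; exact: cvg_mean.
  by apply: cvg_exprn; apply: cvg_sqrtr.
rewrite sqrtr0 expr0n addn_eq0 (gtn_eqF d_gt0) /= mulr0 subr0 in H.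
exact: cvg_trans (near_eq_cvg fE) H.
Unshelve. all: by end_near. Qed.

End Boundary.
End Along.
End Limits.

(** * Uniform expansion of the mean squared error *)

Section Errors.
Context {R : realType} {d : nat}.
Variables (f fext : 'rV[R]_d -> R) (J : {set 'I_d}).
Implicit Types (lam x : 'rV[R]_d).

Definition variance_error lam x (m : nat) : R :=
  let y := boundary_point J m lam x in
  (bernstein_second_moment f m y - bernstein_mean f m y ^+ 2) /
    m%:R `^ ((d + #|J|)%:R / 2) - vcoef f J lam x.

Definition bias_error lam x (m : nat) : R :=
  let y := boundary_point J m lam x in
  (bernstein_mean f m y - f y) ^+ 2 - (bcoef fext J x / m%:R) ^+ 2.

Lemma MSE_errors {disp : measure_display} {T : measurableType disp}
    (P : probability T R) (X : nat -> {RV P >-> d.-tuple R}) n m lam x :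
  iid_density X f -> (0 < n)%N -> (0 < m)%N ->
  MSE X f n m (boundary_point J m lam x) =
  (MSE_lead f fext J lam x n m%:R +
   n%:R^-1 * m%:R `^ ((d + #|J|)%:R / 2) * variance_error lam x m +
   bias_error lam x m)%:E.
Proof.
move=> iidX n0 m0; rewrite (@MSE_bernstein _ _ _ _ P X f) //; congr EFin.
have m0R : 0 < m%:R :> R by rewrite ltr0n.
have p0 : m%:R `^ ((d + #|J|)%:R / 2) != 0 :> R by rewrite gt_eqF // powR_gt0.
rewrite /MSE_lead /variance_error /bias_error exprMn exprVn.
set y := boundary_point J m lam x; move: p0.
move: (_ `^ _) (bernstein_second_moment f m y) (bernstein_mean f m y ^+ 2).
move: ((_ - f y) ^+ 2) (bcoef _ _ _ ^+ 2) (m%:R ^- 2) (n%:R^-1) (vcoef _ _ _ _).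
by move=> e b i j v p S E p0; field.
Qed.

(** Setting the coordinates in J to 0 removes the same terms as the indicators in
    bcoef. *)
Lemma bcoefE x : bcoef fext J x = bias_limit fext (zero_on J x).
Proof.
set z := zero_on J x; have zE j : z ord0 j = if j \in J then 0 else x ord0 j.
  by rewrite mxE.
rewrite /bcoef /bias_limit -/z; congr (_ + _).
  apply: eq_bigr => j _; rewrite mulrC zE; congr (_ * (_ - _)).
  by case: (j \in J); rewrite ?mulr0 ?mulr1.
rewrite mulr_sumr exchange_big /= big_mkcond /=.
rewrite [RHS](eq_bigr (fun j => \sum_(i | true) 2^-1 *
  (partial i (partial j fext) z * ((j == i)%:R * z ord0 j - z ord0 j * z ord0 i)))); last first.
  by move=> j _; rewrite mulr_sumr.
apply: eq_bigr => j _; case: ifPn => [jJ|]; last first.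
  rewrite negbK => jJ; rewrite big1 // => i _.
  by rewrite zE jJ !mul0r mulr0 subr0 !mulr0.
rewrite [LHS]big_mkcond /=; apply: eq_bigr => i _.
rewrite !zE (negPf jJ) eq_sym; case: ifPn => [iJ|].
  rewrite (negPf iJ); case: eqVneq => [->|_]; rewrite ?mul1r ?mulr1 ?mul0r ?mulr0 ?mulrA //.
    by ring.
  by ring.
rewrite negbK => iJ; rewrite iJ mulr0 subr0; case: eqVneq => [ij|_].
  by rewrite ij iJ in jJ.
by rewrite mul0r !mulr0.
Qed.

Lemma vcoefE lam x : vcoef f J lam x = f (zero_on J x) *
  (psi (~: J) x * \prod_(j in J) poisson_collision (lam ord0 j)).
Proof. by rewrite /vcoef -mulrA. Qed.

Lemma psiE (A : {set 'I_d}) x : (forall j, j \in A -> 0 <= x ord0 j) ->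
  \sum_(j in A) x ord0 j <= 1 ->
  psi A x = (Num.sqrt ((4 * pi) ^+ #|A| * (1 - \sum_(j in A) x ord0 j) *
    \prod_(j in A) x ord0 j))^-1.
Proof.
move=> x0 x1; rewrite /psi powRN powR12_sqrt // !mulr_ge0 ?subr_ge0 //.
  by rewrite exprn_ge0 // mulr_ge0 // pi_ge0.
exact: prodr_ge0.
Qed.

Lemma admissible_zero_on lam x : admissible J lam x -> simplex (zero_on J x).
Proof.
case=> _ x01 x1; have z0 j : 0 <= zero_on J x ord0 j.
  by rewrite mxE; case: ifPn => // /x01/andP[/ltW].
split => [j|]; first by rewrite mxE; case: ifPn => [|/x01/andP[/ltW-> /ltW->]]; rewrite ?lexx ?ler01.
apply: le_trans (ltW x1); rewrite le_eqVlt; apply/orP; left; apply/eqP.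
rewrite [RHS]big_mkcond; apply: eq_bigr => j _.
by rewrite ger0_norm // mxE; case: (j \in J).
Qed.

End Errors.

Lemma cvg_comp_poisson_collision {R : realType} {I : Type} (F : set_system I) {FF : Filter F}
    (u : I -> R) (l : R) : (\forall i \near F, 0 <= u i) -> 0 <= l -> u @ F --> l ->
  poisson_collision (u i) @[i --> F] --> poisson_collision l.
Proof.
move=> u0 l0 ul; apply/cvgrPdist_le => /= e e0.
have e2 : 0 < e / 2 by rewrite divr_gt0.
near=> i; apply: le_trans (poisson_collision_dist l0 _) _; first by near: i.
have : `|l - u i| <= e / 2 by near: i; move/cvgrPdist_le : ul; exact.
by lra.
Unshelve. all: by end_near. Qed.

Lemma cvg_big_prod (R : realType) (I : Type) (F : set_system I) {FF : Filter F}
    (K : Type) (r : seq K) (P : pred K) (g : K -> I -> R) (l : K -> R) :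
  (forall j, P j -> g j @ F --> l j) ->
  \prod_(j <- r | P j) g j i @[i --> F] --> \prod_(j <- r | P j) l j.
Proof. by move=> gl; apply: cvg_big => //; exact: mul_continuous. Qed.

Definition lam_bounded {R : realType} {d} (J : {set 'I_d}) (K : nat) (lam : 'rV[R]_d) : Prop :=
  forall j, j \in J -> lam ord0 j <= K%:R.

Definition x_bounded {R : realType} {d} (J : {set 'I_d}) (K : nat) (x : 'rV[R]_d) : Prop :=
  (forall j, j \notin J -> K.+1%:R^-1 <= x ord0 j) /\
  \sum_(j | j \notin J) x ord0 j <= 1 - K.+1%:R^-1.

Section Uniform.
Context {R : realType} {d : nat}.
Variables (f fext : 'rV[R]_d -> R) (U : set 'rV[R]_d) (M : R) (J : {set 'I_d}).
Hypotheses (d_gt0 : (0 < d)%N) (U_open : open U) (simplex_U : simplex `<=` U).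
Hypothesis fext_f : forall x, simplex x -> fext x = f x.
Hypothesis fext_C2 : C2_on U fext.
Hypothesis fM : forall x, `|f x| <= M.

Lemma cvg_errors (G : set_system nat) {FG : ProperFilter G} (m : nat -> nat)
    (lam x : nat -> 'rV[R]_d) (lams xs : 'rV[R]_d) :
  m @ G --> \oo -> (forall i, admissible J (lam i) (x i)) ->
  (forall i, simplex (boundary_point J (m i) (lam i) (x i))) ->
  (forall j, j \in J -> lam i ord0 j @[i --> G] --> lams ord0 j) ->
  (forall j, j \notin J -> x i ord0 j @[i --> G] --> xs ord0 j) ->
  (forall j, j \in J -> 0 <= lams ord0 j) -> (forall j, j \in J -> xs ord0 j = 0) ->
  (forall j, j \notin J -> 0 < xs ord0 j) -> simplex xs -> norm1 xs < 1 ->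
  variance_error f J (lam i) (x i) (m i) @[i --> G] --> 0 /\
  (m i)%:R ^+ 2 * bias_error f fext J (lam i) (x i) (m i) @[i --> G] --> 0.
Proof.
move=> moo adm yS lam_lim x_lim lams0 xsJ xs0 xsS xs1.
pose y i := boundary_point J (m i) (lam i) (x i).
have mV : ((m i)%:R^-1 : R) @[i --> G] --> (0 : R) by exact: cvg_natr_inv.
have yx j : y i ord0 j @[i --> G] --> xs ord0 j.
  have [jJ|jJ] := boolP (j \in J).
    rewrite (_ : (fun i => _) = (fun i => lam i ord0 j * (m i)%:R^-1)); last first.
      by apply/funext => i; rewrite mxE jJ.
    by rewrite xsJ // -(mulr0 (lams ord0 j)); apply: cvgM => //; exact: lam_lim.
  rewrite (_ : (fun i => _) = (fun i => x i ord0 j)); first exact: x_lim.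
  by apply/funext => i; rewrite mxE (negPf jJ).
have zx j : zero_on J (x i) ord0 j @[i --> G] --> xs ord0 j.
  have [jJ|jJ] := boolP (j \in J).
    rewrite (_ : (fun i => _) = cst 0); first by rewrite xsJ //; exact: cvg_cst.
    by apply/funext => i; rewrite mxE jJ.
  rewrite (_ : (fun i => _) = (fun i => x i ord0 j)); first exact: x_lim.
  by apply/funext => i; rewrite mxE (negPf jJ).
have m_gt0 : \forall i \near G, (0 < m i)%N.
  by near=> i; near: i; exact: (moo _ (nbhs_infty_gt 0)).
have y_lams j : j \in J -> (m i)%:R * y i ord0 j @[i --> G] --> lams ord0 j.
  move=> jJ; have fE : \forall i \near G, lam i ord0 j = (m i)%:R * y i ord0 j.
    near=> i; rewrite mxE jJ mulrC divfK // pnatr_eq0 -lt0n; by near: i.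
  exact: cvg_trans (near_eq_cvg fE) (lam_lim j jJ).
have yS' : \forall i \near G, simplex (y i) by near=> i; exact: yS.
have b_lim : bcoef fext J (x i) @[i --> G] --> bias_limit fext xs.
  rewrite (_ : (fun i => _) = (fun i => bias_limit fext (zero_on J (x i)))).
    exact: (cvg_bias_limit simplex_U fext_C2 xsS zx).
  by apply/funext => i; exact: bcoefE.
split.
  rewrite -(subrr (fext xs * (psi (~: J) xs * \prod_(j in J) poisson_collision (lams ord0 j)))).
  apply: cvgB.
    exact: (cvg_variance U_open simplex_U fext_f fext_C2 fM moo yS' xsS xs1 yx xsJ xs0
      lams0 y_lams d_gt0).
  rewrite (_ : (fun i => _) = (fun i => fext (zero_on J (x i)) * (psi (~: J) (x i) *
     \prod_(j in J) poisson_collision (lam i ord0 j)))); last first.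
    apply/funext => i; rewrite vcoefE fext_f //.
    exact: admissible_zero_on (adm i).
  apply: cvgM; first exact: (cvg_fext simplex_U fext_C2 xsS zx).
  apply: cvgM; last first.
    apply: cvg_big_prod => j jJ; apply: cvg_comp_poisson_collision.
    - by near=> i; have [+ _ _] := adm i; exact.
    - exact: lams0.
    - exact: lam_lim.
  have xs_sum : \sum_(j in ~: J) xs ord0 j = norm1 xs.
    rewrite norm1_simplex // [LHS]big_mkcond; apply: eq_bigr => j _.
    by rewrite inE; case: ifPn => //; rewrite negbK => /xsJ.
  have xCJ j : j \in ~: J -> x i ord0 j @[i --> G] --> xs ord0 j.
    by rewrite inE; exact: x_lim.
  rewrite (psiE (x := xs)); last 2 first.
  - by move=> j; rewrite inE => /xs0/ltW.
  - by rewrite xs_sum ltW.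
  rewrite (_ : (fun i => _) = (fun i => (Num.sqrt ((4 * pi) ^+ #|~: J| *
      (1 - \sum_(j in ~: J) x i ord0 j) * \prod_(j in ~: J) x i ord0 j))^-1)); last first.
    apply/funext => i; have [_ xi01 xi1] := adm i; apply: psiE.
      by move=> j; rewrite inE => /xi01/andP[/ltW].
    by apply: le_trans (ltW xi1); rewrite le_eqVlt; apply/orP; left; apply/eqP;
       apply: eq_bigl => j; rewrite inE.
  apply: cvgV.
    rewrite sqrtr_eq0 -ltNge !mulr_gt0 ?exprn_gt0 ?mulr_gt0 ?pi_gt0 //.
      by rewrite xs_sum subr_gt0.
    by apply: prodr_gt0 => j; rewrite inE => /xs0.
  apply: cvg_sqrtr; apply: cvgM; last exact: cvg_big_prod.
  apply: cvgM; first exact: cvg_cst.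
  by apply: cvgB; [exact: cvg_cst|exact: cvg_big_sum].
pose A i := (m i)%:R * (bernstein_mean f (m i) (y i) - f (y i)).
have A_lim : A i @[i --> G] --> bias_limit fext xs.
  exact: (cvg_bias U_open simplex_U fext_f fext_C2 fM moo yS' xsS xs1 yx).
have fE : \forall i \near G, A i ^+ 2 - bcoef fext J (x i) ^+ 2 =
    (m i)%:R ^+ 2 * bias_error f fext J (lam i) (x i) (m i).
  near=> i; have : (m i)%:R != 0 :> R by rewrite pnatr_eq0 -lt0n; near: i.
  rewrite /bias_error -/(y i) /A.
  move: (bernstein_mean _ _ _) (f _) (bcoef _ _ _) ((m i)%:R : R) => a b c k k0.
  by field.
have H : A i ^+ 2 - bcoef fext J (x i) ^+ 2 @[i --> G] -->
    bias_limit fext xs ^+ 2 - bias_limit fext xs ^+ 2.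
  by apply: cvgB; exact: cvg_exprn.
by rewrite subrr in H; exact: cvg_trans (near_eq_cvg fE) H.
Unshelve. all: by end_near. Qed.

(** A failure of uniformity gives a sequence of parameters with m to infinity;
    along an ultrafilter all their coordinates converge, to an admissible
    limit since the bounds defined by K are closed, which contradicts
    cvg_errors. *)
Lemma uniform_errors (K : nat) (e : R) : 0 < e ->
  exists m0, forall m lam x, (m0 <= m)%N -> admissible J lam x ->
    lam_bounded J K lam -> x_bounded J K x -> simplex (boundary_point J m lam x) ->
    `|variance_error f J lam x m| <= e /\
    m%:R ^+ 2 * `|bias_error f fext J lam x m| <= e.
Proof.
move=> e0; apply: contrapT => neg.
pose good (p : nat * 'rV[R]_d * 'rV[R]_d) :=
  `|variance_error f J p.1.2 p.2 p.1.1| <= e /\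
  p.1.1%:R ^+ 2 * `|bias_error f fext J p.1.2 p.2 p.1.1| <= e.
pose par (p : nat * 'rV[R]_d * 'rV[R]_d) := [/\ admissible J p.1.2 p.2,
  lam_bounded J K p.1.2, x_bounded J K p.2 & simplex (boundary_point J p.1.1 p.1.2 p.2)].
have bad n : exists p, [/\ (n <= p.1.1)%N, par p & ~ good p].
  apply: contrapT => nbad; apply: neg; exists n => m lam x nm ad lb xb yS.
  by apply: contrapT => ng; apply: nbad; exists (m, lam, x); split.
have [p pP] := choice bad.
have [G [GU ooG]] := ultraFilterLemma (eventually_filter).
have GP : ProperFilter G by exact: ultra_proper.
pose m i := (p i).1.1; pose lam i := (p i).1.2; pose x i := (p i).2.
have par_p i : par (p i) by have [] := pP i.
have moo : m @ G --> \oo.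
  move=> A [n _ nA]; apply: ooG; exists n => // i /= ni; apply: nA => /=.
  by apply: leq_trans ni _; have [] := pP i.
have K1 : 0 < K.+1%:R^-1 :> R by rewrite invr_gt0.
have lam_ex j : exists l : R, j \in J -> 0 <= l /\ lam i ord0 j @[i --> G] --> l.
  have [jJ|] := boolP (j \in J); last by exists 0.
  have [|l /andP[l0 _] lim] := @ultra_cvg_segment R nat G (fun i => lam i ord0 j) 0 K%:R GU.
    near=> i; have [[+ _ _] + _ _] := par_p i.
    by move=> /(_ j jJ) -> /(_ j jJ) ->.
  by exists l.
have x_ex j : exists l : R, j \notin J -> K.+1%:R^-1 <= l <= 1 /\ x i ord0 j @[i --> G] --> l.
  have [jJ|] := boolP (j \notin J); last by exists 0.
  have [|l l01 lim] := @ultra_cvg_segment R nat G (fun i => x i ord0 j) K.+1%:R^-1 1 GU.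
    near=> i; have [[_ + _] _ [+ _] _] := par_p i.
    by move=> /(_ j jJ)/andP[_ /ltW ->] /(_ j jJ) ->.
  by exists l.
have [l lP] := choice lam_ex; have [l' l'P] := choice x_ex.
pose lams : 'rV[R]_d := \row_j l j; pose xs : 'rV[R]_d := \row_j (if j \in J then 0 else l' j).
have xsJ j : j \in J -> xs ord0 j = 0 by move=> jJ; rewrite mxE jJ.
have xsE j : j \notin J -> xs ord0 j = l' j by move=> jJ; rewrite mxE (negPf jJ).
have x_lim j : j \notin J -> x i ord0 j @[i --> G] --> xs ord0 j.
  by move=> jJ; rewrite xsE //; have [] := l'P j jJ.
have xs0 j : j \notin J -> 0 < xs ord0 j.
  by move=> jJ; rewrite xsE //; have [/andP[+ _] _] := l'P j jJ; exact: lt_le_trans.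
have xs_ge0 j : 0 <= xs ord0 j.
  by have [/xsJ ->|/xs0/ltW] := boolP (j \in J).
have norm_xs : norm1 xs = \sum_(j | j \notin J) xs ord0 j.
  rewrite [RHS]big_mkcond; apply: eq_bigr => j _; rewrite ger0_norm //.
  by case: ifPn => //; rewrite negbK => /xsJ.
have sum_lim : \sum_(j | j \notin J) x i ord0 j @[i --> G] --> norm1 xs.
  by rewrite norm_xs; apply: cvg_big_sum.
have norm_le : norm1 xs <= 1 - K.+1%:R^-1.
  have [|s /andP[_ s1] s_lim] := @ultra_cvg_segment R nat G
      (fun i => \sum_(j | j \notin J) x i ord0 j) 0 (1 - K.+1%:R^-1) GU.
    near=> i; have [[_ x01 _] _ [_ x1] _] := par_p i; rewrite x1 andbT.
    by apply: sumr_ge0 => j /x01/andP[/ltW].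
  by rewrite (cvg_unique _ sum_lim s_lim).
have xs1 : norm1 xs < 1 by apply: le_lt_trans norm_le _; rewrite ltrBlDr ltrDl.
have xsS : simplex xs.
  split => [j|]; last exact: ltW.
  rewrite xs_ge0 /=; have [/xsJ ->|jJ] := boolP (j \in J); first exact: ler01.
  by rewrite xsE //; have [/andP[]] := l'P j jJ.
have [|||||||||Vlim Blim] := @cvg_errors G GP m lam x lams xs moo.
- by move=> i; have [] := par_p i.
- by move=> i; have [] := par_p i.
- by move=> j jJ; rewrite mxE; have [] := lP j jJ.
- exact: x_lim.
- by move=> j jJ; rewrite mxE; have [] := lP j jJ.
- exact: xsJ.
- exact: xs0.
- exact: xsS.
- exact: xs1.
have nearV : \forall i \near G, `|variance_error f J (lam i) (x i) (m i)| <= e.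
  by move/cvgr0Pnorm_le : Vlim; exact.
have nearB : \forall i \near G,
    `|(m i)%:R ^+ 2 * bias_error f fext J (lam i) (x i) (m i)| <= e.
  by move/cvgr0Pnorm_le : Blim; exact.
have [i [Vi Bi]] := filter_ex (filterI nearV nearB).
have [_ _] := pP i; apply; split => //.
by move: Bi; rewrite normrM ger0_norm // exprn_ge0.
Unshelve. all: by end_near. Qed.

End Uniform.

(** * Rates at the vertex of the simplex *)

Lemma prod_dist {R : realType} (I : Type) (r : seq I) (a b : I -> R) :
  (forall i, 0 <= a i <= 1) -> (forall i, 0 <= b i <= 1) ->
  `|\prod_(i <- r) a i - \prod_(i <- r) b i| <= \sum_(i <- r) `|a i - b i|.
Proof.
move=> a01 b01; elim: r => [|i r IH]; first by rewrite !big_nil subrr normr0.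
rewrite !big_cons.
have -> : a i * \prod_(j <- r) a j - b i * \prod_(j <- r) b j =
  a i * (\prod_(j <- r) a j - \prod_(j <- r) b j) + (a i - b i) * \prod_(j <- r) b j by ring.
apply: le_trans (ler_normD _ _) _; rewrite addrC !normrM; apply: lerD.
  rewrite -[leRHS]mulr1 ler_wpM2l // ger0_norm; last first.
    by apply: prodr_ge0 => j _; case/andP: (b01 j).
  elim: r {IH} => [|j r IHr]; first by rewrite big_nil.
  rewrite big_cons; have /andP[b0 b1] := b01 j; apply: mulr_ile1 => //.
  by apply: prodr_ge0 => k _; case/andP: (b01 k).
apply: le_trans IH; rewrite -[leRHS]mul1r ler_wpM2r //.
by have /andP[a0 a1] := a01 i; rewrite ger0_norm.
Qed.

Section Full.
Context {R : realType} {d : nat}.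
Variables (f fext : 'rV[R]_d -> R) (U : set 'rV[R]_d) (M : R) (lam : 'rV[R]_d).
Hypotheses (d_gt0 : (0 < d)%N) (U_open : open U) (simplex_U : simplex `<=` U).
Hypothesis fext_f : forall x, simplex x -> fext x = f x.
Hypothesis fext_C2 : C2_on U fext.
Hypothesis fM : forall x, `|f x| <= M.
Hypothesis lam_ge0 : forall j, 0 <= lam ord0 j.

Let y (m : nat) : 'rV[R]_d := \row_j (lam ord0 j / m%:R).
Let Lam : R := \sum_j lam ord0 j.
Let Lam0 : 0 <= Lam. Proof. exact: sumr_ge0. Qed.
Let lam_le j : lam ord0 j <= Lam.
Proof. by rewrite /Lam (bigD1 j) //= lerDl; apply: sumr_ge0. Qed.
Let zS : simplex (0 : 'rV[R]_d).
Proof.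
split => [j|]; first by rewrite mxE lexx ler01.
by rewrite /norm1 big1 // => j _; rewrite mxE normr0.
Qed.
Let norm0 : norm1 (0 : 'rV[R]_d) < 1.
Proof. by rewrite /norm1 big1 // => j _; rewrite mxE normr0. Qed.
Let U0 : U 0. Proof. exact: simplex_U. Qed.

Let y_lim j : y m ord0 j @[m --> \oo] --> (0 : 'rV[R]_d) ord0 j.
Proof.
rewrite mxE (_ : (fun m => _) = (fun m => lam ord0 j * m%:R^-1)); last first.
  by apply/funext => m; rewrite mxE.
rewrite -[X in _ --> X](mulr0 (lam ord0 j)); apply: cvgM; first exact: cvg_cst.
exact: (@cvg_natr_inv R nat \oo _ id).
Qed.

Let yS : \forall m \near \oo, simplex (y m).
Proof.
have lim : \sum_j y m ord0 j @[m --> \oo] --> \sum_(j < d) (0 : 'rV[R]_d) ord0 j.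
  by apply: cvg_big_sum.
rewrite [X in _ --> X]big1 in lim; last by move=> j _; rewrite mxE.
have near1 : \forall m \near \oo, \sum_j y m ord0 j < 1 by move/cvgr_lt : lim; exact.
near=> m; have y0 j : 0 <= y m ord0 j by rewrite mxE divr_ge0.
have y1 : \sum_j y m ord0 j <= 1 by rewrite ltW //; near: m.
split => [j|]; last by apply: le_trans y1; apply: ler_sum => j _; rewrite ger0_norm.
by rewrite y0 (le_trans _ y1) // (bigD1 j) //= lerDl sumr_ge0.
Unshelve. all: by end_near. Qed.

Let near_full (r : R) : 0 < r -> exists2 delta : R, 0 < delta <= 2 &
  \forall m \near \oo, [/\ (0 < m)%N, simplex (y m), 1 <= delta * m%:R,
    2 * d%:R * delta <= 1 - norm1 (y m) &
    (forall j, `|y m ord0 j - (0 : 'rV[R]_d) ord0 j| < r) /\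
    forall u : 'rV[R]_d, (forall j, `|u ord0 j - y m ord0 j| <= 2 * delta) ->
      forall j, `|u ord0 j - (0 : 'rV[R]_d) ord0 j| < r].
Proof. by move=> r0; apply: (near_delta (m := id) _ yS norm0 y_lim r0). Qed.

Let near_tail (delta : R) (C : nat) : 0 < delta <= 2 -> \forall m \near \oo,
  d%:R * (2 * expR (- (m.-1%:R * delta ^+ 2 / 8))) <= (m%:R ^+ C)^-1.
Proof.
case/andP => delta0 _; have lim := cvg_tail d C delta0.
have lt1 : \forall m \near \oo,
    m%:R ^+ C * (d%:R * (2 * expR (- (m.-1%:R * delta ^+ 2 / 8)))) < 1.
  by move/cvgr_lt : lim; apply; exact: ltr01.
near=> m; have m0 : 0 < m%:R :> R by rewrite ltr0n; near: m; exact: nbhs_infty_gt.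
rewrite -(ler_pM2l (exprn_gt0 C m0)) mulfV ?expf_neq0 ?gt_eqF // ltW //.
by near: m.
Unshelve. all: by end_near. Qed.

(** The points y m lie on the half line through lam, so the mean value theorem
    along this line applies, with locally bounded second derivatives. *)
Let partial_dist j : exists2 C : R, 0 <= C & \forall m \near \oo,
  `|partial j fext (y m) - partial j fext 0| <= C / m%:R.
Proof.
pose D k z := partial k (partial j fext) z.
have [_ /(_ j)[_ _ cD]] := fext_C2 U0.
have Unear : \forall z \near (0 : 'rV[R]_d), U z by apply: open_nbhs_nbhs.
have Dnear : \forall z \near (0 : 'rV[R]_d), forall k, `|D k z - D k 0| <= 1.
  suff Q k : \forall z \near (0 : 'rV[R]_d), `|D k z - D k 0| <= 1.
    exact: (filter_forall (nbhs_filter (0 : 'rV[R]_d)) Q).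
  by have [_] := cD k; move/cvgrPdistC_le => /(_ _ ltr01).
have [r r0 rP] := near_coords (filterI Unear Dnear).
have Q : \forall m \near \oo, forall k, `|y m ord0 k - (0 : 'rV[R]_d) ord0 k| < r.
  suff Q k : \forall m \near \oo, `|y m ord0 k - (0 : 'rV[R]_d) ord0 k| < r.
    exact: (filter_forall eventually_filter Q).
  by move/cvgrPdistC_lt : (@y_lim k); exact.
exists (\sum_k lam ord0 k * (`|D k 0| + 1)).
  by apply: sumr_ge0 => k _; rewrite mulr_ge0 // addr_ge0.
near=> m; have m0 : 0 < m%:R :> R by rewrite ltr0n; near: m; exact: nbhs_infty_gt.
have yr : forall k, `|y m ord0 k - (0 : 'rV[R]_d) ord0 k| < r by near: m.
have ball_s (s : R) : `|s| <= `|m%:R^-1| ->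
    U (s *: lam + 0) /\ forall k, `|D k (s *: lam + 0) - D k 0| <= 1.
  move=> sm; apply: rP => k; apply: le_lt_trans (yr k).
  rewrite !mxE addr0 !subr0 !normrM [`|lam _ _| * _]mulrC.
  by rewrite ler_wpM2r.
have derD (s : R) : `|s| <= `|m%:R^-1| -> is_derive (s *: lam + 0) lam (partial j fext)
    (\sum_k lam ord0 k * D k (s *: lam + 0)).
  move=> /ball_s[Us _]; have nearU : \forall z \near s *: lam + 0, U z.
    by apply: open_nbhs_nbhs.
  apply: is_derive_partial => k.
    by apply: filterS nearU => z /fext_C2[_ /(_ j)[_ _ /(_ k)[]]].
  by have [_ /(_ j)[_ _ /(_ k)[]]] := fext_C2 Us.
have [s sm] := @line_MVT R _ (partial j fext) 0 lam m%:R^-1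
  (fun s sm => let: DeriveDef ds _ := derD s sm in ds).
have yE : y m = m%:R^-1 *: lam + 0 by apply/rowP => k; rewrite !mxE addr0 mulrC.
rewrite -yE => ->; have [_ Ds] := derD s sm; rewrite Ds normrM ger0_norm ?invr_ge0 ?(ltW m0) //.
rewrite mulrC ler_wpM2r ?invr_ge0 ?(ltW m0) //.
apply: le_trans (ler_norm_sum _ _ _) _; apply: ler_sum => k _.
rewrite normrM (ger0_norm (lam_ge0 k)) ler_wpM2l //.
have [_ /(_ k) close] := ball_s s sm.
have := ler_normD (D k (s *: lam + 0) - D k 0) (D k 0); rewrite subrK => /le_trans; apply.
by rewrite addrC lerD2l.
Unshelve. all: by end_near. Qed.

(** Coordinates are nonnegative on the simplex, so norm1 u is the sum of the u j;
    quadratic terms are absorbed since the coordinates are at most 1. *)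
Lemma lipschitz_origin : exists2 L : R, 0 <= L & exists2 r : R, 0 < r &
  forall u, simplex u -> (forall j, `|u ord0 j - (0 : 'rV[R]_d) ord0 j| < r) ->
  `|f u - f 0| <= L * \sum_j u ord0 j.
Proof.
have [r r0 rP] := taylor_local U_open fext_C2 U0 ltr01.
have [B B0 HB] := sum_norm2_bound (fun i j => partial j (partial i fext) (0 : 'rV[R]_d)).
pose G : R := \sum_j `|partial j fext (0 : 'rV[R]_d)|.
have G0 : 0 <= G by apply: sumr_ge0 => j _; exact: normr_ge0.
exists (G + 2^-1 * (B * d%:R) + 1).
  by rewrite !addr_ge0 // !mulr_ge0.
exists r => // u uS ur; have u0 j : 0 <= u ord0 j := simplex_ge0 j uS.
have u1 j : u ord0 j <= 1 := simplex_le1 j uS.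
have z0 j : (0 : 'rV[R]_d) ord0 j = 0 by rewrite mxE.
have zr i : `|(0 : 'rV[R]_d) ord0 i - (0 : 'rV[R]_d) ord0 i| < r by rewrite subrr normr0.
have := rP 0 u zr ur.
under [X in fext 0 + X + _]eq_bigr do rewrite z0 subr0.
under [X in 2^-1 * X]eq_bigr do under eq_bigr do rewrite !z0 !subr0.
under [X in _ <= 1 * X]eq_bigr do rewrite z0 subr0.
rewrite mul1r (fext_f zS) (fext_f uS).
set A := \sum_i partial i fext 0 * u ord0 i.
set Q := \sum_i \sum_j _ => bound.
pose S : R := \sum_j u ord0 j.
have S0 : 0 <= S by apply: sumr_ge0.
have A_le : `|A| <= G * S.
  apply: le_trans (ler_norm_sum _ _ _) _; rewrite /S mulr_sumr; apply: ler_sum => j _.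
  rewrite normrM (ger0_norm (u0 j)) ler_wpM2r //.
  exact: (le_sum_norm (fun j => partial j fext (0 : 'rV[R]_d))).
have Q_le : `|Q| <= B * d%:R * S.
  apply: le_trans (ler_norm_sum _ _ _) _; rewrite /S mulr_sumr; apply: ler_sum => i _.
  apply: le_trans (ler_norm_sum _ _ _) _.
  have -> : B * d%:R * u ord0 i = \sum_(j < d) (B * u ord0 i).
    by rewrite sumr_const card_ord -[RHS]mulr_natr mulrAC.
  apply: ler_sum => j _; rewrite normrM ler_pM // ger0_norm ?mulr_ge0 //.
  by rewrite -[leRHS]mulr1 ler_wpM2l.
have sq_le : \sum_j u ord0 j ^+ 2 <= S.
  by apply: ler_sum => j _; rewrite expr2 -[leRHS]mulr1 ler_wpM2l.
rewrite (_ : f u - f 0 = (f u - (f 0 + A + 2^-1 * Q)) + A + 2^-1 * Q); last by ring.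
apply: le_trans (ler_normD _ _) _; apply: le_trans (lerD (ler_normD _ _) (lexx _)) _.
rewrite normrM [`|2^-1|]ger0_norm //; move: bound A_le Q_le sq_le; rewrite -/S.
move: `|A| `|Q| (\sum_j u ord0 j ^+ 2) => a q s'; lra.
Qed.

Lemma cell_center_cov_le m j k : (0 < m)%N -> simplex (y m) ->
  `|cell_center_cov (y m) m j k| <= (4 * Lam + 2) / m%:R ^+ 2.
Proof.
move=> m0 ymS; have m1 : 1 <= m%:R :> R by rewrite ler1n.
have m0R : 0 < m%:R :> R by rewrite ltr0n.
have yj0 := simplex_ge0 j ymS; have yk0 := simplex_ge0 k ymS.
have yj1 := simplex_le1 j ymS; have yk1 := simplex_le1 k ymS.
have my : m%:R * y m ord0 j = lam ord0 j by rewrite mxE mulrC divfK // gt_eqF.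
rewrite /cell_center_cov normrM [`|_^-1|]ger0_norm ?invr_ge0 ?exprn_ge0 ?(ltW m0R) //.
apply: ler_wpM2r; first by rewrite invr_ge0 exprn_ge0 // ltW.
have a_le := lam_le j; have a0 := lam_ge0 j; rewrite -my in a_le a0.
move: m1 yj0 yk0 yj1 yk1 a_le a0 Lam0; move: (y m ord0 j) (y m ord0 k) (m%:R) Lam.
move=> a b n L n1 a0 b0 a1 b1 nal na0 L0.
have p0 : 0 <= a * b by rewrite mulr_ge0.
have pa : a * b <= a by rewrite -[leRHS]mulr1 ler_wpM2l.
have np : n * (a * b) <= n * a by rewrite ler_wpM2l // (le_trans ler01).
have np0 : 0 <= n * (a * b) by rewrite mulr_ge0 // (le_trans ler01).
have anL : a <= L by apply: le_trans nal; rewrite -[leLHS]mul1r ler_wpM2r.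
rewrite ler_norml; case: (j == k); rewrite /= ?mulr1 ?mulr0 ?mul0r;
  by apply/andP; split; lra.
Qed.

(** All the second moments of the midpoints are of order m^-2 here, so that the
    second derivatives only enter the remainder. *)
Lemma mean_full : exists2 C : R, 0 <= C & \forall m \near \oo,
  `|bernstein_mean f m (y m) - f (y m) - bias_limit fext 0 / m%:R| <= C / m%:R ^+ 2.
Proof.
have [r r0 rP] := taylor_local U_open fext_C2 U0 ltr01.
pose H j k := partial k (partial j fext) (0 : 'rV[R]_d).
have [B B0 HB] := sum_norm2_bound H.
pose G0 : R := \sum_j `|partial j fext (0 : 'rV[R]_d)|.
have ex_C j : exists C : R, 0 <= C /\ \forall m \near \oo,
    `|partial j fext (y m) - partial j fext 0| <= C / m%:R.
  by have [C C0 CP] := partial_dist j; exists C.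
have [Cj CjP] := choice ex_C.
pose CG : R := \sum_j Cj j; pose G := G0 + CG.
have CG0 : 0 <= CG by apply: sumr_ge0 => j _; have [] := CjP j.
have Cj_le j : Cj j <= CG.
  rewrite /CG (bigD1 j) //= lerDl; apply: sumr_ge0 => k _; by have [] := CjP k.
have G00 : 0 <= G0 by apply: sumr_ge0 => j _; exact: normr_ge0.
have nearC : \forall m \near \oo, forall j, `|partial j fext (y m) - partial j fext 0| <= CG / m%:R.
  suff Q j : \forall m \near \oo, `|partial j fext (y m) - partial j fext 0| <= CG / m%:R.
    exact: (filter_forall eventually_filter Q).
  have [_] := CjP j; apply: filterS => m /le_trans; apply; exact: ler_wpM2r.
have [delta delta02 near_m] := near_full r0.
pose C1 : R := (2 + B * d%:R / 2) * (d%:R * (4 * Lam + 2)) +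
  (2 * d%:R + B * d%:R ^+ 2) / 4 + (2 * M + d%:R * G + d%:R ^+ 2 * B / 2).
pose C2 : R := B * d%:R ^+ 2 * (4 * Lam + 2) / 2.
pose C3 : R := d%:R * (CG / 2 + G * Lam).
have M0 : 0 <= M := le_trans (normr_ge0 _) (fM 0).
have L2 : 0 <= 4 * Lam + 2 by move: Lam0; lra.
have G0' : 0 <= G by exact: addr_ge0.
have C30 : 0 <= C3 by rewrite /C3 mulr_ge0 // addr_ge0 ?divr_ge0 // mulr_ge0.
have C20 : 0 <= C2 by rewrite /C2 divr_ge0 // !mulr_ge0 // exprn_ge0.
have C10 : 0 <= C1.
  have h1 : 0 <= (2 + B * d%:R / 2) * (d%:R * (4 * Lam + 2)).
    by rewrite !mulr_ge0 // addr_ge0 // !mulr_ge0.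
  have h2 : 0 <= (2 * d%:R + B * d%:R ^+ 2) / 4 by rewrite divr_ge0 // addr_ge0 // mulr_ge0 // exprn_ge0.
  have h3 : 0 <= 2 * M + d%:R * G + d%:R ^+ 2 * B / 2.
    by rewrite !addr_ge0 // !mulr_ge0 // exprn_ge0.
  exact: addr_ge0 (addr_ge0 h1 h2) h3.
exists (C1 + C2 + C3); first exact: addr_ge0 (addr_ge0 C10 C20) C30.
have D3 (p q s w : R) : (p + q + s) * w = p * w + q * w + s * w by rewrite !mulrDl.
have tail_le := near_tail 2 delta02.
near=> m; have [m0 ymS d1 d2 [yr ur]] : [/\ (0 < m)%N, simplex (y m), 1 <= delta * m%:R,
    2 * d%:R * delta <= 1 - norm1 (y m) &
    (forall j, `|y m ord0 j - (0 : 'rV[R]_d) ord0 j| < r) /\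
    forall u : 'rV[R]_d, (forall j, `|u ord0 j - y m ord0 j| <= 2 * delta) ->
      forall j, `|u ord0 j - (0 : 'rV[R]_d) ord0 j| < r] by near: m.
have m0R : 0 < m%:R :> R by rewrite ltr0n.
have m1 : m%:R^-1 <= 1 :> R by rewrite invf_le1 // ler1n.
have gd : forall j, `|partial j fext (y m) - partial j fext 0| <= CG / m%:R by near: m.
have gG j : `|partial j fext (y m)| <= G.
  have := ler_normD (partial j fext (y m) - partial j fext 0) (partial j fext 0).
  rewrite subrK => /le_trans; apply; rewrite addrC /G; apply: lerD.
    exact: (le_sum_norm (fun j => partial j fext (0 : 'rV[R]_d))).
  by apply: le_trans (gd j) _; rewrite -[leRHS]mulr1 ler_wpM2l.
have tail_m : d%:R * (2 * expR (- (m.-1%:R * delta ^+ 2 / 8))) <= (m%:R ^+ 2)^-1 by near: m.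
have bound := @bernstein_bias_bound _ _ f m (y m) delta M m0 ymS delta02 d1 d2 fM
  (fun j => partial j fext (y m)) H G B 1 1 ler01 ltr01 gG HB
  (fun u uS uy => ltac:(by rewrite -!fext_f //; apply: rP => // j; exact: ur)).
have sumd (x : R) : \sum_(i < d) x = d%:R * x.
  by rewrite sumr_const card_ord mulr_natl.
have w0 : 0 <= (m%:R ^+ 2)^-1 :> R by rewrite invr_ge0 exprn_ge0 // ltW.
have cov_sum : \sum_j cell_center_cov (y m) m j j <= d%:R * (4 * Lam + 2) * (m%:R ^+ 2)^-1.
  rewrite -mulrA -sumd; apply: ler_sum => j _.
  exact: le_trans (ler_norm _) (cell_center_cov_le j j m0 ymS).
pose X := bernstein_mean f m (y m) - f (y m) -
  \sum_j partial j fext (y m) * ((2^-1 - y m ord0 j) / m%:R) -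
  2^-1 * \sum_j \sum_k H j k * cell_center_cov (y m) m j k.
have X_le : `|X| <= C1 * (m%:R ^+ 2)^-1.
  apply: le_trans bound _; rewrite /C1 [leRHS]D3; apply: lerD; [apply: lerD|].
  - rewrite !mulr1 -[leRHS]mulrA; apply: ler_wpM2l cov_sum.
    by rewrite addr_ge0 // !mulr_ge0.
  - rewrite invr1 le_eqVlt; apply/orP; left; apply/eqP; field.
    by rewrite gt_eqF.
  - by apply: ler_wpM2l tail_m; rewrite !addr_ge0 // !mulr_ge0 // exprn_ge0.
pose Y := 2^-1 * \sum_j \sum_k H j k * cell_center_cov (y m) m j k.
have Y_le : `|Y| <= C2 * (m%:R ^+ 2)^-1.
  rewrite /Y normrM [`|2^-1|]ger0_norm // /C2.
  rewrite (_ : _ / 2 / _ = 2^-1 * (d%:R * (d%:R * (B * ((4 * Lam + 2) / m%:R ^+ 2))))); last by ring.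
  apply: ler_wpM2l => //; rewrite -!sumd.
  apply: le_trans (ler_norm_sum _ _ _) _; apply: ler_sum => j _.
  apply: le_trans (ler_norm_sum _ _ _) _; apply: ler_sum => k _.
  by rewrite normrM ler_pM //; exact: cell_center_cov_le.
pose Z := \sum_j partial j fext (y m) * ((2^-1 - y m ord0 j) / m%:R) - bias_limit fext 0 / m%:R.
have Z_le : `|Z| <= C3 * (m%:R ^+ 2)^-1.
  rewrite /Z; have -> : bias_limit fext 0 / m%:R = \sum_j partial j fext 0 * (2^-1 / m%:R).
    rewrite /bias_limit [X in _ + X](_ : _ = 0).
      by rewrite addr0 mulr_suml; apply: eq_bigr => j _; rewrite mxE subr0 mulrA.
    rewrite big1 ?mulr0 // => j _; rewrite big1 // => k _.
    by rewrite !mxE mul0r mulr0 subr0 mulr0.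
  rewrite -sumrB /C3 -mulrA -sumd.
  apply: le_trans (ler_norm_sum _ _ _) _; apply: ler_sum => j _.
  rewrite (_ : _ - _ = (partial j fext (y m) - partial j fext 0) * (2^-1 / m%:R) -
     partial j fext (y m) * (lam ord0 j * (m%:R ^+ 2)^-1)); last first.
    by rewrite mxE; field; rewrite gt_eqF.
  apply: le_trans (ler_normB _ _) _; rewrite [leRHS]mulrDl; apply: lerD; rewrite normrM.
    rewrite [`|2^-1 / _|]ger0_norm ?divr_ge0 ?(ltW m0R) //.
    apply: le_trans (ler_wpM2r _ (gd j)) _; first by rewrite divr_ge0 // ltW.
    by rewrite le_eqVlt; apply/orP; left; apply/eqP; field; rewrite gt_eqF.
  rewrite [`|lam _ _ / _|]ger0_norm ?mulr_ge0 // mulrA.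
  by rewrite ler_wpM2r // ler_pM.
rewrite (_ : bernstein_mean _ _ _ - _ - _ = X + Y + Z); last first.
  by rewrite /X /Y /Z; ring.
apply: le_trans (ler_normD _ _) _; apply: le_trans (lerD (ler_normD _ _) (lexx _)) _.
by rewrite [leRHS]D3; exact: lerD (lerD X_le Y_le) Z_le.
Unshelve. all: by end_near. Qed.

(** Three errors of order 1 / m: f against f 0, the multinomial against the Poisson
    collision probability, and the parameter (m - 1) lam / m against lam. *)
Lemma second_moment_full : exists2 C : R, 0 <= C & \forall m \near \oo,
  `|bernstein_second_moment f m (y m) / m%:R ^+ d -
    f 0 * \prod_(j < d) poisson_collision (lam ord0 j)| <= C / m%:R.
Proof.
have [L L0 [r r0 Lr]] := lipschitz_origin.
have [delta delta02 near_m] := near_full r0.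
have M0 : 0 <= M := le_trans (normr_ge0 _) (fM 0).
pose C1 : R := L * Lam + L * (d%:R + 2 * Lam) + 2 * M.
pose C2 : R := M * (5 * Lam ^+ 2 + 2 * Lam).
have tail_le := near_tail 1 delta02.
have C10 : 0 <= C1 by rewrite !addr_ge0 // !mulr_ge0 // addr_ge0 // mulr_ge0.
have C20 : 0 <= C2 by rewrite mulr_ge0 // addr_ge0 // mulr_ge0 // exprn_ge0.
exists (C1 + C2); first exact: addr_ge0.
near=> m; have [m0 ymS d1 d2 [yr ur]] : [/\ (0 < m)%N, simplex (y m), 1 <= delta * m%:R,
    2 * d%:R * delta <= 1 - norm1 (y m) &
    (forall j, `|y m ord0 j - (0 : 'rV[R]_d) ord0 j| < r) /\
    forall u : 'rV[R]_d, (forall j, `|u ord0 j - y m ord0 j| <= 2 * delta) ->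
      forall j, `|u ord0 j - (0 : 'rV[R]_d) ord0 j| < r] by near: m.
have m0R : 0 < m%:R :> R by rewrite ltr0n.
have mV0 : 0 <= m%:R^-1 :> R by rewrite invr_ge0 ltW.
have tail_m : d%:R * (2 * expR (- (m.-1%:R * delta ^+ 2 / 8))) <= (m%:R ^+ 1)^-1 by near: m.
rewrite expr1 in tail_m.
have sum_y : \sum_j y m ord0 j = Lam / m%:R.
  by rewrite mulr_suml; apply: eq_bigr => j _; rewrite mxE.
have Lip u : simplex u -> (forall i, `|u ord0 i - y m ord0 i| <= 2 * delta) ->
    `|f u - f 0| <= L * Lam / m%:R + L * \sum_i `|u ord0 i - y m ord0 i|.
  move=> uS uy; apply: le_trans (Lr u uS (ur u uy)) _.
  rewrite -mulrA -sum_y -mulrDr ler_wpM2l // -big_split /=; apply: ler_sum => j _.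
  by rewrite -lerBlDl ler_norm.
have eps0 : 0 <= L * Lam / m%:R by rewrite !mulr_ge0.
have := @bernstein_second_moment_bound _ _ f m (y m) delta M m0 ymS delta02 d1 d2 fM
  (f 0) (L * Lam / m%:R) L eps0 L0 Lip.
set W2 := \sum_(ks <- _) _; set S2 := _ / m%:R ^+ d => bound.
have W2_ge0 : 0 <= W2 by apply: sumr_ge0 => ks _; exact: sqr_ge0.
have W2_le1 : W2 <= 1.
  rewrite -(point_weight_mass1 m.-1 ymS) /W2 big_seq [leRHS]big_seq; apply: ler_sum => ks ks_in.
  rewrite expr2 -[leRHS]mulr1 ler_wpM2l //; first exact: point_weight_ge0.
  exact: point_weight_le1.
have sumd (x : R) : \sum_(i < d) x = d%:R * x.
  by rewrite sumr_const card_ord mulr_natl.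
have D3 (p q s w : R) : (p + q + s) * w = p * w + q * w + s * w by rewrite !mulrDl.
have S2_le : `|S2 - f 0 * W2| <= C1 / m%:R.
  apply: le_trans bound _; rewrite /C1 [leRHS]D3; apply: lerD; [apply: lerD|].
  - by rewrite -[leRHS]mulr1 ler_wpM2l.
  - rewrite -mulrA; apply: ler_wpM2l => //.
    have -> : (d%:R + 2 * Lam) / m%:R = \sum_j (m%:R^-1 + 2 * (lam ord0 j / m%:R)).
      by rewrite big_split /= sumd -mulr_sumr -mulr_suml mulrDl mulrA.
    apply: ler_sum => j _.
    have y0 := simplex_ge0 j ymS.
    rewrite [y m ord0 j]mxE in y0 *.
    have yV : 0 <= lam ord0 j / m%:R * m%:R^-1 by rewrite mulr_ge0.
    have -> : (2 * m%:R)^-1 = m%:R^-1 / 2 :> R by rewrite invfM mulrC.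
    by move: yV mV0; rewrite mulrBl; move: (lam ord0 j / m%:R) => a; lra.
  - have f0M := fM 0; apply: le_trans (ler_wpM2l _ tail_m) _; first by rewrite addr_ge0.
    by apply: ler_wpM2r => //; move: f0M; lra.
have yj0 j := simplex_ge0 j ymS.
have W2_pc : `|W2 - \prod_(j < d) poisson_collision ((m.-1)%:R * y m ord0 j)| <=
    5 * Lam ^+ 2 / m%:R.
  have all0 : all (fun z => 0 <= z) (coords (y m)) by exact: coords_ge0.
  have le1 : \sum_(z <- coords (y m)) z <= 1.
    by rewrite sum_coords -norm1_simplex //; case: ymS.
  have := multinomial_collision_poisson m.-1 all0 le1.
  rewrite size_coords sum_coords -norm1_simplex // big_map big_enum /=.
  move=> /le_trans; apply; rewrite norm1_simplex // sum_y -mulrA ler_wpM2l //.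
  rewrite exprMn exprVn mulrCA ler_wpM2l ?exprn_ge0 //.
  rewrite expr2 invfM mulrA ler_piMl // ler_pdivrMr // mul1r ler_nat leq_pred //.
have pc_dist : `|\prod_(j < d) poisson_collision ((m.-1)%:R * y m ord0 j) -
    \prod_(j < d) poisson_collision (lam ord0 j)| <= 2 * Lam / m%:R.
  have pc01 (l : R) : 0 <= l -> 0 <= poisson_collision l <= 1.
    by move=> l0; rewrite poisson_collision_ge0 // poisson_collision_le1.
  apply: le_trans (@prod_dist R _ _ _ _ _ _) _.
  - by move=> j; apply: pc01; rewrite mulr_ge0.
  - by move=> j; exact: pc01.
  rewrite -mulrA -sum_y mulr_sumr; apply: ler_sum => j _.
  apply: le_trans (poisson_collision_dist _ (lam_ge0 j)) _; first by rewrite mulr_ge0.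
  apply: ler_wpM2l => //; rewrite -subn1 natrB // mulrBl mul1r.
  have -> : m%:R * y m ord0 j = lam ord0 j by rewrite mxE mulrC divfK // gt_eqF.
  by rewrite addrAC subrr add0r normrN ger0_norm.
set P := \prod_(j < d) poisson_collision (lam ord0 j).
rewrite (_ : S2 - f 0 * P = (S2 - f 0 * W2) + f 0 * (W2 - P)); last by ring.
apply: le_trans (ler_normD _ _) _; rewrite mulrDl lerD // normrM /C2 -mulrA.
apply: ler_pM => //; rewrite mulrDl.
apply: le_trans (ler_distD (\prod_(j < d) poisson_collision ((m.-1)%:R * y m ord0 j)) _ _) _.
exact: lerD.
Unshelve. all: by end_near. Qed.

Lemma full_errors : exists C : R, \forall m \near \oo, forall x,
  `|variance_error f [set: 'I_d] lam x m| <= C / m%:R /\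
  `|bias_error f fext [set: 'I_d] lam x m| <= C / m%:R ^+ 3.
Proof.
have [CV CV0 HV] := second_moment_full; have [CB CB0 HB] := mean_full.
have M0 : 0 <= M := le_trans (normr_ge0 _) (fM 0).
pose b := bias_limit fext 0.
pose C1 := CV + M ^+ 2; pose C2 := CB * (CB + 2 * `|b|).
have C10 : 0 <= C1 by rewrite addr_ge0 // exprn_ge0.
have C20 : 0 <= C2 by rewrite mulr_ge0 // addr_ge0 // mulr_ge0.
exists (C1 + C2); near=> m => x.
have m0 : (0 < m)%N by near: m; exact: nbhs_infty_gt.
have ymS : simplex (y m) by near: m.
have m0R : 0 < m%:R :> R by rewrite ltr0n.
have m1 : m%:R^-1 <= 1 :> R by rewrite invf_le1 // ler1n.
have mV0 : 0 <= m%:R^-1 :> R by rewrite invr_ge0 ltW.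
have bpE : boundary_point [set: 'I_d] m lam x = y m.
  by apply/rowP => j; rewrite !mxE inE.
have zE : zero_on [set: 'I_d] x = 0 by apply/rowP => j; rewrite !mxE inE.
split.
  rewrite /variance_error bpE vcoefE zE cardsT card_ord.
  have -> : psi (~: [set: 'I_d]) x = 1.
    rewrite finset.setCT psiE.
    - by rewrite cards0 expr0 !big_set0 subr0 !mulr1 sqrtr1 invr1.
    - by move=> j; rewrite inE.
    - by rewrite big_set0.
  have -> : m%:R `^ ((d + d)%:R / 2) = m%:R ^+ d :> R.
    by rewrite -powR_mulrn ?(ltW m0R) //; congr (_ `^ _); rewrite natrD; field.
  rewrite mul1r (eq_bigl xpredT); last by move=> j; rewrite inE.
  rewrite mulrBl addrAC; apply: le_trans (ler_normB _ _) _.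
  rewrite [leRHS](_ : _ = CV / m%:R + (M ^+ 2 + C2) / m%:R); last by rewrite /C1; ring.
  apply: lerD; first by near: m.
  apply: le_trans (_ : M ^+ 2 / m%:R <= _); last first.
    by rewrite mulrDl lerDl mulr_ge0.
  rewrite normrM; apply: ler_pM => //.
    have := bernstein_mean_bound m0 ymS fM.
    by rewrite normrX => ?; rewrite lerXn2r ?nnegrE.
  rewrite ger0_norm ?invr_ge0 ?exprn_ge0 ?(ltW m0R) // lef_pV2 ?posrE ?exprn_gt0 //.
  by rewrite -[leLHS]expr1 ler_weXn2l // ler1n.
rewrite /bias_error bpE bcoefE zE -/b.
have D_le : `|bernstein_mean f m (y m) - f (y m) - b / m%:R| <= CB / m%:R ^+ 2 by near: m.
move: D_le; move: (bernstein_mean _ _ _ - _) => e D_le.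
rewrite subr_sqr normrM; apply: le_trans (_ : (CB / m%:R ^+ 2) * ((CB + 2 * `|b|) / m%:R) <= _).
  apply: ler_pM => //; rewrite (_ : e + b / m%:R = (e - b / m%:R) + 2 * (b / m%:R)); last by ring.
  apply: le_trans (ler_normD _ _) _; rewrite [leRHS]mulrDl lerD //.
    apply: le_trans D_le _; rewrite ler_wpM2l // -exprVn expr2 -[leRHS]mulr1 ler_wpM2l //.
  by rewrite normrM [`|2|]ger0_norm // normrM [`|m%:R^-1|]ger0_norm // mulrA.
rewrite (_ : _ * _ = C2 / m%:R ^+ 3); last by rewrite /C2; field; rewrite gt_eqF.
by rewrite ler_wpM2r ?invr_ge0 ?exprn_ge0 ?(ltW m0R) // lerDr.
Unshelve. all: by end_near. Qed.

End Full.

(** * Distribution of the error among the remainders *)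

(** The largest K <= n for which Q K holds from n on works. *)
Lemma diagonal_threshold (Q : nat -> nat -> Prop) :
  (forall K, \forall n \near \oo, Q K n) ->
  exists2 k : nat -> nat, (forall K, \forall n \near \oo, (K <= k n)%N) &
    forall n, (0 < k n)%N -> Q (k n) n.
Proof.
move=> QK; have ex K : exists n0, forall n, (n0 <= n)%N -> Q K n.
  by have [n0 _ n0Q] := QK K; exists n0.
have [n0 n0Q] := choice ex.
exists (fun n => \max_(K < n.+1 | (n0 K <= n)%N) K) => [K|n].
  exists (maxn K (n0 K)) => // n /=; rewrite geq_max => /andP[Kn n0n].
  have Kn' : (K < n.+1)%N by [].
  exact: (@leq_bigmax_cond _ (fun K : 'I_n.+1 => (n0 K <= n)%N) _ (Ordinal Kn')).
have : \max_(K < n.+1 | (n0 K <= n)%N) K = 0%N \/ Q (\max_(K < n.+1 | (n0 K <= n)%N) K) n.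
  elim/big_ind: _ => [|a b [->|Qa] [->|Qb]|K /n0Q]; [by left|by left| | | |by right].
  - by rewrite max0n; right.
  - by rewrite maxn0; right.
  - by rewrite /maxn; case: ifP; right.
by case=> [->|].
Qed.

Section Bounded.
Context {R : realType} {d : nat} (J : {set 'I_d}).
Implicit Types (lam x : 'rV[R]_d).

Lemma lam_bounded_le K K' lam : (K <= K')%N -> lam_bounded J K lam -> lam_bounded J K' lam.
Proof. by move=> KK' lb j jJ; apply: le_trans (lb j jJ) _; rewrite ler_nat. Qed.

Lemma x_bounded_le K K' x : (K <= K')%N -> x_bounded J K x -> x_bounded J K' x.
Proof.
move=> KK' [xb sb]; have le_inv : K'.+1%:R^-1 <= K.+1%:R^-1 :> R.
  by rewrite lef_pV2 ?posrE ?ltr0Sn // ler_nat.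
split=> [j jJ|]; first exact: le_trans (xb j jJ).
by apply: le_trans sb _; rewrite lerD2l lerN2.
Qed.

Lemma lam_bounded_ex lam : exists K, lam_bounded J K lam.
Proof.
exists (Num.truncn (\sum_j `|lam ord0 j|)).+1 => j _.
apply: le_trans (ltW (truncnS_gt _)); apply: le_trans (ler_norm _) _.
exact: le_sum_norm.
Qed.

Lemma inv_natr_le (e : R) : 0 < e -> exists K : nat, K.+1%:R^-1 <= e.
Proof.
move=> e0; exists (Num.truncn e^-1).
by rewrite -[leRHS]invrK lef_pV2 ?posrE ?invr_gt0 // ltW // truncnS_gt.
Qed.

Lemma x_bounded_ex lam x : admissible J lam x -> exists K, x_bounded J K x.
Proof.
move=> [_ x01 x1]; have s0 : 0 < 1 - \sum_(j | j \notin J) x ord0 j by rewrite subr_gt0.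
have [K0 K0P] := inv_natr_le s0.
have ex j : exists K : nat, j \notin J -> K.+1%:R^-1 <= x ord0 j.
  have [jJ|] := boolP (j \notin J); last by exists 0%N.
  have /andP[x0 _] := x01 j jJ; by have [K KP] := inv_natr_le x0; exists K.
have [Kj KjP] := choice ex.
have inv_le (a b : nat) : (a <= b)%N -> b.+1%:R^-1 <= a.+1%:R^-1 :> R.
  by move=> ab; rewrite lef_pV2 ?posrE ?ltr0Sn // ler_nat.
exists (K0 + \sum_j Kj j)%N; split => [j jJ|].
  apply: le_trans (KjP j jJ); apply: inv_le.
  by rewrite (bigD1 j) //= addnCA leq_addr.
rewrite lerBrDl -lerBrDr; apply: le_trans K0P; exact/inv_le/leq_addr.
Qed.

End Bounded.

Section Expansion.
Context {R : realType} {d : nat}.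
Variables (f fext : 'rV[R]_d -> R) (U : set 'rV[R]_d) (M : R) (J : {set 'I_d}).
Hypotheses (d_gt0 : (0 < d)%N) (U_open : open U) (simplex_U : simplex `<=` U).
Hypothesis fext_f : forall x, simplex x -> fext x = f x.
Hypothesis fext_C2 : C2_on U fext.
Hypothesis fM : forall x, `|f x| <= M.

Let V := variance_error f J.
Let B := bias_error f fext J.
Let rate (n m : nat) : R := n%:R^-1 * m%:R `^ ((d + #|J|)%:R / 2).
Let ok (m : nat -> nat) (lam x : 'rV[R]_d) n := `[< [/\ admissible J lam x,
  (0 < n)%N, (0 < m n)%N & simplex (boundary_point J (m n) lam x)] >].

(** If lam is not bounded by k (m n) the whole error goes to r1 and r3; this happens
    for finitely many n once lam is fixed, so that even the constant 0 is
    admissible for them. If only x escapes, the error goes to r2, whose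
    threshold may depend on x. Otherwise the errors are uniformly small and go
    to r2 and r4. *)
Lemma expansion_not_full (m : nat -> nat) : m n @[n --> \oo] --> \oo ->
  exists r1 r2 r3 r4 : 'rV[R]_d -> 'rV[R]_d -> nat -> R,
  [/\ bigO_unif (fun=> 0) (fun lam x => admissible J lam x)
         (fun lam x n => r1 lam x n) (fun n => (m n)%:R^-1),
       littleo_unif (fun x lam => admissible J lam x)
         (fun x lam n => r2 lam x n) (fun=> 1),
       bigO_unif (fun=> 0) (fun lam x => admissible J lam x)
         (fun lam x n => r3 lam x n) (fun n => (m n)%:R ^- 3) &
       littleo_unif (fun lam x => admissible J lam x)
         (fun lam x n => r4 lam x n) (fun n => (m n)%:R ^- 2)] /\
  forall lam x n, ok m lam x n ->
    rate n (m n) * V lam x (m n) + B lam x (m n) =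
    rate n (m n) * (r1 lam x n + r2 lam x n) + r3 lam x n + r4 lam x n.
Proof.
move=> moo.
pose Q K n := forall lam x, admissible J lam x ->
    lam_bounded J K lam -> x_bounded J K x -> simplex (boundary_point J n lam x) ->
    `|V lam x n| <= K.+1%:R^-1 /\ n%:R ^+ 2 * `|B lam x n| <= K.+1%:R^-1.
have [K|k koo kP] := @diagonal_threshold Q.
  have K0 : 0 < K.+1%:R^-1 :> R by rewrite invr_gt0.
  have [m0 m0P] := uniform_errors J d_gt0 U_open simplex_U fext_f fext_C2 fM K K0.
  by exists m0 => // n /= m0n lam x; exact: m0P.
pose k' n := k (m n).
have k'oo K : \forall n \near \oo, (K <= k' n)%N by exact: (moo _ (koo K)).
pose lb (lam : 'rV[R]_d) n := `[< lam_bounded J (k' n) lam >].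
pose xb (x : 'rV[R]_d) n := `[< x_bounded J (k' n) x >] && (0 < k' n)%N.
exists (fun lam x n => if ok m lam x n && ~~ lb lam n then V lam x (m n) else 0).
exists (fun lam x n => if ok m lam x n && lb lam n then
  (if xb x n then V lam x (m n) else V lam x (m n) + (rate n (m n))^-1 * B lam x (m n)) else 0).
exists (fun lam x n => if ok m lam x n && ~~ lb lam n then B lam x (m n) else 0).
exists (fun lam x n => if [&& ok m lam x n, lb lam n & xb x n] then B lam x (m n) else 0).
have near_lb lam : \forall n \near \oo, lb lam n.
  have [K KP] := lam_bounded_ex J lam; apply: filterS (k'oo K) => n Kn.
  by apply/asboolP; exact: lam_bounded_le Kn KP.
have QE lam x n : ok m lam x n -> lb lam n -> xb x n ->
    `|V lam x (m n)| <= (k' n).+1%:R^-1 /\ (m n)%:R ^+ 2 * `|B lam x (m n)| <= (k' n).+1%:R^-1.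
  by move=> /asboolP[ad _ _ yS] /asboolP lbn /andP[/asboolP xbn k0]; exact: kP.
have near_k (e : R) : 0 < e -> \forall n \near \oo, (k' n).+1%:R^-1 <= e.
  move=> /inv_natr_le[K Ke]; apply: filterS (k'oo K) => n Kn.
  by apply: le_trans Ke; rewrite lef_pV2 ?posrE ?ltr0Sn // ler_nat.
split; first split.
- move=> lam; apply: filterS (near_lb lam) => n lbn x _.
  by rewrite lbn andbF normr0 mul0r.
- move=> x e e0; have [[lam0 ad0]|nad] := pselect (exists lam, admissible J lam x); last first.
    by exists 0%N => // n _ lam ad; exfalso; apply: nad; exists lam.
  have [K KP] := x_bounded_ex ad0.
  apply: filterS (filterI (filterI (k'oo K) (k'oo 1%N)) (near_k e e0)) => n [[Kn k0] ke] lam ad.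
  have xbn : xb x n by rewrite /xb k0 andbT; apply/asboolP; exact: x_bounded_le Kn KP.
  rewrite xbn normr1 mulr1; case: ifP => [/andP[okn lbn]|_]; last by rewrite normr0 ltW.
  by have [Vle _] := QE lam x n okn lbn xbn; exact: le_trans ke.
- move=> lam; apply: filterS (near_lb lam) => n lbn x _.
  by rewrite lbn andbF normr0 mul0r.
- move=> lam e e0; apply: filterS (near_k e e0) => n ke x ad.
  case: ifP => [/and3P[okn lbn xbn]|_]; last by rewrite normr0 mulr_ge0 // ltW.
  have [_ Ble] := QE lam x n okn lbn xbn; have /asboolP[_ _ m0 _] := okn.
  have m0R : 0 < (m n)%:R ^+ 2 :> R by rewrite exprn_gt0 // ltr0n.
  rewrite [`|_ ^- 2|]ger0_norm ?invr_ge0 ?(ltW m0R) // ler_pdivlMr // mulrC.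
  exact: le_trans Ble ke.
move=> lam x n okn; rewrite okn /=; case: (lb lam n) => /=; last first.
  by rewrite !addr0.
have /asboolP[_ n0 m0 _] := okn.
have rate0 : rate n (m n) != 0.
  by rewrite mulf_neq0 ?invr_neq0 ?gt_eqF ?powR_gt0 ?ltr0n.
case: (xb x n); rewrite add0r addr0 //.
move: rate0; move: (rate n (m n)) (V lam x (m n)) (B lam x (m n)) => c a b c0.
by field.
Qed.

End Expansion.

Lemma expansion_full {R : realType} {d : nat} (f fext : 'rV[R]_d -> R)
    (U : set 'rV[R]_d) (M : R) :
  (0 < d)%N -> open U -> simplex `<=` U -> (forall x, simplex x -> fext x = f x) ->
  C2_on U fext -> (forall x, `|f x| <= M) ->
  exists C : 'rV[R]_d -> R, forall lam : 'rV[R]_d, (forall j, 0 <= lam ord0 j) ->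
    \forall m \near \oo, forall x,
    `|variance_error f [set: 'I_d] lam x m| <= C lam / m%:R /\
    `|bias_error f fext [set: 'I_d] lam x m| <= C lam / m%:R ^+ 3.
Proof.
move=> d0 oU sU ff fC fM.
have ex (lam : 'rV[R]_d) : exists C : R, (forall j, 0 <= lam ord0 j) ->
    \forall m \near \oo, forall x,
    `|variance_error f [set: 'I_d] lam x m| <= C / m%:R /\
    `|bias_error f fext [set: 'I_d] lam x m| <= C / m%:R ^+ 3.
  have [lam0|nlam0] := pselect (forall j, 0 <= lam ord0 j); last by exists 0.
  by have [C CP] := full_errors d0 oU sU ff fC fM lam0; exists C.
by have [C CP] := choice ex; exists C.
Qed.

(** * Minimizing the leading terms *)

Section Optimum.
Context {R : realType}.
Variables (N v B q : R).
Hypotheses (N0 : 0 < N) (v0 : 0 < v) (B0 : 0 < B) (q0 : 0 < q).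

Definition lead_terms (t : R) : R := N^-1 * t `^ (q / 2) * v + t ^- 2 * B.

Definition optimum : R :=
  N `^ (2 / (q + 4)) * (B `^ (2 / (q + 4)) / (q / 4 * v) `^ (2 / (q + 4))).

Let w0 : 0 < q / 4 * v. Proof. by rewrite mulr_gt0 // divr_gt0. Qed.
Let q4 : q + 4 != 0. Proof. by rewrite gt_eqF // addr_gt0. Qed.

Lemma optimum_gt0 : 0 < optimum.
Proof. by rewrite /optimum !mulr_gt0 // ?invr_gt0 powR_gt0. Qed.

Lemma powR_div (x y a : R) : 0 <= x -> 0 < y -> (x / y) `^ a = x `^ a / y `^ a.
Proof.
move=> x0 y0; have y_gt : y `^ a != 0 by rewrite gt_eqF // powR_gt0.
have yn : y != 0 by rewrite gt_eqF.
have -> : x `^ a = (x / y) `^ a * y `^ a by rewrite -powRM ?divr_ge0 ?(ltW y0) // divfK.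
by rewrite mulfK.
Qed.

(** The first order condition: the derivatives of the two terms cancel. *)
Lemma optimum_balance :
  N^-1 * optimum `^ (q / 2) * v = 4 / q * (optimum ^- 2 * B).
Proof.
pose t := N * (B / (q / 4 * v)).
have t0 : 0 < t by rewrite mulr_gt0 // divr_gt0.
have optE : optimum = t `^ (2 / (q + 4)).
  by rewrite /t powRM ?powR_div // ?divr_ge0 // ltW.
have o0 := optimum_gt0.
have : optimum `^ (q / 2) * optimum ^+ 2 = t.
  rewrite -powR_mulrn ?(ltW o0) // -powRD; last by rewrite (gt_eqF o0) implybT.
  rewrite optE -powRrM (_ : _ * _ = 1) ?powRr1 ?(ltW t0) //; by field.
move=> eq_t; have -> : optimum `^ (q / 2) = t / optimum ^+ 2.
  by rewrite -eq_t mulfK // expf_neq0 // gt_eqF.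
rewrite /t; move: optimum o0 {eq_t optE} => o o0; field.
by rewrite !gt_eqF.
Qed.

Lemma lead_terms_ratio (r : R) : 0 < r ->
  lead_terms (optimum * r) = optimum ^- 2 * B * (4 / q * r `^ (q / 2) + r ^- 2).
Proof.
move=> r0; have o0 := optimum_gt0.
rewrite /lead_terms powRM ?(ltW r0) ?(ltW o0) //.
rewrite (_ : N^-1 * _ * v = (N^-1 * optimum `^ (q / 2) * v) * r `^ (q / 2)); last by ring.
rewrite optimum_balance; move: optimum o0 (r `^ _) => o o0 p; field.
by rewrite !gt_eqF.
Qed.

(** With r = exp u, both exponentials lie above their tangents at u = 0, and the
    two slopes cancel. *)
Lemma ratio_gt (r : R) : 0 < r -> r != 1 -> 4 / q + 1 < 4 / q * r `^ (q / 2) + r ^- 2.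
Proof.
move=> r0 r1; pose u := ln r.
have u0 : u != 0 by rewrite /u ln_eq0.
have rE : r = expR u by rewrite lnK.
have -> : r `^ (q / 2) = expR (q / 2 * u) by rewrite /powR gt_eqF.
have -> : r ^- 2 = expR (- (2 * u)) by rewrite expRN rE -expRM_natl.
have h1 := expR_gt1Dx (_ : q / 2 * u != 0).
have h2 := expR_gt1Dx (_ : - (2 * u) != 0).
have g1 : 1 + q / 2 * u < expR (q / 2 * u) by apply: h1; rewrite mulf_neq0 // gt_eqF // divr_gt0.
have g2 : 1 + - (2 * u) < expR (- (2 * u)) by apply: h2; rewrite oppr_eq0 mulf_neq0.
have c0 : 0 < 4 / q by rewrite divr_gt0.
have g3 := ltr_pM2l c0 (1 + q / 2 * u) (expR (q / 2 * u)).
rewrite g1 in g3; have {}g3 : 4 / q * (1 + q / 2 * u) < 4 / q * expR (q / 2 * u) by rewrite g3.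
have E : 4 / q * (1 + q / 2 * u) = 4 / q + 2 * u by field; rewrite gt_eqF.
by rewrite E in g3; lra.
Qed.

Lemma optimum_strict (t : R) : 0 < t -> t != optimum ->
  lead_terms optimum < lead_terms t.
Proof.
move=> t0 t_opt; have o0 := optimum_gt0.
have r0 : 0 < t / optimum by rewrite divr_gt0.
have tE : t = optimum * (t / optimum) by rewrite mulrC divfK // gt_eqF.
rewrite [in ltRHS]tE lead_terms_ratio // -[in ltLHS](mulr1 optimum) lead_terms_ratio //.
rewrite powR1 expr1n invr1 mulr1 ltr_pM2l; last by rewrite mulr_gt0 // invr_gt0 exprn_gt0.
apply: ratio_gt => //; apply: contraNneq t_opt => r1.
by rewrite tE r1 mulr1.
Qed.

Lemma optimal_value : optimum ^- 2 * B * (4 / q + 1) =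
  N `^ (- (4 / (q + 4))) * (B `^ (q / (q + 4)) /
    ((4 / q) `^ (4 / (q + 4)) / (4 / q + 1) * v `^ (- 4 / (q + 4)))).
Proof.
pose a := 4 / (q + 4).
have sq x : 0 < x -> (x `^ (2 / (q + 4))) ^+ 2 = x `^ a.
  move=> x0; rewrite -powR_mulrn ?powR_ge0 // -powRrM; congr (_ `^ _).
  by rewrite /a; field.
have -> : q / (q + 4) = 1 - a by rewrite /a; field.
rewrite mulNr -/a !powRN.
have -> : B `^ (1 - a) = B / B `^ a.
  by rewrite powRD ?(gt_eqF B0) ?implybT // powRN powRr1 // ltW.
have -> : (4 / q) `^ a = ((q / 4) `^ a)^-1.
  by rewrite !powR_div ?(ltW q0) // invf_div.
rewrite /optimum !exprMn exprVn !sq // powRM ?divr_ge0 ?(ltW q0) ?(ltW v0) //.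
have p1 : 0 < N `^ a by rewrite powR_gt0.
have p2 : 0 < B `^ a by rewrite powR_gt0.
have p3 : 0 < v `^ a by rewrite powR_gt0.
have p4 : 0 < (q / 4) `^ a by rewrite powR_gt0 // divr_gt0.
move: (N `^ a) (B `^ a) (v `^ a) ((q / 4) `^ a) p1 p2 p3 p4 => n b v' w p1 p2 p3 p4.
have p5 : 0 < 4 + q by rewrite addr_gt0.
by field; rewrite !gt_eqF.
Qed.

(** Errors V and E of the variance and of the squared bias enter through their
    ratios to v and to B / m^2. *)
Lemma lead_terms_excess (m V E : R) : 0 < m ->
  lead_terms m + N^-1 * m `^ (q / 2) * V + E - optimum ^- 2 * B * (4 / q + 1) =
  optimum ^- 2 * B *
    (4 / q * (m / optimum) `^ (q / 2) * (1 + V / v) +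
     (m / optimum) ^- 2 * (1 + m ^+ 2 * E / B) - (4 / q + 1)).
Proof.
move=> m0; have o0 := optimum_gt0; pose r := m / optimum.
have r0 : 0 < r by rewrite divr_gt0.
have mE : m = optimum * r by rewrite /r mulrC divfK // gt_eqF.
have powE : N^-1 * m `^ (q / 2) * v = 4 / q * (optimum ^- 2 * B) * r `^ (q / 2).
  by rewrite -optimum_balance mE powRM ?(ltW o0) ?(ltW r0) //; ring.
rewrite [in lead_terms m]mE lead_terms_ratio // -/r.
have -> : N^-1 * m `^ (q / 2) * V = (N^-1 * m `^ (q / 2) * v) * (V / v).
  by move: (N^-1 * _) => p; field; rewrite gt_eqF.
rewrite powE mE; move: (r `^ (q / 2)) (r) (optimum) r0 o0 => p s o s0 o0'.
by field; rewrite !gt_eqF.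
Qed.

End Optimum.

Section Rounding.
Context {R : realType}.

Lemma expr_dist1 k (s : R) : 0 <= s <= 2 -> `|s ^+ k - 1| <= (k * 2 ^ k)%:R * `|s - 1|.
Proof.
move=> /andP[s0 s2]; elim: k => [|k IH]; first by rewrite expr0 subrr normr0 mul0n mul0r.
have -> : s ^+ k.+1 - 1 = s * (s ^+ k - 1) + (s - 1) by rewrite exprS; ring.
apply: le_trans (ler_normD _ _) _; rewrite normrM (ger0_norm s0).
apply: le_trans (_ : 2 * ((k * 2 ^ k)%:R * `|s - 1|) + `|s - 1| <= _).
  by rewrite lerD2r ler_pM.
rewrite mulrA -[X in _ + X]mul1r -mulrDl ler_wpM2r //.
rewrite -[X in _ + X]/(1%:R) -natrM -natrD ler_nat.
have : (0 < 2 ^ k)%N by rewrite expn_gt0.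
by rewrite expnS; move: (2 ^ k)%N => p; nia.
Qed.

Lemma powR_half_dist k (r : R) : 0 <= r <= 2 ->
  `|r `^ (k%:R / 2) - 1| <= (k * 2 ^ k)%:R * `|r - 1|.
Proof.
move=> /andP[r0 r2]; pose s := Num.sqrt r; have s0 : 0 <= s by exact: sqrtr_ge0.
have sE : s ^+ 2 = r by rewrite sqr_sqrtr.
have s2 : s <= 2.
  rewrite leNgt; apply/negP => s_gt; have : 2 * 2 < s * s by apply: ltr_pM.
  by rewrite -(expr2 s) sE; lra.
rewrite mulrC powRrM powR12_sqrt // -/s powR_mulrn //.
apply: le_trans (expr_dist1 _ _) _; first by rewrite s0.
rewrite ler_wpM2l // -sE (_ : s ^+ 2 - 1 = (s - 1) * (s + 1)); last by ring.
by rewrite normrM [`|s + 1|]ger0_norm ?addr_ge0 // ler_peMr // lerDr.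
Qed.

Lemma inv_sqr_dist (r : R) : 2^-1 <= r -> `|r ^- 2 - 1| <= 12 * `|r - 1|.
Proof.
move=> r2; have r0 : 0 < r by apply: lt_le_trans r2.
have rV : r^-1 <= 2 by rewrite -[leRHS]invrK lef_pV2 ?posrE ?invr_gt0.
have rV0 : 0 <= r^-1 by rewrite invr_ge0 ltW.
have -> : r ^- 2 - 1 = (1 - r) * (r^-1 * (r^-1 + 1)).
  by field; rewrite gt_eqF.
rewrite normrM distrC mulrC ler_wpM2r // ger0_norm ?mulr_ge0 ?addr_ge0 //.
by move: r^-1 rV rV0 => w w2 w0; nra.
Qed.

Definition excess_const k : R := 4 / k%:R * (2 * (k * 2 ^ k)%:R + 1) + 25.

Lemma excess_le k (r s t : R) : (0 < k)%N -> `|r - 1| <= 2^-1 -> `|s| <= 1 -> `|t| <= 1 ->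
  `|4 / k%:R * r `^ (k%:R / 2) * (1 + s) + r ^- 2 * (1 + t) - (4 / k%:R + 1)| <=
  excess_const k * (`|r - 1| + `|s| + `|t|).
Proof.
move=> k0 r1 s1 t1; have r01 : 2^-1 <= r /\ r <= 2.
  by move: r1; rewrite ler_norml => /andP[? ?]; split; lra.
have [r_lo r_hi] := r01.
have h1 := @powR_half_dist k r; rewrite (le_trans _ r_lo) // r_hi in h1.
have {}h1 := h1 isT; have h2 := inv_sqr_dist r_lo.
pose c : R := 4 / k%:R; have c0 : 0 <= c by rewrite divr_ge0.
have -> : 4 / k%:R * r `^ (k%:R / 2) * (1 + s) + r ^- 2 * (1 + t) - (4 / k%:R + 1) =
  c * ((r `^ (k%:R / 2) - 1) * (1 + s) + s) + ((r ^- 2 - 1) * (1 + t) + t).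
  by rewrite /c; move: (4 / k%:R) => c'; ring.
rewrite /excess_const -/c; move: (r `^ _ - 1) (r ^- 2 - 1) h1 h2 => a b h1 h2.
have s2 : `|1 + s| <= 2 by apply: le_trans (ler_normD _ _) _; rewrite normr1; lra.
have t2 : `|1 + t| <= 2 by apply: le_trans (ler_normD _ _) _; rewrite normr1; lra.
apply: le_trans (ler_normD _ _) _; rewrite normrM (ger0_norm c0).
set K : R := (k * 2 ^ k)%:R in h1 *; have K0 : 0 <= K by rewrite /K.
have A1 : `|a * (1 + s) + s| <= 2 * K * `|r - 1| + `|s|.
  apply: le_trans (ler_normD _ _) _; rewrite lerD2r normrM.
  by rewrite -mulrA [leRHS]mulrC; apply: ler_pM.
have A2 : `|b * (1 + t) + t| <= 24 * `|r - 1| + `|t|.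
  apply: le_trans (ler_normD _ _) _; rewrite lerD2r normrM.
  apply: le_trans (ler_pM _ _ h2 t2) _ => //; lra.
apply: le_trans (lerD (ler_wpM2l c0 A1) A2) _.
have p1 : 0 <= c * K * `|s| by rewrite !mulr_ge0.
have p2 : 0 <= c * K * `|t| by rewrite !mulr_ge0.
have p3 : 0 <= c * `|r - 1| by rewrite mulr_ge0.
have p4 : 0 <= c * `|t| by rewrite mulr_ge0.
have := normr_ge0 (r - 1); have := normr_ge0 s; have := normr_ge0 t.
by move: p1 p2 p3 p4; move: `|r - 1| `|s| `|t| => x y z; lra.
Qed.

Lemma powR_natr_large (a A : R) : 0 < a -> \forall n \near \oo, A <= n%:R `^ a.
Proof.
move=> a0; have [A0|A0] := leP A 0.
  by exists 0%N => // n _; apply: le_trans A0 _; exact: powR_ge0.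
exists (Num.truncn (A `^ a^-1)).+1 => // n /= nA.
have -> : A = (A `^ a^-1) `^ a by rewrite -powRrM mulVf ?gt_eqF // powRr1 // ltW.
apply: ge0_ler_powR; rewrite ?nnegrE ?powR_ge0 ?(ltW a0) //.
by apply: le_trans (ltW (truncnS_gt _)) _; rewrite ler_nat.
Qed.

End Rounding.

(** * The error at the rounded optimum *)

Section OptimalMSE.
Context {R : realType} {d : nat}.
Variables (f fext : 'rV[R]_d -> R) (U : set 'rV[R]_d) (M : R) (J : {set 'I_d}).
Hypotheses (d_gt0 : (0 < d)%N) (U_open : open U) (simplex_U : simplex `<=` U).
Hypothesis fext_f : forall x, simplex x -> fext x = f x.
Hypothesis fext_C2 : C2_on U fext.
Hypothesis fM : forall x, `|f x| <= M.
Hypothesis f_ge0 : forall x, 0 <= f x.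

Let k := (d + #|J|)%N.
Let q : R := k%:R.
Let v lam x := vcoef f J lam x.
Let b2 x := bcoef fext J x ^+ 2.
Let tau0 lam x := b2 x `^ (2 / (q + 4)) / (q / 4 * v lam x) `^ (2 / (q + 4)).
Let tau lam x n := m_opt f fext J lam x n.
Let k_gt0 : (0 < k)%N. Proof. by rewrite addn_gt0 d_gt0. Qed.
Let q_gt0 : 0 < q. Proof. by rewrite ltr0n. Qed.
Let q4_gt0 : 0 < q / 4. Proof. exact: divr_gt0. Qed.

(** By MSE_errors, the first three terms are the mean squared error at bandwidth m. *)
Definition excess lam x (n m : nat) : R :=
  MSE_lead f fext J lam x n m%:R +
  n%:R^-1 * m%:R `^ ((d + #|J|)%:R / 2) * variance_error f J lam x m +
  bias_error f fext J lam x m - MSE_opt f fext J lam x n.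

Definition regular lam x : Prop :=
  [/\ admissible J lam x, bcoef fext J x != 0 & vcoef f J lam x != 0].

Lemma regular_v_gt0 lam x : regular lam x -> 0 < v lam x.
Proof.
move=> [[lam0 _ _] _ v0]; rewrite lt_neqAle eq_sym v0 /v vcoefE mulr_ge0 // mulr_ge0 ?powR_ge0 //.
by apply: prodr_ge0 => j /lam0; exact: poisson_collision_ge0.
Qed.

Lemma regular_b2_gt0 lam x : regular lam x -> 0 < b2 x.
Proof. by move=> [_ b0 _]; rewrite /b2 exprn_even_gt0. Qed.

Lemma tau0_gt0 lam x : regular lam x -> 0 < tau0 lam x.
Proof.
move=> reg; have v0 := regular_v_gt0 reg; have b0 := regular_b2_gt0 reg.
by rewrite divr_gt0 // powR_gt0 // mulr_gt0 // divr_gt0.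
Qed.

Let scale_ge0 lam x : regular lam x -> 0 <= tau0 lam x ^- 2 * b2 x.
Proof.
move=> reg; apply: mulr_ge0 (ltW (regular_b2_gt0 reg)).
by rewrite invr_ge0 exprn_ge0 // ltW // tau0_gt0.
Qed.

Lemma tauE lam x n : tau lam x n = n%:R `^ (2 / (q + 4)) * tau0 lam x.
Proof. by []. Qed.

(** The prefactor is the squared bias at the optimum, of order n^(-4/(q+4)), and
    the rounding error m / m_opt - 1 is at most 1 / m_opt. *)
Lemma excess_bound lam x n m : regular lam x -> (0 < n)%N ->
  `|m%:R - tau lam x n| < 1 -> 2 <= tau lam x n ->
  `|variance_error f J lam x m / v lam x| <= 1 ->
  `|m%:R ^+ 2 * bias_error f fext J lam x m / b2 x| <= 1 ->
  `|excess lam x n m| <= n%:R `^ (- (4 / (q + 4))) * (tau0 lam x ^- 2 * b2 x) *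
    (excess_const k * ((tau lam x n)^-1 + `|variance_error f J lam x m / v lam x| +
      `|m%:R ^+ 2 * bias_error f fext J lam x m / b2 x|)).
Proof.
move=> reg n0 m_tau tau2 V1 B1.
have v0 := regular_v_gt0 reg; have b0 := regular_b2_gt0 reg.
have n0R : 0 < n%:R :> R by rewrite ltr0n.
have t0 : 0 < tau lam x n by apply: lt_le_trans tau2.
have m0 : 0 < m%:R :> R.
  by move: m_tau; rewrite ltr_norml => /andP[+ _]; move: tau2; lra.
have -> : excess lam x n m = tau lam x n ^- 2 * b2 x *
    (4 / q * (m%:R / tau lam x n) `^ (q / 2) * (1 + variance_error f J lam x m / v lam x) +
     (m%:R / tau lam x n) ^- 2 * (1 + m%:R ^+ 2 * bias_error f fext J lam x m / b2 x) -
     (4 / q + 1)).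
  rewrite -(lead_terms_excess n0R v0 b0 q_gt0 (variance_error f J lam x m)
    (bias_error f fext J lam x m) m0).
  by rewrite (optimal_value n0R v0 b0 q_gt0).
have -> : tau lam x n ^- 2 * b2 x =
    n%:R `^ (- (4 / (q + 4))) * (tau0 lam x ^- 2 * b2 x).
  rewrite tauE exprMn invfM -mulrA; congr (_ * _); rewrite powRN; congr (_^-1).
  rewrite -powR_mulrn ?powR_ge0 // -powRrM; congr (_ `^ _); field.
  by rewrite gt_eqF // addr_gt0.
have c0 : 0 <= n%:R `^ (- (4 / (q + 4))) * (tau0 lam x ^- 2 * b2 x).
  exact: mulr_ge0 (powR_ge0 _ _) (scale_ge0 reg).
rewrite normrM (ger0_norm c0) ler_wpM2l //.
have r_le : `|m%:R / tau lam x n - 1| <= (tau lam x n)^-1.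
  rewrite -[X in _ - X](divff (_ : tau lam x n != 0)) ?gt_eqF // -mulrBl normrM.
  rewrite [`|_^-1|]ger0_norm ?invr_ge0 ?(ltW t0) //.
  by rewrite -[leRHS]mul1r ler_wpM2r ?invr_ge0 ?(ltW t0) // ltW.
have tV : (tau lam x n)^-1 <= 2^-1 by rewrite lef_pV2 ?posrE.
apply: le_trans (excess_le k_gt0 (le_trans r_le tV) V1 B1) _.
apply: ler_wpM2l; last by rewrite !lerD2r.
by rewrite /excess_const addr_ge0 // mulr_ge0 ?divr_ge0 // addr_ge0 // mulr_ge0.
Qed.

Let near_tau (l A : R) : 0 < l -> \forall n \near \oo, A <= n%:R `^ (2 / (q + 4)) * l.
Proof.
move=> l0; have a0 : 0 < 2 / (q + 4) by rewrite divr_gt0 // addr_gt0.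
apply: filterS (powR_natr_large (A / l) a0) => n.
by rewrite ler_pdivrMr.
Qed.

(** All the relative errors are of order 1 / m_opt, that is n^(-2/(q+4)). *)
Lemma excess_full : J = [set: 'I_d]%SET -> exists C : 'rV[R]_d * 'rV[R]_d -> R,
  forall rnd : R -> nat, (forall t, 0 <= t -> `|(rnd t)%:R - t| < 1) ->
  forall lam x, regular lam x -> \forall n \near \oo,
    `|excess lam x n (rnd (tau lam x n))| <= C (lam, x) * n%:R `^ (- (6 / (q + 4))).
Proof.
move=> JT; have [Cf CfP] := expansion_full d_gt0 U_open simplex_U fext_f fext_C2 fM.
pose C lam x : R := tau0 lam x ^- 2 * b2 x * (excess_const k *
  (1 + 2 * `|Cf lam| / v lam x + 2 * `|Cf lam| / b2 x)) / tau0 lam x.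
exists (fun p => C p.1 p.2) => rnd rndP lam x reg /=.
have v0 := regular_v_gt0 reg; have b0 := regular_b2_gt0 reg; have t00 := tau0_gt0 reg.
have lam0 j : 0 <= lam ord0 j.
  by have [[+ _ _] _ _] := reg; apply; rewrite JT inE.
have [m0 _ m0P] := CfP lam lam0.
pose c : R := `|Cf lam|; have c0 : 0 <= c by exact: normr_ge0.
(* Once m_opt exceeds A, the rounded m exceeds m0 and m_opt / 2, and the relative
   errors of the variance and of the squared bias are at most 1. *)
pose A : R := 3 + m0%:R + 2 * c / v lam x + 2 * c / b2 x.
have c2 : 0 <= 2 * c by rewrite mulr_ge0.
have A1 : 0 <= 2 * c / v lam x := divr_ge0 c2 (ltW v0).
have A2 : 0 <= 2 * c / b2 x := divr_ge0 c2 (ltW b0).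
have m00 : 0 <= m0%:R :> R by [].
have near_A := near_tau A t00.
near=> n; have n0 : (0 < n)%N by near: n; exact: nbhs_infty_gt.
have tA : A <= tau lam x n by rewrite tauE; near: n.
have n0R : 0 < n%:R :> R by rewrite ltr0n.
have tau0' : 0 < tau lam x n by apply: lt_le_trans tA; rewrite /A; lra.
set m := rnd _; have m_tau : `|m%:R - tau lam x n| < 1 by apply: rndP; exact: ltW.
have m_ge : tau lam x n / 2 <= m%:R.
  by move: m_tau tA; rewrite ltr_norml => /andP[+ _]; rewrite /A; lra.
have m_m0 : (m0 <= m)%N.
  rewrite -(ler_nat R); move: m_tau tA; rewrite ltr_norml => /andP[+ _]; rewrite /A; lra.
have m_gt0 : 0 < m%:R :> R by apply: lt_le_trans m_ge; rewrite divr_gt0.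
have mV : m%:R^-1 <= 2 * (tau lam x n)^-1.
  by rewrite -invf_div lef_pV2 ?posrE // divr_gt0.
have [Vle Ble] : `|variance_error f J lam x m| <= c * m%:R^-1 /\
    `|bias_error f fext J lam x m| <= c * m%:R ^- 3.
  have /= := m0P m m_m0 x; rewrite -JT => -[h1 h2]; split.
    by apply: le_trans h1 _; rewrite ler_wpM2r ?invr_ge0 ?(ltW m_gt0) // ler_norm.
  apply: le_trans h2 _; rewrite ler_wpM2r ?invr_ge0 ?exprn_ge0 ?(ltW m_gt0) //.
  exact: ler_norm.
have Vv : `|variance_error f J lam x m / v lam x| <= 2 * c / v lam x / tau lam x n.
  rewrite normrM [`|_^-1|]ger0_norm ?invr_ge0 ?(ltW v0) //.
  rewrite (_ : 2 * c / _ / _ = c * (2 * (tau lam x n)^-1) / v lam x); last by ring.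
  rewrite ler_wpM2r ?invr_ge0 ?(ltW v0) //.
  by apply: le_trans Vle _; rewrite ler_wpM2l.
have Bb : `|m%:R ^+ 2 * bias_error f fext J lam x m / b2 x| <= 2 * c / b2 x / tau lam x n.
  rewrite normrM [`|(b2 x)^-1|]ger0_norm ?invr_ge0 ?(ltW b0) //.
  rewrite normrM [`|m%:R ^+ 2|]ger0_norm ?exprn_ge0 //.
  rewrite (_ : 2 * c / _ / _ = c * (2 * (tau lam x n)^-1) / b2 x); last by ring.
  rewrite ler_wpM2r ?invr_ge0 ?(ltW b0) //.
  apply: le_trans (_ : c * m%:R^-1 <= _); last by rewrite ler_wpM2l.
  have -> : c * m%:R^-1 = m%:R ^+ 2 * (c * m%:R ^- 3) by field; rewrite gt_eqF.
  by rewrite ler_wpM2l ?exprn_ge0.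
have le1 u : u <= A -> u / tau lam x n <= 1.
  by move=> uA; rewrite ler_pdivrMr // mul1r; exact: le_trans tA.
apply: le_trans (@excess_bound lam x n m reg n0 m_tau _ _ _) _.
- by apply: le_trans tA; rewrite /A; lra.
- by apply: le_trans Vv _; apply: le1; rewrite /A; lra.
- by apply: le_trans Bb _; apply: le1; rewrite /A; lra.
have nE : n%:R `^ (- (6 / (q + 4))) = n%:R `^ (- (4 / (q + 4))) / n%:R `^ (2 / (q + 4)).
  rewrite -powRN -powRD; last by rewrite (gt_eqF n0R) implybT.
  by congr (_ `^ _); field; rewrite gt_eqF // addr_gt0.
have K0 : 0 <= tau0 lam x ^- 2 * b2 x.
  exact: scale_ge0.
have Cq0 : 0 <= excess_const k :> R.
  by rewrite /excess_const addr_ge0 // mulr_ge0 ?divr_ge0 // addr_ge0 // mulr_ge0.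
apply: le_trans (_ : n%:R `^ (- (4 / (q + 4))) * (tau0 lam x ^- 2 * b2 x) *
  (excess_const k * ((1 + 2 * c / v lam x + 2 * c / b2 x) / tau lam x n)) <= _).
  apply: ler_wpM2l; first exact: mulr_ge0 (powR_ge0 _ _) K0.
  apply: ler_wpM2l => //.
  rewrite [leRHS](_ : _ = (tau lam x n)^-1 + 2 * c / v lam x / tau lam x n +
    2 * c / b2 x / tau lam x n); last by rewrite !mulrDl mul1r.
  by apply: lerD => //; apply: lerD.
have tV : (tau lam x n)^-1 = (n%:R `^ (2 / (q + 4)))^-1 * (tau0 lam x)^-1.
  by rewrite tauE invfM.
rewrite /C -/c nE tV le_eqVlt; apply/orP; left; apply/eqP.
by ring.
Unshelve. all: by end_near. Qed.

Let regular_K K lam x := [/\ lam_bounded J K lam, x_bounded J K x,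
  K.+1%:R^-1 <= v lam x <= K.+1%:R & K.+1%:R^-1 <= b2 x <= K.+1%:R].

Let regular_K_le K K' lam x : (K <= K')%N -> regular_K K lam x -> regular_K K' lam x.
Proof.
move=> KK' [lb xb /andP[v1 v2] /andP[b1 b2']].
have le_inv : K'.+1%:R^-1 <= K.+1%:R^-1 :> R by rewrite lef_pV2 ?posrE ?ltr0Sn // ler_nat.
have le_nat : K.+1%:R <= K'.+1%:R :> R by rewrite ler_nat.
split; [exact: lam_bounded_le lb|exact: x_bounded_le xb| |].
  by rewrite (le_trans le_inv) // (le_trans v2).
by rewrite (le_trans le_inv) // (le_trans b2').
Qed.

Let regular_K_ex lam x : regular lam x -> exists K, regular_K K lam x.
Proof.
move=> reg; have v0 := regular_v_gt0 reg; have b0 := regular_b2_gt0 reg.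
have [adm _ _] := reg.
have [K1 P1] := lam_bounded_ex J lam; have [K2 P2] := x_bounded_ex adm.
have [K3 P3] := inv_natr_le v0; have [K4 P4] := inv_natr_le b0.
pose K5 := Num.truncn (v lam x); pose K6 := Num.truncn (b2 x).
pose K := (K1 + K2 + K3 + K4 + K5 + K6)%N; exists K.
have inv_le a : (a <= K)%N -> K.+1%:R^-1 <= a.+1%:R^-1 :> R.
  by move=> aK; rewrite lef_pV2 ?posrE ?ltr0Sn // ler_nat.
have nat_le a : (a <= K)%N -> a.+1%:R <= K.+1%:R :> R by move=> aK; rewrite ler_nat.
have le1 : (K1 <= K)%N by rewrite /K -!addnA leq_addr.
have le2 : (K2 <= K)%N by rewrite /K; lia.
have le3 : (K3 <= K)%N by rewrite /K; lia.
have le4 : (K4 <= K)%N by rewrite /K; lia.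
have le5 : (K5 <= K)%N by rewrite /K; lia.
have le6 : (K6 <= K)%N by rewrite /K; lia.
split; [exact: lam_bounded_le P1|exact: x_bounded_le P2| |].
  rewrite (le_trans (inv_le _ le3) P3) /=.
  by apply: le_trans (nat_le _ le5); rewrite ltW // truncnS_gt.
rewrite (le_trans (inv_le _ le4) P4) /=.
by apply: le_trans (nat_le _ le6); rewrite ltW // truncnS_gt.
Qed.

Lemma excess_uniform (rnd : R -> nat) (K : nat) :
  (forall t, 0 <= t -> `|(rnd t)%:R - t| < 1) ->
  \forall n \near \oo, forall lam x, regular lam x -> regular_K K lam x ->
    simplex (boundary_point J (rnd (tau lam x n)) lam x) ->
    `|excess lam x n (rnd (tau lam x n))| <= n%:R `^ (- (4 / (q + 4))) * K.+1%:R^-1.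
Proof.
move=> rndP; pose kap : R := K.+1%:R; have kap0 : 0 < kap by rewrite ltr0n.
have a0 : 0 < 2 / (q + 4) by rewrite divr_gt0 // addr_gt0.
pose l : R := (kap^-1 / (q / 4 * kap)) `^ (2 / (q + 4)).
have l0 : 0 < l by rewrite powR_gt0 // divr_gt0 ?invr_gt0 // mulr_gt0 // divr_gt0.
have Cq0 : 0 < excess_const k :> R.
  by rewrite /excess_const ltr_wpDl // mulr_ge0 ?divr_ge0 // addr_ge0 // mulr_ge0.
(* On the compact part tau0 is at least l, so that tau0^-2 b2 is at most c. *)
pose c : R := l ^- 2 * kap; have c0 : 0 < c by rewrite mulr_gt0 // invr_gt0 exprn_gt0.
have cpos : 0 < 3 * c * excess_const k * kap.
  by apply: mulr_gt0 kap0; apply: mulr_gt0 Cq0; exact: mulr_gt0.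
pose del : R := Num.min 1 (3 * c * excess_const k * kap)^-1.
have del0 : 0 < del by rewrite lt_min ltr01 invr_gt0.
have del1 : del <= 1 by rewrite ge_min lexx.
have del_c : del <= (3 * c * excess_const k * kap)^-1 by rewrite ge_min lexx orbT.
have [m0 m0P] := uniform_errors J d_gt0 U_open simplex_U fext_f fext_C2 fM K
  (divr_gt0 del0 kap0).
pose A : R := 3 + m0%:R + del^-1.
have near_A := near_tau A l0.
near=> n => lam x reg [lb xb /andP[v1 v2] /andP[b1 b2']] yS.
have n0 : (0 < n)%N by near: n; exact: nbhs_infty_gt.
have v0 := regular_v_gt0 reg; have b0 := regular_b2_gt0 reg; have t00 := tau0_gt0 reg.
have qv := mulr_gt0 q4_gt0 v0; have qk := mulr_gt0 q4_gt0 kap0.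
have kV0 : 0 < kap^-1 by rewrite invr_gt0.
have l_le : l <= tau0 lam x.
  have -> : tau0 lam x = (b2 x / (q / 4 * v lam x)) `^ (2 / (q + 4)).
    by rewrite powR_div //; exact: ltW.
  apply: ge0_ler_powR; rewrite ?(ltW a0) // ?nnegrE.
  - exact: divr_ge0 (ltW kV0) (ltW qk).
  - exact: divr_ge0 (ltW b0) (ltW qv).
  apply: ler_pM => //; rewrite ?invr_ge0 ?(ltW kap0) ?(ltW qk) //.
  by rewrite lef_pV2 ?posrE ?qv ?qk // ler_wpM2l // ltW.
have tA : A <= tau lam x n.
  rewrite tauE; apply: le_trans (_ : n%:R `^ (2 / (q + 4)) * l <= _); first by near: n.
  by rewrite ler_wpM2l // powR_ge0.
have m00 : 0 <= m0%:R :> R by [].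
have dV0 : 0 < del^-1 by rewrite invr_gt0.
have tau_gt0 : 0 < tau lam x n by apply: lt_le_trans tA; rewrite /A; lra.
move: yS; set m := rnd _ => yS.
have m_tau : `|m%:R - tau lam x n| < 1 by apply: rndP; exact: ltW.
have m_m0 : (m0 <= m)%N.
  by rewrite -(ler_nat R); move: m_tau tA; rewrite ltr_norml => /andP[+ _]; rewrite /A; lra.
have [adm _ _] := reg; have [Vle Ble] := m0P m lam x m_m0 adm lb xb yS.
have inv_kap u : kap^-1 <= u -> 0 < u -> u^-1 <= kap.
  by move=> ku u0; rewrite -[leRHS]invrK lef_pV2 ?posrE ?invr_gt0.
have Vv : `|variance_error f J lam x m / v lam x| <= del.
  rewrite normrM [`|_^-1|]ger0_norm ?invr_ge0 ?(ltW v0) //.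
  have -> : del = del / kap * kap by rewrite divfK // gt_eqF.
  by apply: ler_pM => //; [rewrite invr_ge0 ltW|exact: inv_kap].
have Bb : `|m%:R ^+ 2 * bias_error f fext J lam x m / b2 x| <= del.
  rewrite normrM [`|(b2 x)^-1|]ger0_norm ?invr_ge0 ?(ltW b0) //.
  rewrite normrM [`|m%:R ^+ 2|]ger0_norm ?exprn_ge0 //.
  have -> : del = del / kap * kap by rewrite divfK // gt_eqF.
  have bV0 : 0 <= (b2 x)^-1 by rewrite invr_ge0 ltW.
  apply: (ler_pM _ bV0 Ble (inv_kap _ b1 b0)).
  by apply: mulr_ge0 => //; exact: exprn_ge0.
have tV : (tau lam x n)^-1 <= del.
  rewrite -[leRHS]invrK lef_pV2 ?posrE //; apply: le_trans tA; rewrite /A; lra.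
apply: le_trans (@excess_bound lam x n m reg n0 m_tau _ _ _) _.
- by apply: le_trans tA; rewrite /A; lra.
- exact: le_trans Vv del1.
- exact: le_trans Bb del1.
rewrite -mulrA ler_wpM2l ?powR_ge0 //.
apply: le_trans (_ : c * (excess_const k * (3 * del)) <= _).
  apply: ler_pM.
  - exact: scale_ge0.
  - by rewrite mulr_ge0 ?(ltW Cq0) // !addr_ge0 // invr_ge0 ltW.
  - have t2 : 0 <= tau0 lam x ^- 2 by rewrite invr_ge0 exprn_ge0 // ltW.
    apply: (ler_pM t2 (ltW b0) _ b2').
    by rewrite lef_pV2 ?posrE ?exprn_gt0 // lerXn2r ?nnegrE ?(ltW l0) ?(ltW t00).
  - by rewrite ler_wpM2l ?(ltW Cq0) //; move: tV Vv Bb; lra.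
rewrite -/kap -(ler_pM2r kap0) mulVf ?gt_eqF //.
have := ler_wpM2l (ltW cpos) del_c; rewrite mulfV ?gt_eqF //.
by apply: le_trans; rewrite le_eqVlt; apply/orP; left; apply/eqP; ring.
Unshelve. all: by end_near. Qed.

(** As in expansion_not_full, parameters outside of a slowly growing compact set are
    charged to s1, which vanishes eventually for fixed parameters. *)
Lemma excess_not_full (rnd : R -> nat) :
  (forall t, 0 <= t -> `|(rnd t)%:R - t| < 1) ->
  exists s1 s2 : 'rV[R]_d -> 'rV[R]_d -> nat -> R,
  [/\ forall lam x, regular lam x -> \forall n \near \oo, s1 lam x n = 0,
      littleo_unif regular s2 (fun n => n%:R `^ (- (4 / (q + 4)))) &
      forall lam x n, regular lam x ->
        simplex (boundary_point J (rnd (tau lam x n)) lam x) ->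
        excess lam x n (rnd (tau lam x n)) = s1 lam x n + s2 lam x n].
Proof.
move=> rndP; pose Q K n := forall lam x, regular lam x -> regular_K K lam x ->
    simplex (boundary_point J (rnd (tau lam x n)) lam x) ->
    `|excess lam x n (rnd (tau lam x n))| <= n%:R `^ (- (4 / (q + 4))) * K.+1%:R^-1.
have [kk kkoo kkP] := @diagonal_threshold Q (fun K => @excess_uniform rnd K rndP).
pose ok lam x n := `[< regular lam x /\
  simplex (boundary_point J (rnd (tau lam x n)) lam x) >].
pose ok2 lam x n := `[< regular_K (kk n) lam x >] && (0 < kk n)%N.
exists (fun lam x n => if ok lam x n && ~~ ok2 lam x n then
  excess lam x n (rnd (tau lam x n)) else 0).
exists (fun lam x n => if ok lam x n && ok2 lam x n then
  excess lam x n (rnd (tau lam x n)) else 0).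
split.
- move=> lam x reg; have [K KP] := regular_K_ex reg.
  apply: filterS (filterI (kkoo K) (kkoo 1%N)) => n [Kn k0].
  have -> : ok2 lam x n by rewrite /ok2 k0 andbT; apply/asboolP; exact: regular_K_le KP.
  by rewrite andbF.
- move=> lam e e0; have [K Ke] := inv_natr_le e0.
  apply: filterS (kkoo K) => n Kn x reg.
  have p0 : 0 <= n%:R `^ (- (4 / (q + 4))) :> R by exact: powR_ge0.
  rewrite (ger0_norm p0); case: ifP => [/andP[/asboolP[_ yS] /andP[/asboolP rK k0]]|_].
    apply: le_trans (kkP n k0 lam x reg rK yS) _; rewrite mulrC ler_wpM2r //.
    by apply: le_trans Ke; rewrite lef_pV2 ?posrE ?ltr0Sn // ler_nat.
  by rewrite normr0 mulr_ge0 // ltW.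
move=> lam x n reg yS; have -> : ok lam x n by apply/asboolP.
by case: (ok2 lam x n); rewrite /= ?add0r ?addr0.
Qed.

End OptimalMSE.

Theorem corollary1 (R : realType) (d : nat) (d_gt0 : (0 < d)%N)
    (f fext : 'rV[R]_d -> R) (U : set 'rV[R]_d)
    (f_density : simplex_density f)
    (f_C2 : C2_on int_simplex f)
    (U_open : open U) (simplex_U : simplex `<=` U)
    (fext_f : forall x, simplex x -> fext x = f x)
    (fext_C2 : C2_on U fext)
    (J : {set 'I_d}) :
  let q : R := (d + #|J|)%:R in
  let not_full : R := (J != [set: 'I_d]%SET)%:R in
  (exists C1 C3 : 'rV[R]_d -> R,
   forall m : nat -> nat, m n @[n --> \oo] --> \oo ->
   exists r1 r2 r3 r4 : 'rV[R]_d -> 'rV[R]_d -> nat -> R,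
   [/\ bigO_unif C1 (fun lam x => admissible J lam x)
         (fun lam x n => r1 lam x n) (fun n => (m n)%:R^-1),
       littleo_unif (fun x lam => admissible J lam x)
         (fun x lam n => r2 lam x n) (fun=> 1),
       bigO_unif C3 (fun lam x => admissible J lam x)
         (fun lam x n => r3 lam x n) (fun n => (m n)%:R ^- 3) &
       littleo_unif (fun lam x => admissible J lam x)
         (fun lam x n => r4 lam x n) (fun n => (m n)%:R ^- 2)] /\
   forall (disp : measure_display) (T : measurableType disp)
     (P : probability T R) (X : nat -> {RV P >-> d.-tuple R}),
   iid_density X f ->
   forall lam x : 'rV[R]_d, admissible J lam x ->
   forall n : nat, (0 < n)%N -> (0 < m n)%N ->
   simplex (boundary_point J (m n) lam x) ->
   MSE X f n (m n) (boundary_point J (m n) lam x) =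
   (MSE_lead f fext J lam x n (m n)%:R
    + n%:R^-1 * (m n)%:R `^ (q / 2) * (r1 lam x n + r2 lam x n * not_full)
    + r3 lam x n + r4 lam x n * not_full)%:E)
  /\
  (forall lam x : 'rV[R]_d, admissible J lam x ->
   bcoef fext J x != 0 -> vcoef f J lam x != 0 ->
   forall n : nat, (0 < n)%N ->
   0 < m_opt f fext J lam x n /\
   forall t : R, 0 < t -> t != m_opt f fext J lam x n ->
     MSE_lead f fext J lam x n (m_opt f fext J lam x n)
     < MSE_lead f fext J lam x n t)
  /\
  (exists C : 'rV[R]_d * 'rV[R]_d -> R,
   forall rnd : R -> nat, (forall t, 0 <= t -> `|(rnd t)%:R - t| < 1) ->
   exists s1 s2 : 'rV[R]_d -> 'rV[R]_d -> nat -> R,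
   let D lam x := [/\ admissible J lam x, bcoef fext J x != 0 &
                      vcoef f J lam x != 0] in
   [/\ bigO_unif C (fun lamx (_ : unit) => D lamx.1 lamx.2)
         (fun lamx _ n => s1 lamx.1 lamx.2 n)
         (fun n => n%:R `^ (- (6 / (q + 4)))
                   + not_full * n%:R `^ (- (5 / (q + 4)))) &
       littleo_unif D (fun lam x n => s2 lam x n)
         (fun n => n%:R `^ (- (4 / (q + 4))))] /\
   forall (disp : measure_display) (T : measurableType disp)
     (P : probability T R) (X : nat -> {RV P >-> d.-tuple R}),
   iid_density X f ->
   forall lam x : 'rV[R]_d, D lam x ->
   forall n : nat, (0 < n)%N ->
   let m := rnd (m_opt f fext J lam x n) in
   (0 < m)%N -> simplex (boundary_point J m lam x) ->
   MSE X f n m (boundary_point J m lam x) =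
   (MSE_opt f fext J lam x n + s1 lam x n + s2 lam x n * not_full)%:E).
Proof.
move=> q not_full.
have [_ f_ge0 f_out _] := f_density.
have [M fM] : exists M, forall x, `|f x| <= M.
  by apply: (bounded_on_simplex fext_f f_out) => x /simplex_U/fext_C2[].
have errorsE disp (T : measurableType disp) (P : probability T R)
    (X : nat -> {RV P >-> d.-tuple R}) n m lam x : iid_density X f ->
    (0 < n)%N -> (0 < m)%N -> MSE X f n m (boundary_point J m lam x) =
    (MSE_lead f fext J lam x n m%:R +
     n%:R^-1 * m%:R `^ (q / 2) * variance_error f J lam x m +
     bias_error f fext J lam x m)%:E by exact: MSE_errors.
split; last split.
- rewrite /not_full; have [JT|JN] := eqVneq J [set: 'I_d]%SET.
    have [C0 CP] := expansion_full d_gt0 U_open simplex_U fext_f fext_C2 fM.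
    pose C lam := `|C0 lam|.
    exists C, C => m moo.
    exists (fun lam x n => variance_error f J lam x (m n)), (fun _ _ _ => 0).
    exists (fun lam x n => bias_error f fext J lam x (m n)), (fun _ _ _ => 0).
    have bounds lam : (exists x, admissible J lam x) -> \forall n \near \oo, forall x,
        `|variance_error f J lam x (m n)| <= C lam * `|(m n)%:R^-1| /\
        `|bias_error f fext J lam x (m n)| <= C lam * `|(m n)%:R ^- 3|.
      move=> [x0 [lam0 _ _]]; have lam0' j : 0 <= lam ord0 j by apply: lam0; rewrite JT inE.
      have near_m : \forall n \near \oo, forall x,
          `|variance_error f [set: 'I_d] lam x (m n)| <= C0 lam / (m n)%:R /\
          `|bias_error f fext [set: 'I_d] lam x (m n)| <= C0 lam / (m n)%:R ^+ 3.
        exact: (moo _ (CP lam lam0')).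
      apply: filterS near_m => n mP x; have [h1 h2] := mP x; rewrite JT; split.
        rewrite ger0_norm ?invr_ge0 //; apply: le_trans h1 _.
        by rewrite ler_wpM2r ?invr_ge0 // ler_norm.
      rewrite [`|_ ^- 3|]ger0_norm ?invr_ge0 ?exprn_ge0 //; apply: le_trans h2 _.
      by rewrite ler_wpM2r ?invr_ge0 ?exprn_ge0 // ler_norm.
    split; first split.
    + move=> lam; have [ex|nex] := pselect (exists x, admissible J lam x).
        by apply: filterS (bounds lam ex) => n nP x _; have [] := nP x.
      by exists 0%N => // n _ x ad; exfalso; apply: nex; exists x.
    + by move=> x e e0; apply: nearW => n lam _; rewrite normr0 mulr_ge0 // ltW.
    + move=> lam; have [ex|nex] := pselect (exists x, admissible J lam x).
        by apply: filterS (bounds lam ex) => n nP x _; have [] := nP x.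
      by exists 0%N => // n _ x ad; exfalso; apply: nex; exists x.
    + by move=> lam e e0; apply: nearW => n x _; rewrite normr0 mulr_ge0 // ltW.
    move=> disp T P X iidX lam x ad n n0 m0 yS; rewrite errorsE //; congr EFin.
    by rewrite !mul0r !addr0.
  exists (fun=> 0), (fun=> 0) => m moo.
  have [r1 [r2 [r3 [r4 [bounds rE]]]]] :=
    expansion_not_full J d_gt0 U_open simplex_U fext_f fext_C2 fM moo.
  exists r1, r2, r3, r4; split => // disp T P X iidX lam x ad n n0 m0 yS.
  rewrite errorsE //; congr EFin; rewrite !mulr1 -!addrA; congr (_ + _).
  by rewrite rE ?addrA //; apply/asboolP; split.
- move=> lam x ad b0 v0 n n0.
  have reg : regular f fext J lam x by split.
  have v_gt0 := regular_v_gt0 f_ge0 reg; have b_gt0 := regular_b2_gt0 reg.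
  have q_gt0 : 0 < q by rewrite ltr0n addn_gt0 d_gt0.
  have n0R : 0 < n%:R :> R by rewrite ltr0n.
  split; first exact: optimum_gt0.
  move=> t t0 t_opt; exact: (optimum_strict n0R v_gt0 b_gt0 q_gt0 t0 t_opt).
rewrite /not_full; have [JT|JN] := eqVneq J [set: 'I_d]%SET.
  have [C CP] := excess_full d_gt0 U_open simplex_U fext_f fext_C2 fM f_ge0 JT.
  exists C => rnd rndP.
  exists (fun lam x n => excess f fext J lam x n (rnd (m_opt f fext J lam x n))), (fun _ _ _ => 0).
  split; first split.
  + move=> [lam x]; have [reg|nreg] := pselect (regular f fext J lam x); last first.
      by exists 0%N => // n _ _ reg; exfalso; exact: nreg.
    apply: filterS (CP rnd rndP lam x reg) => n nP _ _ /=.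
    by rewrite mul0r addr0 (ger0_norm (powR_ge0 _ _)).
  + by move=> lam e e0; apply: nearW => n x _; rewrite normr0 mulr_ge0 // ltW.
  move=> disp T P X iidX lam x reg n n0 m0 yS; rewrite errorsE //; congr EFin.
  by rewrite mul0r addr0 /excess -/q; ring.
exists (fun=> 0) => rnd rndP.
have [s1 [s2 [s1P s2P sE]]] :=
  excess_not_full J d_gt0 U_open simplex_U fext_f fext_C2 fM f_ge0 rndP.
exists s1, s2; split; first split => //.
  move=> [lam x]; have [reg|nreg] := pselect (regular f fext J lam x); last first.
    by exists 0%N => // n _ _ reg; exfalso; exact: nreg.
  by apply: filterS (s1P lam x reg) => n /= -> _ _; rewrite normr0 mul0r.
move=> disp T P X iidX lam x reg n n0 m0 yS; rewrite errorsE //; congr EFin.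
by rewrite mulr1 -[RHS]addrA -(sE lam x n reg yS) /excess -/q; ring.
Qed.
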